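(* Let $R$ be a nontrivial commutative ring with identity and let $X$ be a finite-dimensional, locally compact regular CW complex. There exists a set $W$ of face relations $(x\ge y)$ of $\mathrm{Fc}(X)$, closed under composition and contained in the set of those face relations for which $\mathbf{L}^\bullet(x\ge y):\mathbf{L}^\bullet(x)\to\mathbf{L}^\bullet(y)$ induces isomorphisms on cohomology, such that the category $\mathbf{S}=\mathrm{Fc}(X)[W^{-1}]$ obtained from $\mathrm{Fc}(X)$ by formally inverting the relations in $W$ has the following property: two cells of $X$ lie in the same canonical stratum of $X$ if and only if they are isomorphic in $\mathbf{S}$.
   Context: **Cells and local cohomology.** A CW complex is regular if the characteristic map of every cell is an embedding. $\mathrm{Fc}(X)$ is the poset of cells of $X$, where $x\ge y$ means that $y$ is a face of $x$ (equivalently, $x$ is a co-face of $y$; $x\ge x$ always), viewed as a category with one morphism $x\to y$ whenever $x\ge y$. For each cell $x$, $\mathbf{L}^\bullet(x)$ is the cochain complex of $R$-modules in which $\mathbf{L}^d(x)$ is the free $R$-module on the set of $d$-cells $z$ of $X$ with $z\ge x$, with differential $\beta^d_x(z)=\sum_w\langle w,z\rangle_R\,w$, the sum being over all $(d+1)$-cells $w\ge x$, where $\langle w,z\rangle_R\in\{0,\pm1_R\}$ is the $R$-valued degree of the attaching map from the boundary of $w$ onto $z$. For $x\ge y$, $\mathbf{L}^\bullet(x\ge y):\mathbf{L}^\bullet(x)\hookrightarrow\mathbf{L}^\bullet(y)$ is the inclusion of basis cells. **Localization.** For a poset $P$ and a set $\Sigma$ of its order relations closed under composition, $P[\Sigma^{-1}]$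 is the category with object set $P$ receiving a functor $P\to P[\Sigma^{-1}]$, identity on objects, which is universal among functors out of $P$ sending every relation in $\Sigma$ to an isomorphism. **Cohomological stratifications.** $C_c^\bullet$ denotes the compactly-supported singular cochain complex with coefficients in $R$; the compactly-supported cohomology of an open set $U$ may be replaced by $H^\bullet(U\cup\{\infty\},\{\infty\};R)$, where $U\cup\{\infty\}$ is the one-point compactification. A quasi-isomorphism is a cochain map inducing isomorphisms on all cohomology groups. The open cone $\mathscr{C}Z$ is the quotient of $Z\times[0,1)$ identifying $(z,0)$ with $(z',0)$ for all $z,z'\in Z$, and $\mathscr{C}\varnothing$ is a point. An $n$-dimensional (cohomological) stratification of a locally compact Hausdorff space $X$ is an ascending sequence of closed subspaces $\varnothing=X_{-1}\subset X_0\subset\cdots\subset X_n=X$, where the connected components of $X_d-X_{d-1}$ are called the $d$-dimensional strata, satisfying: - *Frontier:* if a stratum $\sigma$ intersects the closure of a stratum $\tau$, then $\sigma\subset\overline{\tau}$ and $\dim\tau\ge\dim\sigma$, with equality if and only if $\tau=\sigma$. This relation, written $\tau\succeq\sigma$, is a partial order on the set of strata. - *Link:* for each $d$-stratum $\sigma$ there is an $(n-d-1)$-dimensional stratified space $\varnothing=L_{-1}\subset L_0\subset\cdots\subset L_{n-d-1}=L$ (the link of $\sigma$) such that every open neighborhood of every point $p\in\sigma$ contains a ''basic'' open neighborhood $U_p\subset X$ of $p$ with $U_p\cap X_i=\varnothing$ for $i<d$, and, for $d\le i\le n$, with quasi-isomorphisms $C_c^\bullet(\mathscr{C}L_{i-d-1}\times\mathbb{R}^d)\to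 C_c^\bullet(U_p\cap X_i)$ that are: (a) filtered: they commute with the contravariant maps $C_c^\bullet(\mathscr{C}L_{i-d}\times\mathbb{R}^d)\to C_c^\bullet(\mathscr{C}L_{i-d-1}\times\mathbb{R}^d)$ and $C_c^\bullet(U_p\cap X_{i+1})\to C_c^\bullet(U_p\cap X_i)$ induced by the inclusions $L_{i-d-1}\subset L_{i-d}$ and $X_i\subset X_{i+1}$; (b) stratum-preserving: there are surjective set-maps $\Phi_i$ from the set of $(i-d-1)$-strata of $L$ to the set of $i$-strata $\tau\succeq\sigma$ of $X$ such that for each $i$-stratum $\tau\succeq\sigma$ the cochain maps restrict to quasi-isomorphisms $C_c^\bullet(\mathscr{C}\Phi_i^{-1}(\tau)\times\mathbb{R}^d)\to C_c^\bullet(U_p\cap\tau)$; (c) refinable: for smaller basic neighborhoods $V_p\subset U_p$, the quasi-isomorphism $C_c^\bullet(\mathscr{C}L_{i-d-1}\times\mathbb{R}^d)\to C_c^\bullet(V_p\cap X_i)$ equals the composite of the quasi-isomorphism $C_c^\bullet(\mathscr{C}L_{i-d-1}\times\mathbb{R}^d)\to C_c^\bullet(U_p\cap X_i)$ with the map $C_c^\bullet(U_p\cap X_i)\to C_c^\bullet(V_p\cap X_i)$ induced by the inclusion $V_p\subset U_p$ (so this last map is also a quasi-isomorphism). **Canonical stratification.** One stratification is a coarsening of another if each stratum of the former is a union of strata of the latter. The canonical stratification of a finite-dimensional regular CW complex $X$ is the coarsest (cohomological) stratification of $X$ whose strata are all unions of cells; its strata are the canonical strata of $X$.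
   Formalization: In the link axiom, (b) uses the cone without its apex for strata above σ; (c) uses the covariant map H_c(V)→H_c(U) in cohomology, as the stated map does not exist; and a basic neighborhood is basic for every point of the stratum it contains. *)

(* Defs.v *)
(* K : realType is the field of real numbers, on which disks, simplices and cones
   are built; R : comNzRingType is the coefficient ring. *)
From HB Require Import structures.
From mathcomp Require Import all_boot all_order all_algebra.
From mathcomp Require Import all_classical all_reals all_analysis.

Set Implicit Arguments.
Unset Strict Implicit.
Unset Printing Implicit Defensive.

Import Order.TTheory GRing.Theory Num.Theory numFieldNormedType.Exports.
Local Open Scope classical_set_scope.
Local Open Scope ring_scope.

(* A category with object set O; composition is in diagrammatic order. *)
Record category (O : Type) := Category {
  hom : O -> O -> Type;
  idm : forall x, hom x x;
  comp : forall x y z, hom x y -> hom y z -> hom x z;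
  comp1m : forall x y (f : hom x y), comp (idm x) f = f;
  compm1 : forall x y (f : hom x y), comp f (idm y) = f;
  compA : forall x y z t (f : hom x y) (g : hom y z) (h : hom z t),
    comp f (comp g h) = comp (comp f g) h }.

(* A functor whose action on objects is F0. *)
Record functor (O O' : Type) (C : category O) (D : category O') (F0 : O -> O')
    := Functor {
  fmap :> forall x y, hom C x y -> hom D (F0 x) (F0 y);
  fmap1 : forall x, fmap (idm C x) = idm D (F0 x);
  fmapM : forall x y z (f : hom C x y) (g : hom C y z),
    fmap (comp f g) = comp (fmap f) (fmap g) }.

Definition is_iso (O : Type) (C : category O) (x y : O) (f : hom C x y) : Prop :=
  exists g : hom C y x, comp f g = idm C x /\ comp g f = idm C y.

Definition isomorphic (O : Type) (C : category O) (x y : O) : Prop :=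
  exists f : hom C x y, is_iso f.

(* Q : C -> S, identity on objects, is the localization of C at Sigma. *)
Definition is_localization (O : Type) (C : category O)
    (Sigma : forall x y, hom C x y -> Prop)
    (S : category O) (Q : functor C S id) : Prop :=
  (forall x y (h : hom C x y), Sigma x y h -> is_iso (Q x y h)) /\
  forall (O' : Type) (D : category O') (F0 : O -> O') (F : functor C D F0),
    (forall x y (h : hom C x y), Sigma x y h -> is_iso (F x y h)) ->
    exists G : functor S D F0,
      (forall x y (h : hom C x y), G x y (Q x y h) = F x y h) /\
      forall G' : functor S D F0,
        (forall x y (h : hom C x y), G' x y (Q x y h) = F x y h) ->
        forall x y (s : hom S x y), G' x y s = G x y s.

(* All the complexes used below consist of R-valued functions: the k-cochains are
   the functions on gen k that lie in the submodule cochains k.  Only the values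
   of dif on cochains matter. *)
Record complex (R : comNzRingType) := Complex {
  gen : nat -> Type;
  cochains : forall k, set (gen k -> R);
  dif : forall k, (gen k -> R) -> gen k.+1 -> R }.

Section Complexes.
Variable R : comNzRingType.
Implicit Types C D : complex R.

Definition cocycle C k : set (gen C k -> R) :=
  [set c | cochains c /\ dif c = 0].

Definition coboundary C k : set (gen C k -> R) :=
  match k with
  | 0 => [set 0]
  | k'.+1 => [set dif b | b in @cochains R C k']
  end.

Definition is_cochain_map C D
    (f : forall k, (gen C k -> R) -> gen D k -> R) : Prop :=
  [/\ forall k (c : gen C k -> R), cochains c -> cochains (f k c),
      forall k (a : R) (c c' : gen C k -> R), cochains c -> cochains c' ->
        f k (fun g => a * c g + c' g) = (fun g => a * f k c g + f k c' g)
    & forall k (c : gen C k -> R), cochains c -> f k.+1 (dif c) = dif (f k c)].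

Definition quasi_iso C D
    (f : forall k, (gen C k -> R) -> gen D k -> R) : Prop :=
  is_cochain_map f /\
  forall k,
    (forall c, @cocycle C k c -> @coboundary D k (f k c) -> @coboundary C k c)
    /\ (forall b, @cocycle D k b ->
          exists2 c, @cocycle C k c & @coboundary D k (f k c - b)).

End Complexes.

Section Simplex.
Variable K : realType.

Definition stdsimplex (k : nat) : set 'rV[K]_k.+1 :=
  [set t | (forall i, 0 <= t 0 i) /\ \sum_i t 0 i = 1].
Arguments stdsimplex k : clear implicits.

Definition insert0 (k : nat) (i : 'I_k.+2) (t : 'rV[K]_k.+1) : 'rV[K]_k.+2 :=
  \row_j (if unlift i j is Some j' then t 0 j' else 0).

Lemma insert0_stdsimplex k (i : 'I_k.+2) (t : stdsimplex k) :
  insert0 i (set_val t) \in stdsimplex k.+1.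
Proof.
have [t0 t1] := set_mem (valP t); apply/mem_set; split.
  by move=> j; rewrite mxE; case: unlift.
rewrite (bigD1_ord i) //= mxE unlift_none add0r -[RHS]t1.
by apply: eq_bigr => j _; rewrite mxE liftK.
Qed.

Definition coface (k : nat) (i : 'I_k.+2) (t : stdsimplex k) :
  stdsimplex k.+1 :=
  exist (fun t => t \in stdsimplex k.+1) _ (insert0_stdsimplex i t).

Lemma insert0_continuous k (i : 'I_k.+2) : continuous (insert0 (k:=k) i).
Proof.
move=> t A [P tP PA] /=.
pose Q (a : 'I_1) (j : 'I_k.+1) : set K := P 0 (lift i j).
exists Q => [a j|s Qs].
  by rewrite /Q ord1; have := tP 0 (lift i j); rewrite mxE liftK.
apply: PA => a j; rewrite ord1 !mxE.
case: unliftP => [j' ->|->]; first exact: Qs.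
by have /nbhs_singleton := tP 0 i; rewrite mxE unlift_none.
Qed.

Lemma coface_continuous k (i : 'I_k.+2) : continuous (coface (k:=k) i).
Proof.
apply/continuousP => A [B oB <-].
rewrite [X in open X](_ : _ = set_val @^-1` (insert0 i @^-1` B)) //.
exists (insert0 i @^-1` B) => //.
by move/continuousP: (@insert0_continuous k i) => /(_ B oB).
Qed.

HB.instance Definition _ k (i : 'I_k.+2) :=
  @isContinuous.Build (stdsimplex k) (stdsimplex k.+1) (coface i)
    (@coface_continuous k i).

Definition singular (T : topologicalType) (k : nat) : Type :=
  continuousType (stdsimplex k) T.

Definition sface (T : topologicalType) (k : nat) (i : 'I_k.+2)
  (s : singular T k.+1) : singular T k := s \o coface i.

End Simplex.

Arguments stdsimplex K k : clear implicits.
Arguments singular K T k : clear implicits.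

Section CompactSupport.
Variables (K : realType) (R : comNzRingType).

Definition sdif (T : topologicalType) k (c : singular K T k -> R)
    (s : singular K T k.+1) : R :=
  \sum_(i < k.+2) (-1) ^+ i * c (sface i s).

Definition supported_in (T : topologicalType) (A : set T) k
    (c : singular K T k -> R) : Prop :=
  exists B : set T, [/\ compact B, B `<=` A &
    forall s : singular K T k, c s != 0 -> range s `&` B !=set0].

(* C_c(A;R) for a subspace A of T.  A cochain of A is stored as a function on
   the singular simplices of T that vanishes on those not contained in A. *)
Definition Cc (T : topologicalType) (A : set T) : complex R :=
  @Complex R (singular K T)
    (fun k => [set c | (forall s : singular K T k, c s != 0 -> range s `<=` A)
                       /\ supported_in A c])
    (fun k c s => if `[< range s `<=` A >] then sdif c s else 0).

Definition restrict (T : topologicalType) (A : set T) k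
    (c : singular K T k -> R) (s : singular K T k) : R :=
  if `[< range s `<=` A >] then c s else 0.

(* The map H_c(V) -> H_c(Y) induced by the inclusion of an open subset V of Y,
   as a relation between cocycles a of V and b of Y.  On singular cochains,
   extension by zero commutes with the differential only up to excision: the
   class of a is represented by a cocycle c of Y that is compactly supported
   inside V. *)
Definition extends_by_zero (T : topologicalType) (V Y : set T) k
    (a b : singular K T k -> R) : Prop :=
  exists c : singular K T k -> R,
    [/\ @cocycle R (Cc Y) k c,
        supported_in V c,
        @coboundary R (Cc V) k (restrict V c - a)
      & @coboundary R (Cc Y) k (c - b)].

End CompactSupport.

Section Cone.
Variable K : realType.

(* The open cone on Z: its apex None, and the points (z, t) with 0 < t < 1.
   The cone on an empty space is the apex alone. *)
Definition cone (Z : topologicalType) : Type :=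
  option (Z * set_type (`]0, 1[%classic : set K)).

Definition cone_proj (Z : topologicalType)
    (p : Z * set_type (`[0, 1[%classic : set K)) : cone Z :=
  omap (pair p.1) (insub (set_val p.2)).

Section ConeTopology.
Variable Z : topologicalType.

HB.instance Definition _ := Choice.on (cone Z).

(* The quotient topology: U is open iff its preimage in Z x [0, 1[ is. *)
Definition cone_open : set (set (cone Z)) :=
  [set U | open (@cone_proj Z @^-1` U)].

Let cone_openT : cone_open setT.
Proof. exact: openT. Qed.

Let cone_openI : setI_closed cone_open.
Proof. by move=> A B oA oB; exact: openI. Qed.

Let cone_open_bigU (I : Type) (f : I -> set (cone Z)) :
  (forall i, cone_open (f i)) -> cone_open (\bigcup_i f i).
Proof.
move=> oF; rewrite /cone_open /mkset preimage_bigcup.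
by apply: bigcup_open => i _; exact: oF.
Qed.

HB.instance Definition _ :=
  isOpenTopological.Build (cone Z) cone_openT cone_openI cone_open_bigU.

End ConeTopology.

(* For B a subset of Z: the product with R^d of the cone on B, respectively of
   the cone on B deprived of its apex. *)
Definition cone_over (Z : topologicalType) (d : nat) (B : set Z) :
    set (cone Z * 'rV[K]_d) :=
  [set p | if p.1 is Some (z, _) then B z else True].

Definition punctured_cone_over (Z : topologicalType) (d : nat) (B : set Z) :
    set (cone Z * 'rV[K]_d) :=
  [set p | if p.1 is Some (z, _) then B z else False].

End Cone.

(* A filtration with N + 1 terms F 0, ..., F N stands for X_{-1}, ..., X_{N-1}:
   F i is X_{i-1}, and the dimension of the stratification is n = N - 1, which
   is -1 for the empty space. *)
Section Strata.
Variables (T : topologicalType) (N : nat) (F : nat -> set T).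

Definition filtration : Prop :=
  [/\ F 0 = set0, F N = setT,
      forall i, (i < N)%N -> F i `<=` F i.+1
    & forall i, (i <= N)%N -> closed (F i)].

Definition layer (d : nat) : set T := F d.+1 `\` F d.

Definition stratum (d : nat) (S : set T) : Prop :=
  (d < N)%N /\ exists2 x, layer d x & S = connected_component (layer d) x.

(* That S <= closure S' is then a partial order on strata is a consequence. *)
Definition frontier : Prop :=
  forall s d (S S' : set T), stratum s S -> stratum d S' ->
    S `&` closure S' !=set0 ->
    [/\ S `<=` closure S', (s <= d)%N & (s = d <-> S = S')].

End Strata.

(* The order on strata: S' lies above S. *)
Definition stratum_le (T : topologicalType) (S S' : set T) : Prop :=
  S `<=` closure S'.

Section Stratification.
Variables (K : realType) (R : comNzRingType).

Section Link.
Variables (T : topologicalType) (N : nat) (F : nat -> set T).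
Variables (d : nat) (S : set T).
Variables (L : topologicalType) (G : nat -> set L).
Variable Phi : nat -> set L -> set T.

Let M := (N - d.+1)%N.

Definition link_labels : Prop :=
  forall i, (d < i < N)%N ->
    (forall l, stratum M G (i - d.+1) l ->
       stratum N F i (Phi i l) /\ stratum_le S (Phi i l)) /\
    (forall S', stratum N F i S' -> stratum_le S S' ->
       exists2 l, stratum M G (i - d.+1) l & Phi i l = S').

(* C L_{i-d-1} x R^d; recall that L_{i-d-1} is G (i - d). *)
Definition model (i : nat) : set (cone K L * 'rV[K]_d) :=
  cone_over (G (i - d)).

(* The piece of the model that corresponds to the i-stratum S' >= S.  For i > d
   it is the stratum of the cone spanned by the strata Phi_i^-1(S') of L, that
   is, the cone on them without the apex, as the apex lies in the stratum of the
   model that corresponds to S.  With the apex the condition would fail for the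
   stratum ]0, +oo[ of R above the stratum 0: the cone with apex over a point,
   [0, 1[, has no compactly supported cohomology.  For i = d, S' is S and the
   piece is the cone on the empty set, the apex times R^d. *)
Definition model_stratum (i : nat) (S' : set T) : set (cone K L * 'rV[K]_d) :=
  if i == d then cone_over set0
  else punctured_cone_over
    (\bigcup_(l in [set l | stratum M G (i - d.+1) l /\ Phi i l = S']) l).

Definition basic_neighborhood (U : set T)
    (f : nat -> forall k, (singular K (cone K L * 'rV[K]_d)%type k -> R) ->
                          singular K T k -> R) : Prop :=
  [/\ open U,
      forall i, (i < d)%N -> U `&` F i.+1 = set0,
      forall i, (d <= i < N)%N ->
        @quasi_iso R (Cc K R (model i)) (Cc K R (U `&` F i.+1)) (f i),
      forall i, (d <= i)%N -> (i.+1 < N)%N ->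
        forall k c, @cochains R (Cc K R (model i.+1)) k c ->
          f i k (restrict (model i) c) =
          restrict (U `&` F i.+1) (f i.+1 k c)
    & forall i S', (d <= i < N)%N -> stratum N F i S' -> stratum_le S S' ->
        exists2 g, @quasi_iso R (Cc K R (model_stratum i S'))
                                (Cc K R (U `&` S')) g &
          forall k a b, @cocycle R (Cc K R (model_stratum i S')) k a ->
            @cocycle R (Cc K R (model i)) k b ->
            extends_by_zero (model_stratum i S') (model i) a b ->
            extends_by_zero (U `&` S') (U `&` F i.+1) (g k a) (f i k b)].

(* basic is the collection of basic open sets; its members that contain a point
   p of S are the basic neighborhoods of p, each with its own maps f p U.  So a
   basic set that contains two points of S is a basic neighborhood of both, but
   the maps attached to different points are not compared (the cohomology of the
   basic neighborhoods may have monodromy along S).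
   The last clause says that the maps are refinable.  Compactly supported
   cohomology is covariant for open inclusions, so the inclusion of V in U
   induces H_c(V n X_i) -> H_c(U n X_i), and f p U is the composite of f p V with
   this map. *)
Definition link : Prop :=
  exists (basic : set (set T))
    (f : T -> set T ->
         nat -> forall k, (singular K (cone K L * 'rV[K]_d)%type k -> R) ->
                          singular K T k -> R),
    [/\ forall p U, S p -> open U -> U p ->
          exists V, [/\ basic V, V p & V `<=` U],
        forall p U, S p -> basic U -> U p -> basic_neighborhood U (f p U)
      & forall p U V, S p -> basic U -> basic V -> V p -> V `<=` U ->
          forall i k z, (d <= i < N)%N -> @cocycle R (Cc K R (model i)) k z ->
            extends_by_zero (V `&` F i.+1) (U `&` F i.+1)
              (f p V i k z) (f p U i k z)].

End Link.

Inductive stratification (T : topologicalType) (N : nat) (F : nat -> set T) :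
    Prop :=
  Stratification of
    hausdorff_space T & locally_compact [set: T] &
    filtration N F & frontier N F &
    (forall d S, stratum N F d S ->
       exists (L : topologicalType) (G : nat -> set L)
              (Phi : nat -> set L -> set T),
         [/\ stratification (N - d.+1) G,
             link_labels N F d S G Phi
           & link N F d S G Phi]).

End Stratification.

Definition strata (T : topologicalType) (N : nat) (F : nat -> set T) :
    set (set T) :=
  [set S | exists d, stratum N F d S].

(* The stratification (N, F) is a coarsening of (N', F'). *)
Definition coarsening (T : topologicalType) (N : nat) (F : nat -> set T)
    (N' : nat) (F' : nat -> set T) : Prop :=
  forall S, strata N F S ->
    exists2 A, A `<=` strata N' F' & S = \bigcup_(S' in A) S'.

Section CW.
Variable K : realType.

Definition simplex_interior (d : nat) : set (stdsimplex K d) :=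
  [set t | forall i, 0 < (set_val t : 'rV[K]_d.+1) 0 i].

Definition embedding (T T' : topologicalType) (f : T -> T') : Prop :=
  [/\ continuous f, injective f &
      forall U, open U -> exists2 V, open V & U = f @^-1` V].

(* The closed d-disc is modelled by the standard d-simplex, so that the
   characteristic map of a cell is also a singular simplex that represents the
   fundamental class of the cell modulo its boundary. *)
Record regular_CW (T : topologicalType) := RegularCW {
  cell : nat -> choiceType;
  chi : forall d, cell d -> singular K T d;
  open_cell : {d : nat & cell d} -> set T :=
    fun c => chi (tagged c) @` @simplex_interior (tag c);
  CW_hausdorff : hausdorff_space T;
  CW_embedding : forall d (c : cell d), embedding (chi c);
  CW_partition : forall p : T, exists! c, open_cell c p;
  CW_boundary : forall d (c : cell d), exists B : set {d : nat & cell d},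
    [/\ finite_set B, forall b, B b -> (tag b < d)%N &
        chi c @` (~` @simplex_interior d) `<=` \bigcup_(b in B) open_cell b];
  CW_weak : forall A : set T,
    (forall d (c : cell d), closed (chi c @^-1` A)) -> closed A }.

Section Cells.
Variables (R : comNzRingType) (T : topologicalType) (X : regular_CW T).

Definition cells : Type := {d : nat & cell X d}.

Definition finite_dimensional : Prop :=
  exists n, forall d, (n < d)%N -> cell X d -> False.

(* face x y is x >= y. *)
Definition face (x y : cells) : Prop :=
  open_cell y `<=` closure (open_cell x).

Lemma face_refl x : face x x.
Proof. exact: subset_closure. Qed.

Lemma face_trans x y z : face x y -> face y z -> face x z.
Proof.
move=> xy yz; apply: (subset_trans yz).
have /closure_id -> := @closed_closure _ (open_cell x).
exact: closureS.
Qed.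

Definition Fc : category cells :=
  @Category cells face face_refl face_trans
    (fun _ _ _ => Prop_irrelevance _ _) (fun _ _ _ => Prop_irrelevance _ _)
    (fun _ _ _ _ _ _ _ => Prop_irrelevance _ _).

Definition skeleton (d : nat) : set T :=
  \bigcup_(c in [set c : cells | (tag c <= d)%N]) open_cell c.

(* r is the degree over z of the attaching map of w: the image of the
   fundamental class of the boundary of w under
   H_d(X^d) -> H_d(X^d, X^d - z) = R [chi z] is r [chi z].  At the chain level,
   the boundary of chi w is r (chi z) + (boundary of b) + e with b a chain of X^d
   and e a chain of X^d - z.  Chains are formal sums, and an equality of chains
   is expressed by evaluating arbitrary cochains c on both sides. *)
Definition is_degree (d : nat) (w : cell X d.+1) (z : cell X d) (r : R) : Prop :=
  exists (b : seq (R * singular K T d.+1)) (e : seq (R * singular K T d)),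
    [/\ forall p, p \in b -> range p.2 `<=` skeleton d,
        forall p, p \in e -> range p.2 `<=`
          skeleton d `\` open_cell (existT (cell X) d z)
      & forall c : singular K T d -> R,
          sdif c (chi w) = r * c (chi z) + \sum_(p <- b) p.1 * sdif c p.2
                           + \sum_(p <- e) p.1 * c p.2].

Definition incidence (d : nat) (w : cell X d.+1) (z : cell X d) : R :=
  xget 0 (is_degree w z).

(* The complex L(x); a d-cochain is a finitely supported function on the d-cells
   that vanishes on the cells that are not cofaces of x. *)
Definition local_cochains (x : cells) : complex R :=
  @Complex R (cell X)
    (fun d => [set c | finite_set [set z | c z != 0] /\
       forall z, c z != 0 -> face (existT (cell X) d z) x])
    (fun d c w => if `[< face (existT (cell X) d.+1 w) x >]
       then \sum_(z \in [set z | face (existT (cell X) d z) x])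
              incidence w z * c z
       else 0).

(* The inclusion of basis cells L(x) -> L(y), for x >= y, extends coefficient
   functions by zero; both complexes consist of functions on all cells. *)
Definition local_incl (x y : cells) (d : nat) (c : cell X d -> R) :
  cell X d -> R := c.

End Cells.

Section Canonical.
Variables (R : comNzRingType) (T : topologicalType) (X : regular_CW T).

Definition cellular (N : nat) (F : nat -> set T) : Prop :=
  forall S, strata N F S ->
    exists A : set (cells X), S = \bigcup_(c in A) open_cell c.

Definition canonical_stratification (N : nat) (F : nat -> set T) : Prop :=
  [/\ stratification K R N F, cellular N F &
      forall N' F', stratification K R N' F' -> cellular N' F' ->
        coarsening N F N' F'].

Definition same_stratum (N : nat) (F : nat -> set T) (x y : cells X) : Prop :=
  exists2 S, strata N F S & open_cell x `<=` S /\ open_cell y `<=` S.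

End Canonical.
End CW.

(* Main.v *)
(* The relations in W are those between cells of the same canonical stratum S.

   Let x >= y be such cells and let c be a point of the cell y.  The complex L(y)
   computes the cohomology of T relative to the complement of the open star of y,
   as one sees by adding the cells of the star dimension by dimension; this is also
   the cohomology of T relative to T - c, because T - c retracts cell by cell to the
   complement of the star.  For basic neighborhoods V < U of a point of S, the
   refinability of the quasi-isomorphisms with the cone on the link shows that
   H_c(V) -> H_c(U) is an isomorphism; letting V shrink to the point p (a telescope
   of cochains, finite on each simplex that misses p) the cohomology of T relative
   to T - p is H_c(U).  A basic neighborhood U of a point of y contained in the star
   of y meets x, so that H(L(x)) and H(L(y)) are both H_c(U), compatibly with the
   inclusion.

   In the localization at W, cells of the same stratum are isomorphic since the
   stratum is connected and the isomorphism classes of its cells are open in it.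
   Conversely, sending a cell to its stratum is a functor to the poset of strata
   that inverts W, and isomorphic objects of a poset are equal.

   Two classical facts are needed on the way.  In a regular complex a cell that
   meets a closed cell is contained in it: this rests on invariance of domain,
   which is deduced from a cochain-level Borsuk-Ulam theorem.  The degree of an
   attaching map exists as a chain identity: the tautological cochain with values
   in the functionals modulo those of the required form is a coboundary on X^d. *)
Require Import Defs.
From HB Require Import structures.
From mathcomp Require Import all_boot all_order all_algebra.
From mathcomp Require Import all_classical all_reals all_analysis.
From mathcomp Require Import ring lra zify.

Set Implicit Arguments.
Unset Strict Implicit.
Unset Printing Implicit Defensive.

Import Order.TTheory GRing.Theory Num.Theory numFieldNormedType.Exports.
Local Open Scope classical_set_scope.
Local Open Scope ring_scope.

(** * Subdivision and homotopies of singular cochains *)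

(** Every group in play (cohomology of T relative to a costar or to the complement of a point,
    compactly supported cohomology of an open set) is realized by cochains on the whole of T that
    vanish on the simplices of some subset. Restriction of supports and extension by zero then leave
    the cochain alone and change only the subset, and all comparisons become statements about
    primitives with prescribed vanishing. Two tools produce such primitives: [small2], a form of
    excision, and the prism operator [hprism] of a homotopy. Both come from one recursive formula,
    the homotopy [ohtp] that cones repeatedly to an apex. It needs no chains: the value of a cochain
    on an affine simplex is a function of the list of its vertices, and subdivision and prisms are
    operators on such functions. *)

Section OrderedCochains.
Variable M : zmodType.

Lemma subrACA (x y z t : M) : x - y - (z - t) = x - z - (y - t).
Proof. by rewrite !opprB addrACA [- y + _]addrC [RHS]addrACA. Qed.

(** The coboundary of ordered simplicial cochains, as a recursive form of the alternating sum over
    deletions ([dlo_sum]). The empty list counts as a simplex of degree -1: the complex is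
    augmented. *)
Fixpoint dlo (W : Type) (f : seq W -> M) (l : seq W) : M :=
  if l is x :: l' then f l' - dlo (fun t => f (x :: t)) l' else 0.

Definition ocone (W : Type) (b : W) (f : seq W -> M) : seq W -> M :=
  fun l => f (b :: l).

Definition lin (W : eqType) (D : set W) (l : seq W) : Prop :=
  forall x, x \in l -> D x.

Lemma lin_cons (W : eqType) (D : set W) x l : lin D (x :: l) <-> D x /\ lin D l.
Proof.
split=> [h|[Dx Dl] y].
  by split=> [|y yl]; apply: h; rewrite inE ?eqxx ?yl ?orbT.
by rewrite inE => /predU1P[->|/Dl].
Qed.

Lemma dloD (W : Type) (f g : seq W -> M) l :
  dlo (fun t => f t + g t) l = dlo f l + dlo g l.
Proof.
elim: l f g => [|x l IH] f g /=; first by rewrite addr0.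
by rewrite (IH (fun t => f (x :: t))) opprD addrACA.
Qed.

Lemma dloN (W : Type) (f : seq W -> M) l : dlo (fun t => - f t) l = - dlo f l.
Proof.
elim: l f => [|x l IH] f /=; first by rewrite oppr0.
by rewrite (IH (fun t => f (x :: t))) opprD.
Qed.

Lemma dloB (W : Type) (f g : seq W -> M) l :
  dlo (fun t => f t - g t) l = dlo f l - dlo g l.
Proof. by rewrite (dloD f (fun t => - g t)) dloN. Qed.

Lemma dlo0 (W : Type) (l : seq W) : dlo (fun=> 0) l = 0.
Proof. by elim: l => //= x l ->; rewrite subr0. Qed.

Lemma dlo_local (W : eqType) (D : set W) (f g : seq W -> M) l : lin D l ->
  (forall t, (size t).+1 = size l -> lin D t -> f t = g t) -> dlo f l = dlo g l.
Proof.
elim: l f g => [//|x l IH] f g /lin_cons[Dx Dl] fg /=.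
rewrite fg //; congr (_ - _); apply: IH => // t st Dt.
by apply: fg; [rewrite /= st|apply/lin_cons].
Qed.

Lemma dlo_eq (W : eqType) (f g : seq W -> M) l :
  (forall t, (size t).+1 = size l -> f t = g t) -> dlo f l = dlo g l.
Proof. by move=> fg; apply: (@dlo_local _ setT) => // t st _; exact: fg. Qed.

Lemma dlo_dlo (W : Type) (f : seq W -> M) l : dlo (dlo f) l = 0.
Proof.
elim: l f => [//|x l IH] f /=.
by rewrite (dloB f) IH subr0 subrr.
Qed.

Lemma dlo_map (W W' : Type) (a : W -> W') (f : seq W' -> M) l :
  dlo (fun t => f (map a t)) l = dlo f (map a l).
Proof.
elim: l f => [//|x l IH] f /=.
by rewrite (IH (fun t => f (a x :: t))).
Qed.

Lemma dlo_sum (W : Type) (f : seq W -> M) l :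
  dlo f l = \sum_(i < size l) f (take i l ++ drop i.+1 l) *~ (-1) ^+ i.
Proof.
elim: l f => [|x l IH] f /=; first by rewrite big_ord0.
rewrite big_ord_recl /= drop0 expr0 mulr1z IH; congr (_ + _).
rewrite -sumrN; apply: eq_bigr => i _.
by rewrite /bump /= add1n exprS mulN1r mulrNz.
Qed.

Section Homotopy.
Variables (W W' : eqType) (Phi : (seq W' -> M) -> seq W -> M) (b : seq W -> W').

(* An operator Phi that commutes with dlo is null-homotopic as soon as a natural
   apex b l is available: the homotopy repeatedly cones to the apex. *)
Fixpoint ohtpF n (f : seq W' -> M) (l : seq W) : M :=
  if n is n'.+1 then
    Phi (ocone (b l) f) l - dlo (ohtpF n' (ocone (b l) f)) l
  else 0.

Definition ohtp f l := ohtpF (size l) f l.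

Lemma ohtpE f x l : let l' := x :: l in
  ohtp f l' = Phi (ocone (b l') f) l' - dlo (ohtp (ocone (b l') f)) l'.
Proof.
rewrite /ohtp /=; congr (_ - (_ - _)).
by apply: dlo_eq => t st /=; rewrite -st.
Qed.

Hypothesis PhiB : forall f g l, Phi (fun t => f t - g t) l = Phi f l - Phi g l.

Lemma ohtpB f g l : ohtp (fun t => f t - g t) l = ohtp f l - ohtp g l.
Proof.
have [n] := ubnP (size l); elim: n f g l => // n IH f g [|x l] sl.
  by rewrite /ohtp /= subr0.
rewrite !ohtpE (PhiB (ocone _ f)).
rewrite (@dlo_eq _ _ (fun t => ohtp (ocone (b (x :: l)) f) t
   - ohtp (ocone (b (x :: l)) g) t)).
  by rewrite dloB subrACA.
move=> t st; rewrite -IH //; first by move: sl st => /= ? [->].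
Qed.

Hypothesis Phid : forall f l, dlo (Phi f) l = Phi (dlo f) l.
Hypothesis Phi0 : forall f, Phi f [::] = 0.

(** For the apex c of l, [ocone c (dlo f)] is [f - dlo (ocone c f)]. The induction hypothesis for
    [ocone c f] on the faces of l turns the correction term of [ohtp] into exactly what is
    missing. *)
Lemma ohtp_htp f l : dlo (ohtp f) l + ohtp (dlo f) l = Phi f l.
Proof.
have [n] := ubnP (size l); elim: n f l => // n IH f [|x l] sl.
  by rewrite Phi0 /ohtp /= addr0.
rewrite [ohtp (dlo f) _]ohtpE; set c := b _; set y := x :: l.
have dc : ocone c (dlo f) = (fun t => f t - dlo (ocone c f) t) by [].
rewrite dc PhiB -Phid.
have -> : dlo (ohtp (fun t => f t - dlo (ocone c f) t)) y =
          dlo (ohtp f) y - dlo (Phi (ocone c f)) y.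
  rewrite -[in RHS](subr0 (dlo (Phi _) _)) -(dlo_dlo (ohtp (ocone c f)) y).
  rewrite -!dloB; apply: dlo_eq => t [st]; rewrite ohtpB.
  by rewrite -(IH (ocone c f)) ?st // [dlo _ t + _]addrC addrK.
by rewrite subrACA subrr subr0 addrC subrK.
Qed.

(** Later D and D' are convex sets; the lemma confines the homotopy on a simplex to any convex set
    that contains it. *)
Lemma ohtp_local (D : set W) (D' : set W') f g l :
  (forall l, lin D l -> l <> [::] -> D' (b l)) ->
  (forall f g l, lin D l -> (forall t, lin D' t -> f t = g t) ->
      Phi f l = Phi g l) ->
  lin D l -> (forall t, lin D' t -> f t = g t) -> ohtp f l = ohtp g l.
Proof.
move=> bD PD; have [n] := ubnP (size l).
elim: n f g l => // n IH f g [//|x l] sl Dl fg; rewrite !ohtpE.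
have fgc t : lin D' t -> ocone (b (x :: l)) f t = ocone (b (x :: l)) g t.
  by move=> Dt; apply: fg; apply/lin_cons; split=> //; exact: bD.
rewrite (PD _ _ _ Dl fgc); congr (_ - _).
by apply: (dlo_local Dl) => t [st] Dt; apply: IH => //; rewrite st.
Qed.

End Homotopy.

Lemma ohtp_map (W1 W1' W2 W2' : eqType)
    (Phi1 : (seq W1' -> M) -> seq W1 -> M) (b1 : seq W1 -> W1')
    (Phi2 : (seq W2' -> M) -> seq W2 -> M) (b2 : seq W2 -> W2')
    (a : W1 -> W2) (a' : W1' -> W2') :
  (forall f l, Phi2 f (map a l) = Phi1 (fun t => f (map a' t)) l) ->
  (forall l, l <> [::] -> b2 (map a l) = a' (b1 l)) ->
  forall f l, ohtp Phi2 b2 f (map a l) = ohtp Phi1 b1 (fun t => f (map a' t)) l.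
Proof.
move=> P12 b12 f l; have [n] := ubnP (size l).
elim: n f l => // n IH f [//|x l] sl; rewrite [map a _]/= !ohtpE -[a x :: _]/(map a (x :: l)).
rewrite P12 b12 //; congr (_ - _); rewrite -dlo_map.
by apply: dlo_eq => t [st]; rewrite IH // st.
Qed.

Section Subdivision.
Variables (W : eqType) (b : seq W -> W).

(* With b l the barycentre of l: the subdivision of l is the cone from b l on the
   subdivision of its boundary. *)
Fixpoint osdF n (f : seq W -> M) (l : seq W) : M :=
  if n is n'.+1 then dlo (osdF n' (ocone (b l) f)) l else f l.

Definition osd f l := osdF (size l) f l.

Lemma osdE f x l : osd f (x :: l) = dlo (osd (ocone (b (x :: l)) f)) (x :: l).
Proof.
apply: (@dlo_eq _ (osdF (size l) (ocone (b (x :: l)) f))) => t [st].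
by rewrite /osd st.
Qed.

Lemma osdB f g l : osd (fun t => f t - g t) l = osd f l - osd g l.
Proof.
have [n] := ubnP (size l); elim: n f g l => // n IH f g [//|x l] sl.
rewrite !osdE -dloB; apply: dlo_eq => t [st].
by rewrite -IH // st.
Qed.

Lemma osd_dlo f l : dlo (osd f) l = osd (dlo f) l.
Proof.
have [n] := ubnP (size l); elim: n f l => // n IH f [//|x l] sl.
rewrite [RHS]osdE; set c := b _.
rewrite -[RHS](@dlo_eq _ (fun t => osd f t - dlo (osd (ocone c f)) t)).
  by rewrite dloB dlo_dlo subr0.
by move=> t [st]; rewrite IH ?st // -osdB.
Qed.

Lemma osd_local (D : set W) f g l :
  (forall l, lin D l -> l <> [::] -> D (b l)) -> lin D l ->
  (forall t, lin D t -> f t = g t) -> osd f l = osd g l.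
Proof.
move=> bD; have [n] := ubnP (size l).
elim: n f g l => // n IH f g [|x l] sl Dl fg; first exact: fg.
rewrite !osdE; apply: (dlo_local Dl) => t [st] Dt; apply: IH => // [|t' Dt'].
  by rewrite st.
by apply: fg; apply/lin_cons; split=> //; exact: bD.
Qed.

End Subdivision.

Lemma osd_map (W W' : eqType) (b : seq W -> W) (b' : seq W' -> W')
    (a : W' -> W) :
  (forall l, l <> [::] -> b (map a l) = a (b' l)) ->
  forall f l, osd b f (map a l) = osd b' (fun t => f (map a t)) l.
Proof.
move=> bb f l; have [n] := ubnP (size l).
elim: n f l => // n IH f [//|x l] sl; rewrite [map a _]/= !osdE.
rewrite -[a x :: _]/(map a (x :: l)) -dlo_map bb //.
by apply: dlo_eq => t [st]; rewrite IH // st.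
Qed.

End OrderedCochains.

(** * Affine simplices, convexity and the mesh of the barycentric subdivision *)

Section AffineSimplices.
Variable K : realType.
Local Notation Dl := (stdsimplex K).

Definition bc k (u : Dl k) (i : 'I_k.+1) : K := (set_val u : 'rV[K]_k.+1) 0 i.

Lemma bc_ge0 k (u : Dl k) i : 0 <= bc u i.
Proof. by have [h _] := set_mem (valP u); exact: h. Qed.

Lemma bc_sum k (u : Dl k) : \sum_i bc u i = 1.
Proof. by have [_ h] := set_mem (valP u). Qed.

Lemma bc_le1 k (u : Dl k) i : bc u i <= 1.
Proof.
by rewrite -(bc_sum u) (bigD1 i) //= lerDl sumr_ge0 // => j _; exact: bc_ge0.
Qed.

Lemma bc_inj k (u v : Dl k) : (forall i, bc u i = bc v i) -> u = v.
Proof.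
by move=> uv; apply: val_inj; apply/rowP => i; exact: uv.
Qed.

Lemma mksimplex_subproof k (x : 'I_k.+1 -> K) :
  (forall i, 0 <= x i) -> \sum_i x i = 1 -> \row_i x i \in Dl k.
Proof.
move=> x0 x1; apply/mem_set; split=> [i|]; first by rewrite mxE.
by rewrite -[RHS]x1; apply: eq_bigr => i _; rewrite mxE.
Qed.

Definition mksimplex k (x : 'I_k.+1 -> K) (x0 : forall i, 0 <= x i)
    (x1 : \sum_i x i = 1) : Dl k :=
  exist (fun t => t \in Dl k) _ (mksimplex_subproof x0 x1).

Lemma bc_mk k (x : 'I_k.+1 -> K) x0 x1 i : bc (@mksimplex k x x0 x1) i = x i.
Proof. by rewrite /bc mxE. Qed.

Definition vertex k (j : 'I_k.+1) : Dl k.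
Proof.
apply: (@mksimplex k (fun i => (i == j)%:R)) => [i|]; first exact: ler0n.
by rewrite (bigD1 j) //= eqxx big1 ?addr0 // => i /negPf ->.
Defined.

Definition bary k : Dl k.
Proof.
apply: (@mksimplex k (fun i => k.+1%:R^-1)) => [i|].
  by rewrite invr_ge0 ler0n.
by rewrite sumr_const card_ord -[_ *+ _]mulr_natr mulVf // pnatr_eq0.
Defined.

Lemma bc_bary k i : bc (bary k) i = k.+1%:R^-1.
Proof. exact: bc_mk. Qed.

Lemma bc_continuous k (i : 'I_k.+1) : continuous (fun u : Dl k => bc u i).
Proof.
move=> u; apply: (@continuous_comp _ _ _ (set_val : Dl k -> 'rV[K]_k.+1)
  (fun x : 'rV[K]_k.+1 => x 0 i)); first exact: initial_continuous.
exact: coord_continuous.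
Qed.

Lemma stdsimplex_closed k : closed (Dl k).
Proof.
have -> : Dl k = (\bigcap_(i in [set: 'I_k.+1])
    ((fun u : 'rV[K]_k.+1 => u 0 i) @^-1` [set x | 0 <= x])) `&`
    ((fun u : 'rV[K]_k.+1 => \sum_i u 0 i) @^-1` [set 1]).
  by rewrite eqEsubset; split=> u [u0 u1]; split=> // i; [move=> _|]; exact: u0.
apply: closedI.
  apply: closed_bigI => i _; apply: preimage_closed => [u _|]; last exact: closed_ge.
  exact: coord_continuous.
apply: preimage_closed => [u _|]; last exact: closed_eq.
apply: continuous_big => [|i _]; first exact: add_continuous.
exact: coord_continuous.
Qed.

Lemma stdsimplex_norm k (u : 'rV[K]_k.+1) : Dl k u -> `|u| <= 1.
Proof.
move=> Du; rewrite -[`|u|]/(mx_norm u) mx_normrE; apply/bigmax_leP; split=> // -[i j] _ /=.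
rewrite ord1; have := bc_ge0 (exist (fun t => t \in Dl k) u (mem_set Du)) j.
rewrite /bc /= => h; rewrite ger0_norm //.
exact: (bc_le1 (exist (fun t => t \in Dl k) u (mem_set Du)) j).
Qed.

Lemma stdsimplex_compact k : compact (Dl k).
Proof.
apply: bounded_closed_compact; last exact: stdsimplex_closed.
exists 1; split; first exact: num_real.
by move=> r r1 u /stdsimplex_norm u1 /=; exact: le_trans u1 (ltW r1).
Qed.

Lemma set_type_compact (T : topologicalType) (A : set T) :
  compact A -> compact [set: set_type A].
Proof.
move=> cA F PF _.
have AF : (set_val @ F) A.
  have -> : (set_val @ F) A = F setT; last exact: filterT.
  by congr (F _); rewrite eqEsubset; split=> // x _; exact: set_mem (valP x).
have [x [Ax clx]] := cA (set_val @ F) (fmap_proper_filter set_val PF) AF.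
exists (exist (fun t => t \in A) x (mem_set Ax)); split=> //.
move=> P Q FP [_ [/= [V oV <-] /= Vx VQ]].
have FP' : (set_val @ F) (set_val @` P) by apply: (@filterS _ F _ P) => // z Pz; exists z.
have nV : nbhs x V by apply: open_nbhs_nbhs; split.
have [y [[z Pz zy] Vy]] := clx _ _ FP' nV.
by exists z; split=> //; apply: VQ; rewrite /= zy.
Qed.

Lemma simplex_compact k : compact [set: Dl k].
Proof. exact/set_type_compact/stdsimplex_compact. Qed.

Section Aff.
Variable W : lmodType K.

Definition aff (l : seq W) k (u : Dl k) : W := \sum_(i < k.+1) bc u i *: l`_i.

Lemma aff_coface (l : seq W) k (i : 'I_k.+2) (u : Dl k) : size l = k.+2 ->
  aff l (coface i u) = aff (take i l ++ drop i.+1 l) u.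
Proof.
move=> sl; rewrite /aff (bigD1_ord i) //= {1}/bc mxE unlift_none scale0r add0r.
apply: eq_bigr => j _; rewrite {1}/bc /= mxE liftK /=; congr (_ *: _).
rewrite nth_cat size_take sl ltn_ord /bump; case: ltnP => ij.
  by rewrite nth_take.
by rewrite nth_drop /= add1n addSn subnKC.
Qed.

Lemma aff_map (W' : lmodType K) (a : {linear W' -> W}) (l : seq W') k (u : Dl k) :
  size l = k.+1 -> aff (map a l) u = a (\sum_(i < k.+1) bc u i *: l`_i).
Proof.
move=> sl; rewrite /aff linear_sum; apply: eq_bigr => i _.
by rewrite (nth_map 0) ?sl // linearZ.
Qed.

Definition conv (D : set W) : Prop :=
  forall (l : seq W) k (u : Dl k), size l = k.+1 -> lin D l -> D (aff l u).

Definition obary (l : seq W) : W := (size l)%:R^-1 *: \sum_(x <- l) x.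

Lemma obaryE l k : size l = k.+1 -> obary l = aff l (bary k).
Proof.
move=> sl; rewrite /obary /aff sl scaler_sumr (big_nth 0) sl big_mkord.
by apply: eq_bigr => i _; rewrite bc_bary.
Qed.

Lemma conv_obary (D : set W) l : conv D -> lin D l -> l <> [::] -> D (obary l).
Proof.
by case: l => // x l cD Dl _; rewrite (@obaryE _ (size l)) //; exact: cD.
Qed.

Lemma convI (D E : set W) : conv D -> conv E -> conv (D `&` E).
Proof.
move=> cD cE l k u sl Dl; split; [apply: cD|apply: cE] => //.
all: by move=> x /Dl[].
Qed.

End Aff.

Lemma obary_map (W W' : lmodType K) (a : {linear W' -> W}) (l : seq W') :
  obary (map a l) = a (obary l).
Proof. by rewrite /obary size_map big_map linearZ /= (linear_sum a). Qed.

Lemma conv_stdsimplex k : conv (Dl k).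
Proof.
move=> l m u sl Dl'.
have E i : aff l u 0 i = \sum_(j < m.+1) bc u j * l`_j 0 i.
  by rewrite /aff summxE; apply: eq_bigr => j _; rewrite mxE.
have Dn (j : 'I_m.+1) : Dl k l`_j by apply: Dl'; rewrite mem_nth // sl.
split=> [i|].
  rewrite E sumr_ge0 // => j _; rewrite mulr_ge0 ?bc_ge0 //.
  by have [+ _] := Dn j; exact.
under eq_bigr do rewrite E.
rewrite exchange_big /= -[RHS](bc_sum u); apply: eq_bigr => j _.
by rewrite -mulr_sumr; have [_ ->] := Dn j; rewrite mulr1.
Qed.

Section AffNormed.
Variable W : normedModType K.

Lemma aff_continuous (l : seq W) k : continuous (fun u : Dl k => aff l u).
Proof.
rewrite /aff; apply: continuous_big => [|i _ u]; first exact: add_continuous.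
have h := @cvgZr_tmp K W _ (nbhs u) _ (fun u : Dl k => bc u i) (bc u i) l`_i.
by apply: h; exact: bc_continuous.
Qed.

Lemma aff_sub (l : seq W) k (u : Dl k) y :
  aff l u - y = \sum_(i < k.+1) bc u i *: (l`_i - y).
Proof.
rewrite /aff -[y in LHS]scale1r -(bc_sum u) scaler_suml -sumrB.
by apply: eq_bigr => i _; rewrite scalerBr.
Qed.

Lemma conv_ball (y : W) r : conv [set x | `|y - x| <= r].
Proof.
move=> l k u sl lr /=; rewrite distrC aff_sub.
apply: le_trans (ler_norm_sum _ _ _) _.
apply: (@le_trans _ _ (\sum_(i < k.+1) bc u i * r)); last first.
  by rewrite -mulr_suml bc_sum mul1r.
apply: ler_sum => i _; rewrite normrZ (ger0_norm (bc_ge0 _ _)).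
apply: ler_wpM2l; first exact: bc_ge0.
by rewrite distrC; apply: lr; rewrite mem_nth // sl.
Qed.

Definition diamle (d : K) (l : seq W) : Prop :=
  forall x y, x \in l -> y \in l -> `|x - y| <= d.

Lemma obary_dist l k d x : size l = k.+1 -> diamle d l -> x \in l ->
  `|obary l - x| <= k%:R / k.+1%:R * d.
Proof.
move=> sl dl /(nthP 0)[j jl <-]; rewrite (obaryE sl) aff_sub.
rewrite sl in jl; rewrite (bigD1 (Ordinal jl)) //= subrr scaler0 add0r.
apply: le_trans (ler_norm_sum _ _ _) _.
apply: (@le_trans _ _ (\sum_(i < k.+1 | i != Ordinal jl) (k.+1%:R^-1 * d))).
  apply: ler_sum => i _; rewrite bc_bary normrZ ger0_norm ?invr_ge0 ?ler0n //.
  by rewrite ler_wpM2l ?invr_ge0 ?ler0n // dl // mem_nth // sl.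
by rewrite sumr_const cardC1 card_ord /= -[_ *+ k]mulr_natl mulrA.
Qed.

(** The factor by which barycentric subdivision shrinks the diameter of a k-simplex. *)
Definition mesh k : K := k%:R / k.+1%:R.

Lemma mesh_ge0 k : 0 <= mesh k.
Proof. by rewrite divr_ge0 ?ler0n. Qed.

Lemma mesh_leS k : mesh k <= mesh k.+1.
Proof.
rewrite /mesh ler_pdivrMr ?ltr0n // mulrAC ler_pdivlMr ?ltr0n //.
rewrite -!natrM ler_nat; lia.
Qed.

Lemma mesh_lt1 k : mesh k < 1.
Proof. by rewrite ltr_pdivrMr ?ltr0n // mul1r ltr_nat. Qed.

(** A simplex of the subdivision is a cone from the barycentre c on a simplex of the subdivided
    boundary. Its edges at c are bounded by [obary_dist], the others by induction, since [mesh]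
    increases with the dimension; the ball E carries the first bound through the recursion. *)
Lemma osd_mesh (M : zmodType) (D : set W) k d (f g : seq W -> M) l :
  conv D -> 0 <= d -> lin D l -> size l = k.+1 -> diamle d l ->
  (forall t, size t = k.+1 -> lin D t -> diamle (mesh k * d) t -> f t = g t) ->
  osd (@obary W) f l = osd (@obary W) g l.
Proof.
elim: k D f g l => [|k IH] D f g [//|x l] cD d0 Dl' sl dl fg; rewrite !osdE.
  case: l sl dl Dl' => // _ dl Dl' /=; rewrite subr0 /osd /= /ocone.
  rewrite /obary /= big_seq1 invr1 scale1r subr0; apply: fg => //.
  by move=> y z; rewrite !inE => /eqP-> /eqP->; rewrite subrr normr0 /mesh !mul0r.
set c := obary _; have Dc : D c by exact: conv_obary.
pose E : set W := [set y | `|c - y| <= mesh k.+1 * d].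
apply: (@dlo_local _ _ [set y | y \in x :: l]) => // t; rewrite sl => -[st] tl.
apply: (IH (D `&` E)) => //.
- by apply: convI => //; exact: conv_ball.
- move=> y /tl yl; split; first exact: Dl'.
  exact: obary_dist.
- by move=> y z /tl yl /tl zl; exact: dl.
move=> t' st' Dt' dt'; apply: fg; first by rewrite /= st'.
  by apply/lin_cons; split=> // y /Dt'[].
have dE y : y \in t' -> `|c - y| <= mesh k.+1 * d by move=> /Dt'[].
move=> y z; rewrite !inE => /predU1P[->|yt] /predU1P[->|zt].
- by rewrite subrr normr0 mulr_ge0 // mesh_ge0.
- exact: dE.
- by rewrite distrC; exact: dE.
- by apply: le_trans (dt' _ _ yt zt) _; rewrite ler_wpM2r // mesh_leS.
Qed.

Lemma iter_osd_mesh (M : zmodType) (D : set W) k m d (f g : seq W -> M) l :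
  conv D -> 0 <= d -> lin D l -> size l = k.+1 -> diamle d l ->
  (forall t, size t = k.+1 -> lin D t -> diamle (mesh k ^+ m * d) t ->
     f t = g t) ->
  iter m (osd (@obary W)) f l = iter m (osd (@obary W)) g l.
Proof.
elim: m d l => [|m IH] d l cD d0 Dl' sl dl fg /=.
  by apply: fg => //; rewrite expr0 mul1r.
apply: (osd_mesh cD d0 Dl' sl dl) => t st Dt dt.
apply: (IH (mesh k * d)) => //; first by rewrite mulr_ge0 // mesh_ge0.
by rewrite mulrA -exprSr.
Qed.

End AffNormed.
End AffineSimplices.

(** * Singular cochains, evaluated on affine simplices *)

Section Cochains.
Variable K : realType.
Local Notation Dl := (stdsimplex K).

Lemma insert0_linear k (i : 'I_k.+2) : linear (insert0 (K := K) i).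
Proof.
move=> a x y; apply/rowP => j; rewrite !mxE.
by case: unliftP => [j' _|_]; rewrite ?mxE // mulr0 addr0.
Qed.

HB.instance Definition _ k (i : 'I_k.+2) :=
  GRing.isLinear.Build K 'rV[K]_k.+1 'rV[K]_k.+2 *:%R (insert0 (K := K) i)
    (@insert0_linear k i).

(** Vectors outside the simplex go to the barycentre, so that a singular simplex can be composed
    with [vx] and evaluated at vectors without membership proofs. *)
Definition vx k (w : 'rV[K]_k.+1) : Dl k := insubd (bary K k) w.

Lemma val_vx k (w : 'rV[K]_k.+1) : Dl k w -> set_val (vx w) = w.
Proof. by move=> Dw; rewrite set_valE; apply/insubdK/mem_set. Qed.

Lemma vxK k (u : Dl k) : vx (set_val u) = u.
Proof. by apply: val_inj; apply: val_vx; exact: set_mem (valP u). Qed.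

Lemma insert0_Dl k (i : 'I_k.+2) (w : 'rV[K]_k.+1) : Dl k w -> Dl k.+1 (insert0 i w).
Proof. by move=> Dw; have := set_mem (insert0_stdsimplex i (vx w)); rewrite val_vx. Qed.

Lemma vx_insert0 k (i : 'I_k.+2) (w : 'rV[K]_k.+1) : Dl k w ->
  vx (insert0 i w) = coface i (vx w).
Proof.
move=> Dw; apply: val_inj; rewrite -[LHS]/(set_val _) val_vx; last exact: insert0_Dl.
by rewrite -[RHS]/(insert0 i (set_val (vx w))) val_vx.
Qed.

Definition sv k : seq 'rV[K]_k.+1 := [seq delta_mx 0 i | i <- enum 'I_k.+1].

Lemma size_sv k : size (sv k) = k.+1.
Proof. by rewrite size_map size_enum_ord. Qed.

Lemma nth_sv k (i : 'I_k.+1) : (sv k)`_i = delta_mx 0 i.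
Proof. by rewrite (nth_map i) ?size_enum_ord // nth_ord_enum. Qed.

Lemma aff_sv k (u : Dl k) : aff (sv k) u = set_val u.
Proof.
apply/rowP => j; rewrite /aff summxE (bigD1 j) //= nth_sv !mxE !eqxx mulr1.
rewrite big1 ?addr0 // => i ij; rewrite nth_sv !mxE eqxx eq_sym (negPf ij).
by rewrite mulr0.
Qed.

Lemma Dl_delta k (i : 'I_k.+1) : Dl k (delta_mx 0 i).
Proof.
split=> [j|]; first by rewrite mxE; case: andP.
rewrite (bigD1 i) //= mxE !eqxx big1 ?addr0 // => j ij.
by rewrite mxE eqxx (negPf ij).
Qed.

Lemma lin_sv k : lin (Dl k) (sv k).
Proof. by move=> x /mapP[i _ ->]; exact: Dl_delta. Qed.

Lemma sv_del k (i : 'I_k.+2) :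
  take i (sv k.+1) ++ drop i.+1 (sv k.+1) = map (insert0 i) (sv k).
Proof.
have sz : size (take i (sv k.+1) ++ drop i.+1 (sv k.+1)) = k.+1.
  by rewrite size_cat size_take size_drop size_sv ltn_ord subSS subnKC // -ltnS.
apply: (@eq_from_nth _ 0); rewrite sz; first by rewrite size_map size_sv.
move=> j jk.
rewrite (nth_map 0) ?size_sv // (nth_sv (Ordinal jk)).
have -> : (take i (sv k.+1) ++ drop i.+1 (sv k.+1))`_j =
    (sv k.+1)`_(lift i (Ordinal jk)).
  rewrite nth_cat size_take size_sv ltn_ord /= /bump; case: ltnP => ij.
    by rewrite nth_take.
  by rewrite nth_drop /= add1n addSn subnKC.
rewrite nth_sv; apply/rowP => m; rewrite !mxE eqxx.
case: unliftP => [m' ->|->]; last by rewrite (negPf (neq_lift _ _)).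
by rewrite mxE eqxx (inj_eq lift_inj).
Qed.

Lemma diamle_sv k : diamle 1 (sv k).
Proof.
move=> x y xs ys; have Dx := lin_sv xs; have Dy := lin_sv ys.
rewrite -[`|_|]/(mx_norm _) mx_normrE; apply/bigmax_leP; split=> // -[i j] _ /=.
rewrite ord1 !mxE -(val_vx Dx) -(val_vx Dy).
have := bc_ge0 (vx x) j; have := bc_ge0 (vx y) j.
have := bc_le1 (vx x) j; have := bc_le1 (vx y) j; rewrite /bc.
by rewrite ler_norml => ? ? ? ?; lra.
Qed.

Variable M : zmodType.

(* Cochains take values on all maps from simplices; continuity is only required,
   by the predicate sin below, of the simplices on which cochains are compared. *)
Definition cochain (T : Type) : Type := forall k, (Dl k -> T) -> M.

Definition dl T (c : cochain T) : cochain T := fun k =>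
  if k is k'.+1 then
    fun s => \sum_(i < k'.+2) c k' (s \o coface i) *~ (-1) ^+ i
  else fun=> 0.

(** The pullback of c along H as an ordered cochain on vectors. The value 0 on the empty list agrees
    with [dl] being 0 in degree 0. *)
Definition ocl T (W : lmodType K) (H : W -> T) (c : cochain T) (l : seq W) : M :=
  if size l is k.+1 then c k (H \o (fun u : Dl k => aff l u)) else 0.

Lemma ocl_dl T (W : lmodType K) (H : W -> T) (c : cochain T) l :
  dlo (ocl H c) l = ocl H (dl c) l.
Proof.
case: l => [//|x [|y l]]; first by rewrite /ocl /= subr0.
rewrite dlo_sum; set t := x :: _; have st : size t = (size l).+2 by [].
transitivity (\sum_(i < (size l).+2)
    c (size l) ((H \o (fun u => aff t u)) \o coface i) *~ (-1) ^+ i) => //.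
apply: (@eq_bigr _ _ _ 'I_(size l).+2) => i _; congr (_ *~ _).
rewrite /ocl size_cat size_take size_drop.
have -> : ((if (i < size t)%N then i : nat else size t) +
    (size t - i.+1))%N = (size l).+1.
  by have := ltn_ord i; rewrite st => il; rewrite il; lia.
by congr (c _ _); apply/funext => u /=; rewrite -aff_coface.
Qed.

Lemma ocl_sv T k (s : Dl k -> T) (c : cochain T) : ocl (s \o @vx k) c (sv k) = c k s.
Proof.
rewrite /ocl size_sv; congr (c k _); apply/funext => u /=.
by rewrite aff_sv vxK.
Qed.

Lemma ocl_coface T k (s : Dl k.+1 -> T) (c : cochain T) (i : 'I_k.+2) l :
  lin (Dl k) l ->
  ocl ((s \o coface i) \o @vx k) c l = ocl (s \o @vx k.+1) c (map (insert0 i) l).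
Proof.
move=> Dl'; rewrite /ocl size_map; case sl: (size l) => [//|m].
congr (c m _); apply/funext => u /=; rewrite -vx_insert0.
  by rewrite (aff_map (insert0 i)).
exact: (@conv_stdsimplex K k).
Qed.

(** An operator on ordered cochains that is natural for face inclusions and local gives one on
    singular cochains by evaluation at the standard vertices; the coboundary can then be taken
    before the evaluation. *)
Lemma dl_op T (c : cochain T) (Op : forall k, (seq 'rV[K]_k.+1 -> M) ->
    seq 'rV[K]_k.+1 -> M) k (s : Dl k.+1 -> T) :
  (forall f (i : 'I_k.+2) l, Op k.+1 f (map (insert0 i) l) =
     Op k (fun t => f (map (insert0 i) t)) l) ->
  (forall f g l, lin (Dl k) l -> (forall t, lin (Dl k) t -> f t = g t) ->
     Op k f l = Op k g l) ->
  \sum_(i < k.+2) Op k (ocl ((s \o coface i) \o @vx k) c) (sv k) *~ (-1) ^+ i =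
  dlo (Op k.+1 (ocl (s \o @vx k.+1) c)) (sv k.+1).
Proof.
move=> nat loc; rewrite dlo_sum size_sv; apply: eq_bigr => i _.
congr (_ *~ _); rewrite sv_del nat; apply: loc; first exact: lin_sv.
by move=> t Dt; rewrite ocl_coface.
Qed.

Section Subdiv.
Variable k : nat.
Let W := 'rV[K]_k.+1.

Definition odiff (f : seq W -> M) l := f l - osd (@obary K W) f l.
Definition ohsd : (seq W -> M) -> seq W -> M := ohtp odiff (@obary K W).
Definition otel m f l := \sum_(j < m) iter j (osd (@obary K W)) (ohsd f) l.

Lemma conv_ob (D : set W) : conv D -> forall l, lin D l -> l <> [::] -> D (obary l).
Proof. by move=> cD l; exact: conv_obary. Qed.

Lemma odiff_local (D : set W) f g l : conv D -> lin D l ->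
  (forall t, lin D t -> f t = g t) -> odiff f l = odiff g l.
Proof.
move=> cD Dl' fg; rewrite /odiff fg // (osd_local (D := D) (g := g)) //.
exact: conv_ob.
Qed.

Lemma ohsd_local (D : set W) f g l : conv D -> lin D l ->
  (forall t, lin D t -> f t = g t) -> ohsd f l = ohsd g l.
Proof.
move=> cD Dl' fg; apply: (ohtp_local (D := D) (D' := D)) => //.
  exact: conv_ob.
by move=> f' g' l' Dl''; exact: odiff_local.
Qed.

Lemma iter_osd_local j (D : set W) (f g : seq W -> M) l : conv D -> lin D l ->
  (forall t, lin D t -> f t = g t) ->
  iter j (osd (@obary K W)) f l = iter j (osd (@obary K W)) g l.
Proof.
move=> cD + fg; elim: j l => [|j IH] l Dl' /=; first exact: fg.
by apply: (osd_local (D := D)) => //; exact: conv_ob.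
Qed.

Lemma otel_local m (D : set W) f g l : conv D -> lin D l ->
  (forall t, lin D t -> f t = g t) -> otel m f l = otel m g l.
Proof.
move=> cD Dl' fg; apply: eq_bigr => j _; apply: (iter_osd_local j cD Dl') => t Dt.
exact: (ohsd_local cD).
Qed.

Lemma iter_osdB j (f g : seq W -> M) l : iter j (osd (@obary K W)) (fun t => f t - g t) l =
  iter j (osd (@obary K W)) f l - iter j (osd (@obary K W)) g l.
Proof.
elim: j l => [//|j IH] l /=; rewrite -osdB.
by congr (osd _ _ _); apply/funext.
Qed.

Lemma iter_osd_dlo j (f : seq W -> M) l : dlo (iter j (osd (@obary K W)) f) l =
  iter j (osd (@obary K W)) (dlo f : seq W -> M) l.
Proof.
elim: j l => [//|j IH] l /=; rewrite osd_dlo.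
by congr (osd _ _ _); apply/funext.
Qed.

Lemma ohsd_htp (f : seq W -> M) l : dlo (ohsd f) l + ohsd (dlo f) l = f l - osd (@obary K W) f l.
Proof.
apply: ohtp_htp.
- by move=> f' g l'; rewrite /odiff osdB subrACA.
- by move=> f' l'; rewrite /odiff dloB osd_dlo.
- by move=> f'; rewrite /odiff /osd /= subrr.
Qed.

(** Telescoping: the j-th summand is the homotopy from the j-fold to the (j+1)-fold subdivision, and
    subdivision commutes with [dlo]. *)
Lemma otel_htp m (f : seq W -> M) l : dlo (otel m f) l + otel m (dlo f) l =
  f l - iter m (osd (@obary K W)) f l.
Proof.
elim: m => [|m IH] in l *.
  rewrite /otel /= big_ord0 addr0 subrr -[RHS](dlo0 M l).
  by congr (dlo _ _); apply/funext => t; rewrite big_ord0.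
have E g t : otel m.+1 g t = otel m g t + iter m (osd (@obary K W)) (ohsd g) t.
  by rewrite /otel big_ord_recr.
rewrite (_ : otel m.+1 f = (fun t => otel m f t +
   iter m (osd (@obary K W)) (ohsd f) t)); last by apply/funext => t; exact: E.
rewrite dloD E addrACA IH iter_osd_dlo.
have -> : ohsd (dlo f) = (fun t => (f t - osd (@obary K W) f t) - dlo (ohsd f) t).
  by apply/funext => t; rewrite -ohsd_htp addrC addKr.
rewrite (iter_osdB m (fun t => f t - osd (@obary K W) f t)) (iter_osdB m f).
by rewrite [X in _ + X]addrC subrK addrA subrK -iterSr.
Qed.

End Subdiv.
End Cochains.

Section OtelNat.
Variables (K : realType) (M : zmodType) (k : nat) (i : 'I_k.+2).

Lemma osd_insert0 (f : seq 'rV[K]_k.+2 -> M) l :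
  osd (@obary K _) f (map (insert0 i) l) =
  osd (@obary K _) (fun t => f (map (insert0 i) t)) l.
Proof. by apply: osd_map => l' _; rewrite (obary_map (insert0 i)). Qed.

Lemma iter_osd_insert0 m (f : seq 'rV[K]_k.+2 -> M) l :
  iter m (osd (@obary K _)) f (map (insert0 i) l) =
  iter m (osd (@obary K _)) (fun t => f (map (insert0 i) t)) l.
Proof.
elim: m l => [//|m IH] l /=; rewrite osd_insert0.
by congr (osd _ _ _); apply/funext.
Qed.

Lemma ohsd_insert0 (f : seq 'rV[K]_k.+2 -> M) l :
  ohsd f (map (insert0 i) l) = ohsd (fun t => f (map (insert0 i) t)) l.
Proof.
apply: ohtp_map => [f' l'|l' _]; first by rewrite /odiff osd_insert0.
by rewrite (obary_map (insert0 i)).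
Qed.

Lemma otel_insert0 m (f : seq 'rV[K]_k.+2 -> M) l :
  otel m f (map (insert0 i) l) = otel m (fun t => f (map (insert0 i) t)) l.
Proof.
apply: eq_bigr => j _; rewrite iter_osd_insert0.
by congr (iter _ _ _ _); apply/funext => t; rewrite ohsd_insert0.
Qed.

End OtelNat.

(** * Cocycles that vanish on small simplices *)

Section SmallSimplices.
Variables (K : realType) (M : zmodType) (T : topologicalType).
Local Notation Dl := (stdsimplex K).
Implicit Types (c g : cochain K M T) (A B : set T).

Definition sin A k (s : Dl k -> T) : Prop := continuous s /\ range s `<=` A.

Lemma sin_sub A B k (s : Dl k -> T) : A `<=` B -> sin A s -> sin B s.
Proof. by move=> AB [cs sA]; split=> //; exact: subset_trans AB. Qed.

Lemma sin_coface A k (s : Dl k.+1 -> T) i : sin A s -> sin A (s \o coface i).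
Proof.
move=> [cs sA]; split=> [u|_ [u _ <-] /=]; last by apply: sA; exists (coface i u).
by apply: continuous_comp; [exact: coface_continuous|exact: cs].
Qed.

Lemma vx_aff_continuous k (t : seq 'rV[K]_k.+1) m :
  (forall u : Dl m, Dl k (aff t u)) -> continuous (fun u : Dl m => vx (aff t u)).
Proof.
move=> Dt; apply: continuous_comp_initial.
rewrite (_ : _ \o _ = (fun u : Dl m => aff t u)); first exact: aff_continuous.
by apply/funext => u /=; exact: val_vx.
Qed.

Lemma sin_aff A k (s : Dl k -> T) (t : seq 'rV[K]_k.+1) m :
  continuous s -> size t = m.+1 -> lin (Dl k) t ->
  (forall u : Dl m, A (s (vx (aff t u)))) ->
  sin A ((s \o @vx K k) \o (fun u : Dl m => aff t u)).
Proof.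
move=> cs st Dt As; split=> [u|_ [u _ <-] /=]; last exact: As.
apply: (@continuous_comp _ _ _ (fun u : Dl m => vx (aff t u)) s); last exact: cs.
by apply: vx_aff_continuous => v; exact: (@conv_stdsimplex K k).
Qed.

Lemma ocl_eq0 A c k (s : Dl k -> T) (E : set 'rV[K]_k.+1) t :
  (forall k s, sin A s -> c k s = 0) -> continuous s ->
  conv E -> E `<=` Dl k -> (forall w, E w -> A (s (vx w))) -> lin E t ->
  ocl (s \o @vx K k) c t = 0.
Proof.
move=> c0 cs cE ED EA Et; rewrite /ocl; case st : (size t) => [//|m].
apply: c0; apply: sin_aff => // [w /Et /ED //|u]; apply: EA.
exact: cE.
Qed.

Variable O : set (set T).
Hypothesis openO : forall U, O U -> open U.

Definition small k (s : Dl k -> T) : Prop := exists2 U, O U & range s `<=` U.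

(** The standard simplex has diameter at most 1, so [mesh K k ^+ m] bounds the diameters in its
    m-fold subdivision: m subdivisions make s small. *)
Definition good k (s : Dl k -> T) (m : nat) : Prop :=
  forall y : Dl k, exists2 U, O U &
    forall w : Dl k, `|set_val y - set_val w| <= mesh K k ^+ m -> U (s w).

Lemma good_mono k (s : Dl k -> T) m m' : (m <= m')%N -> good s m -> good s m'.
Proof.
move=> mm' gm y; have [U OU Us] := gm y; exists U => // w yw; apply: Us.
by apply: le_trans yw _; apply: ler_wiXn2l => //; [exact: mesh_ge0|exact/ltW/mesh_lt1].
Qed.

(** A Lebesgue number: by compactness one radius works at all points, and some power of the mesh is
    below it. *)
Lemma good_exists k (s : Dl k -> T) : continuous s ->
  (forall u, exists2 U, O U & U (s u)) -> exists m, good s m.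
Proof.
move=> cs sO.
have ballE (x y : Dl k) r : ball x r y <-> `|set_val x - set_val y| < r.
  by rewrite -[ball x r y]/(ball (set_val x) r (set_val y)) -ball_normE.
pose P (r : K) (y : Dl k) := exists2 U, O U &
    forall w : Dl k, `|set_val y - set_val w| <= r -> U (s w).
have : \forall r \near 0^'+, [set: Dl k] `<=` P r.
  apply: (proj1 (@compact_near_coveringP _ _) (@simplex_compact K k)) => u _.
  have [U OU Usu] := sO u.
  have : nbhs u (s @^-1` U) by apply: cs; apply: open_nbhs_nbhs; split=> //; exact: openO.
  move=> /nbhs_ballP[e /= e0 eU].
  exists (ball u (e / 2), [set r | r < e / 2]) => /=.
    split; first by apply: nbhsx_ballx; rewrite divr_gt0.
    by apply: nbhs_right_lt; rewrite divr_gt0.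
  move=> [y r] /= [/ballE uy re]; exists U => // w yw; apply: eU; apply/ballE.
  rewrite -(subrKA (set_val y)) [e]splitr; apply: le_lt_trans (ler_normD _ _) _.
  by apply: ltrD => //; apply: le_lt_trans re.
move=> [r /= r0 rP]; have r2 : 0 < r / 2 by rewrite divr_gt0.
have Pr : [set: Dl k] `<=` P (r / 2).
  by apply: rP; rewrite //= sub0r normrN gtr0_norm // ltr_pdivrMr // ltr_pMr // ltr1n.
have /cvg_expr /cvgr0_norm_lt /(_ _ r2) [m _ /(_ m (leqnn m)) /= hm] : `|mesh K k| < 1.
  by rewrite ger0_norm ?mesh_ge0 ?mesh_lt1.
exists m => y; have [U OU Us] := Pr y I; exists U => // w yw; apply: Us.
apply: le_trans yw _; apply: le_trans (ltW hm).
exact: ler_norm.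
Qed.

Lemma iter_osd0 k j l :
  iter j (osd (@obary K 'rV[K]_k.+1)) (fun=> 0 : M) l = 0.
Proof.
by have := iter_osdB j (fun=> 0 : M) (fun=> 0) l; rewrite !subrr.
Qed.

Lemma ohsd0 k (l : seq 'rV[K]_k.+1) : ohsd (fun=> 0 : M) l = 0.
Proof.
have PB (f g : seq 'rV[K]_k.+1 -> M) t :
    odiff (fun t => f t - g t) t = odiff f t - odiff g t.
  by rewrite /odiff osdB subrACA.
by have := ohtpB (@obary K _) PB (fun=> 0) (fun=> 0) l; rewrite !subrr.
Qed.

Section Vanishing.
Variables (B : set T) (g : cochain K M T).

Hypothesis coverB : forall x, B x -> exists2 U, O U & U x.
Hypothesis g_dl : forall k (s : Dl k -> T), sin B s -> dl g s = 0.
Hypothesis g_small : forall k (s : Dl k -> T), sin B s -> small s -> g s = 0.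

(** E is the part of the simplex in a ball around the first vertex: it is convex and s maps it into
    a single member of O. *)
Lemma ocl_small_eq0 k (s : Dl k -> T) m t : sin B s -> good s m ->
  lin (Dl k) t -> t <> [::] -> diamle (mesh K k ^+ m) t ->
  exists E, [/\ conv E, lin E t & forall t', lin E t' -> ocl (s \o @vx K k) g t' = 0].
Proof.
case: t => // x t [cs sB] gm Dt _ dt.
have Dx : Dl k x by apply: Dt; rewrite mem_head.
exists (Dl k `&` [set w | `|x - w| <= mesh K k ^+ m]); split.
- by apply: convI; [exact: conv_stdsimplex|exact: conv_ball].
- by move=> w wt; split; [exact: Dt|apply: dt; rewrite ?mem_head].
have [U OU Us] := gm (vx x); move=> t'.
apply: (ocl_eq0 (A := B `&` U)) => // [j s' s'BU| |w [Dw xw]].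
- apply: g_small; first by apply: sin_sub s'BU; exact: subIsetl.
  by exists U => // y /s'BU.2[].
- by apply: convI; [exact: conv_stdsimplex|exact: conv_ball].
- by split; [apply: sB; exists (vx w)|apply: Us; rewrite !val_vx].
Qed.

Lemma iter_osd_small k (s : Dl k -> T) m : sin B s -> good s m ->
  iter m (osd (@obary K _)) (ocl (s \o @vx K k) g) (sv K k) = 0.
Proof.
move=> sB gm; rewrite -[RHS](iter_osd0 m (sv K k)).
apply: (iter_osd_mesh (D := Dl k) (k := k) (d := 1)) => //.
- exact: conv_stdsimplex.
- exact: lin_sv.
- exact: size_sv.
- exact: diamle_sv.
move=> t st Dt; rewrite mulr1 => dt.
have t0 : t <> [::] by move=> t0; move: st; rewrite t0.
by have [E [_ Et ->]] := ocl_small_eq0 sB gm Dt t0 dt.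
Qed.

(** On a short list the homotopy evaluates the cochain only inside a convex set where it is 0. *)
Lemma iter_ohsd_small k (s : Dl k -> T) m j : sin B s -> good s m -> (m <= j)%N ->
  iter j (osd (@obary K _)) (ohsd (ocl (s \o @vx K k) g)) (sv K k) = 0.
Proof.
move=> sB gm /good_mono /(_ gm) gj; rewrite -[RHS](iter_osd0 j (sv K k)).
apply: (iter_osd_mesh (D := Dl k) (k := k) (d := 1)) => //.
- exact: conv_stdsimplex.
- exact: lin_sv.
- exact: size_sv.
- exact: diamle_sv.
move=> t st Dt; rewrite mulr1 => dt.
have t0 : t <> [::] by move=> t0; move: st; rewrite t0.
have [E [cE Et E0]] := ocl_small_eq0 sB gj Dt t0 dt.
by rewrite -(ohsd0 t); apply: (ohsd_local cE Et).
Qed.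

(* The number of subdivisions depends on the simplex; this is harmless as further
   subdivisions contribute zero to a cochain that vanishes on small simplices. *)
Definition hsub : cochain K M T := fun k s =>
  otel (xget 0%N [set m | good s m]) (ocl (s \o @vx K k) g) (sv K k).

Lemma otel_good k (s : Dl k -> T) m m' : sin B s -> good s m -> good s m' ->
  otel m (ocl (s \o @vx K k) g) (sv K k) = otel m' (ocl (s \o @vx K k) g) (sv K k).
Proof.
move=> sB; wlog mm' : m m' / (m <= m')%N.
  by move=> h gm gm'; case/orP: (leq_total m m') => mm'; [|symmetry]; exact: h.
move=> gm _; rewrite /otel -2!(big_mkord xpredT
  (fun j => iter j (osd (@obary K _)) (ohsd (ocl (s \o @vx K k) g)) (sv K k))).
rewrite [RHS](big_cat_nat _ mm') //= [X in _ = _ + X]big1_seq ?addr0 // => j.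
by rewrite mem_index_iota => /andP[_ /andP[mj _]]; exact: iter_ohsd_small gm mj.
Qed.

Lemma goodB k (s : Dl k -> T) : sin B s -> exists m, good s m.
Proof.
by move=> [cs sB]; apply: good_exists => // u; apply: coverB; apply: sB; exists u.
Qed.

Lemma hsubE k (s : Dl k -> T) m : sin B s -> good s m ->
  hsub s = otel m (ocl (s \o @vx K k) g) (sv K k).
Proof.
move=> sB gm; apply: otel_good => //; case: xgetP => // h.
by have [n gn] := goodB sB; have := h n.
Qed.

Lemma hsub_small k (s : Dl k -> T) : sin B s -> small s -> hsub s = 0.
Proof.
move=> sB [U OU Us]; rewrite (@hsubE _ _ 0%N) ?/otel ?big_ord0 // => y.
by exists U => // w _; apply: Us; exists w.
Qed.

Lemma dl_hsub k (s : Dl k -> T) : sin B s -> dl hsub s = g s.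
Proof.
case: k s => [|k] s sB.
  (* A 0-simplex has a single point, hence is small. *)
  rewrite g_small //; have [U OU Us] := coverB (sB.2 _ (imageT s (bary K 0))).
  exists U => // _ [u _ <-]; rewrite (_ : u = bary K 0) //.
  apply: bc_inj => i; rewrite ord1; have := bc_sum u; have := bc_sum (bary K 0).
  by rewrite !big_ord1 => -> ->.
have [m0 gm0] := goodB sB.
have /choice [mi gmi] : forall i, exists m, good (s \o coface i) m.
  by move=> i; apply: goodB; exact: sin_coface.
(* One number of subdivisions that serves s and all its faces, for which [hsub] may have chosen
   different ones. *)
pose m := (m0 + \sum_i mi i)%N.
have gm : good s m by apply: good_mono gm0; exact: leq_addr.
have gF i : good (s \o coface i) m.
  apply: good_mono (gmi i); rewrite /m (bigD1 i) //= addnCA; exact: leq_addr.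
transitivity (\sum_(i < k.+2)
    otel m (ocl ((s \o coface i) \o @vx K k) g) (sv K k) *~ (-1) ^+ i).
  by apply: eq_bigr => i _; rewrite (@hsubE _ _ m) //; exact: sin_coface.
rewrite (@dl_op _ _ _ g (fun k => @otel K M k m)); last 2 first.
- by move=> f i l; exact: otel_insert0.
- by move=> f f' l; apply: otel_local; exact: conv_stdsimplex.
have := otel_htp m (ocl (s \o @vx K k.+1) g) (sv K k.+1).
rewrite iter_osd_small // subr0 ocl_sv => <-.
rewrite (_ : otel m (dlo _) _ = 0) ?addr0 //.
have <- : otel m (fun=> 0 : M) (sv K k.+1) = 0.
  rewrite /otel big1 // => j _; rewrite -[RHS](iter_osd0 j (sv K k.+1)).
  by congr (iter _ _ _ _); apply/funext => t; rewrite ohsd0.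
apply: (otel_local m (@conv_stdsimplex K _) (@lin_sv K _)) => t Dt.
rewrite ocl_dl; apply: (ocl_eq0 (A := B) (E := Dl k.+1)) => //.
- exact: sB.1.
- exact: conv_stdsimplex.
- by move=> w Dw; apply: sB.2; exists (vx w).
Qed.

(** Applied below to the antipode. The numbers of subdivisions chosen for s and its image may
    differ, but their sum is good for both. *)
Lemma hsub_sym (a : T -> T) k (s : Dl k -> T) :
  (forall k (s : Dl k -> T), sin B s -> sin B (a \o s) /\ g (a \o s) = g s) ->
  sin B s -> hsub (a \o s) = hsub s.
Proof.
move=> ag sB; have [asB _] := ag _ _ sB.
have [m gm] := goodB sB; have [m' gm'] := goodB asB.
have gM : good s (m + m') by apply: good_mono gm; exact: leq_addr.
have gM' : good (a \o s) (m + m') by apply: good_mono gm'; exact: leq_addl.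
rewrite (hsubE sB gM) (hsubE asB gM').
apply: (otel_local _ (@conv_stdsimplex K _) (@lin_sv K _)) => t Dt.
rewrite /ocl; case st : (size t) => [//|j].
have /ag[_ <-] // : sin B ((s \o @vx K k) \o (fun u : Dl j => aff t u)).
apply: sin_aff => //; first exact: sB.1.
by move=> u; apply: sB.2; exists (vx (aff t u)).
Qed.

End Vanishing.
End SmallSimplices.

(** * The prism operator *)

Section Homotopy.
Variables (K : realType) (M : zmodType).
Local Notation Dl := (stdsimplex K).

Section Prism.
Variables (T T' : topologicalType) (h : T' -> K -> T).

(* The homotopies used below are defined by cases and not known to be continuous;
   it is enough that they preserve the continuity of simplices. *)
Definition simplexwise (B : set T') (Y : set T) : Prop :=
  forall m (p : Dl m -> T') (q : Dl m -> K), sin B p -> continuous q ->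
    (forall u, 0 <= q u <= 1) -> sin Y (fun u => h (p u) (q u)).

Let W k := ('rV[K]_k.+1 * K^o)%type.

(** Restriction to the bottom of the cylinder minus restriction to its top. It commutes with [dlo]
    and is 0 on the empty list, so that [ohtp] makes it null-homotopic: this homotopy is the prism
    operator. *)
Definition ophi k (f : seq (W k) -> M) (l : seq 'rV[K]_k.+1) : M :=
  f (map (fun w => (w, 0)) l) - f (map (fun w => (w, 1)) l).

Definition oapex k (l : seq 'rV[K]_k.+1) : W k := (head 0 l, 0).

Definition hmap k (s : Dl k -> T') (w : W k) : T := h (s (vx w.1)) w.2.

Definition hprism (c : cochain K M T) : cochain K M T' := fun k s =>
  ohtp (@ophi k) (@oapex k) (ocl (hmap s) c) (sv K k).

Definition cyl k : set (W k) := [set w | Dl k w.1 /\ 0 <= w.2 <= 1].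
Arguments cyl k : clear implicits.

Lemma aff_fst k (t : seq (W k)) m (u : Dl m) : size t = m.+1 ->
  (aff t u).1 = aff (map fst t) u.
Proof.
move=> st; rewrite /aff (big_morph fst (fun _ _ => erefl) erefl).
by apply: eq_bigr => i _ /=; rewrite (nth_map 0) ?st.
Qed.

Lemma aff_snd k (t : seq (W k)) m (u : Dl m) : size t = m.+1 ->
  (aff t u).2 = aff (map snd t) u.
Proof.
move=> st; rewrite /aff (big_morph snd (fun _ _ => erefl) erefl).
by apply: eq_bigr => i _ /=; rewrite (nth_map 0) ?st.
Qed.

Lemma conv_itv : conv [set x : K^o | 0 <= x <= 1].
Proof.
move=> l k u sl Dl' /=; have li (i : 'I_k.+1) : 0 <= l`_i <= 1.
  by apply: Dl'; rewrite mem_nth // sl.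
rewrite /aff; apply/andP; split.
  by apply: sumr_ge0 => i _; rewrite mulr_ge0 ?bc_ge0 //; case/andP: (li i).
rewrite -[leRHS](bc_sum u); apply: ler_sum => i _.
by rewrite ler_piMr ?bc_ge0 //; case/andP: (li i).
Qed.

Lemma lin_fst k (t : seq (W k)) : lin (cyl k) t -> lin (Dl k) (map fst t).
Proof. by move=> Dt x /mapP[w /Dt[? _] ->]. Qed.

Lemma lin_snd k (t : seq (W k)) :
  lin (cyl k) t -> lin [set x : K^o | 0 <= x <= 1] (map snd t).
Proof. by move=> Dt x /mapP[w /Dt[_ ?] ->]. Qed.

Lemma conv_cyl k : conv (cyl k).
Proof.
move=> l m u sl Dl'; split; rewrite ?aff_fst ?aff_snd //.
  by apply: conv_stdsimplex; rewrite ?size_map //; exact: lin_fst.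
by apply: conv_itv; rewrite ?size_map //; exact: lin_snd.
Qed.

Lemma ocl_hmap_eq0 (B : set T') (Y : set T) (c : cochain K M T) k (s : Dl k -> T') t :
  simplexwise B Y -> (forall k s, sin Y s -> c k s = 0) -> sin B s -> lin (cyl k) t ->
  ocl (hmap s) c t = 0.
Proof.
move=> hBY c0 sB Dt; rewrite /ocl; case st : (size t) => [//|m]; apply: c0.
rewrite (_ : _ \o _ = (fun u => h (((s \o @vx K k) \o (fun u => aff (map fst t) u)) u)
    (aff (map snd t) u))); last first.
  by apply/funext => u /=; rewrite /hmap aff_fst // aff_snd.
apply: hBY.
- apply: sin_aff; [exact: sB.1|by rewrite size_map|exact: lin_fst|].
  by move=> u; apply: sB.2; exists (vx (aff (map fst t) u)).
- exact: aff_continuous.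
- move=> u; apply: (conv_itv (l := map snd t)); first by rewrite size_map.
  exact: lin_snd.
Qed.

Definition insh k (i : 'I_k.+2) (w : W k) : W k.+1 := (insert0 i w.1, w.2).

Lemma insh_linear k (i : 'I_k.+2) : linear (insh i).
Proof. by move=> a x y; rewrite /insh /= linearP. Qed.

HB.instance Definition _ k (i : 'I_k.+2) :=
  GRing.isLinear.Build K (W k) (W k.+1) *:%R (insh i) (@insh_linear k i).

Lemma ocl_hmap_coface (c : cochain K M T) k (s : Dl k.+1 -> T') i t :
  lin (cyl k) t ->
  ocl (hmap (s \o coface i)) c t = ocl (hmap s) c (map (insh i) t).
Proof.
move=> Dt; rewrite /ocl size_map; case st : (size t) => [//|m].
congr (c m _); apply/funext => u /=; rewrite (aff_map (insh i)) // -/(aff t u).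
have [D1 _] := conv_cyl u st Dt.
by rewrite /hmap /= vx_insert0.
Qed.

Lemma ohtp_ophi_eq0 k f : (forall t, lin (cyl k) t -> f t = 0 :> M) ->
  forall l, lin (Dl k) l -> ohtp (@ophi k) (@oapex k) f l = 0.
Proof.
move=> f0 l Dl'; have PB (f' g' : seq (W k) -> M) t :
  ophi (fun t => f' t - g' t) t = ophi f' t - ophi g' t by rewrite /ophi subrACA.
have -> : 0 = ohtp (@ophi k) (@oapex k) (fun=> 0 : M) l.
  by have := ohtpB (@oapex k) PB (fun=> 0) (fun=> 0) l; rewrite !subrr.
apply: (ohtp_local (D := Dl k) (D' := cyl k)) => //.
- case=> // x t Dt _; split; first by apply: Dt; rewrite mem_head.
  by rewrite /= lexx ler01.
- move=> f' g' t Dt fg; rewrite /ophi !fg // => _ /mapP[w /Dt Dw ->].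
    by split=> //=; rewrite ler01 lexx.
  by split=> //=; rewrite ler01 lexx.
Qed.

Lemma ohtp_ophi_local k f g : (forall t, lin (cyl k) t -> f t = g t :> M) ->
  forall l, lin (Dl k) l ->
    ohtp (@ophi k) (@oapex k) f l = ohtp (@ophi k) (@oapex k) g l.
Proof.
move=> fg l Dl'; apply/eqP; rewrite -subr_eq0 -ohtpB; last first.
  by move=> f' g' t; rewrite /ophi subrACA.
by rewrite ohtp_ophi_eq0 // => t Dt; rewrite fg // subrr.
Qed.

Lemma hprism_eq0 (B : set T') (Y : set T) (c : cochain K M T) k (s : Dl k -> T') :
  simplexwise B Y -> (forall k s, sin Y s -> c k s = 0) -> sin B s -> hprism c s = 0.
Proof.
move=> hBY c0 sB; apply: ohtp_ophi_eq0 (@lin_sv K k) => t.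
exact: ocl_hmap_eq0 hBY c0 sB.
Qed.

(** The homotopy formula has one more term, the prism on [dl c], which vanishes because the prism
    stays in Y. *)
Lemma dl_hprism (B : set T') (Y : set T) (c : cochain K M T) k (s : Dl k -> T') :
  simplexwise B Y -> (forall k (s : Dl k -> T), sin Y s -> dl c s = 0) -> sin B s ->
  dl (hprism c) s = c k (fun u => h (s u) 0) - c k (fun u => h (s u) 1).
Proof.
move=> hBY c0 sB.
have mf (t : K) l : map fst (map (fun w : 'rV[K]_k.+1 => (w, t) : W k) l) = l.
  by elim: l => //= x l ->.
have E (t : K) : ocl (hmap s) c (map (fun w => (w, t)) (sv K k)) =
    c k (fun u => h (s u) t).
  rewrite /ocl size_map size_sv; congr (c k _); apply/funext => u.
  have st : size (map (fun w : 'rV[K]_k.+1 => (w, t) : W k) (sv K k)) = k.+1.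
    by rewrite size_map size_sv.
  rewrite /hmap /= (aff_fst _ st) (aff_snd _ st).
  rewrite mf aff_sv vxK; congr (h _ _).
  rewrite /aff -[RHS]mul1r -(bc_sum u) mulr_suml; apply: eq_bigr => i _.
  by rewrite -map_comp (nth_map 0) // size_sv.
rewrite -!E -/(ophi (ocl (hmap s) c) (sv K k)).
rewrite -(@ohtp_htp _ _ _ (@ophi k) (@oapex k)); first last.
- by move=> f; rewrite /ophi subrr.
- by move=> f l; rewrite /ophi dloB !dlo_map.
- by move=> f g l; rewrite /ophi subrACA.
rewrite [X in _ = _ + X]ohtp_ophi_eq0 ?addr0; last 2 first.
- by move=> t Dt; rewrite ocl_dl; exact: ocl_hmap_eq0 hBY c0 sB Dt.
- exact: lin_sv.
case: k s sB {mf E} => [|k] s sB.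
  by rewrite /= /sv enum_ordSl enum_ord0 /= subr0.
rewrite dlo_sum size_sv; apply: eq_bigr => i _; congr (_ *~ _).
rewrite sv_del (@ohtp_map _ _ _ _ _ (@ophi k) (@oapex k) _ _ _ (insh i)).
- apply: ohtp_ophi_local (@lin_sv K k) => t Dt.
  exact: ocl_hmap_coface.
- by move=> f l; rewrite /ophi -!map_comp.
- by case.
Qed.

End Prism.
End Homotopy.

(** * Attaching a cell *)

Section Retraction.
Variables (K : realType) (k : nat).
Local Notation Dl := (stdsimplex K).
Implicit Types v b : Dl k.

Definition bd (n : nat) : set (Dl n) := [set u | exists i, bc u i = 0].

Lemma bdE n (u : Dl n) : ~ bd u <-> simplex_interior u.
Proof.
split=> [nb i|ui [i ui0]].
  by rewrite lt_neqAle bc_ge0 andbT eq_sym; apply/eqP => ui0; apply: nb; exists i.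
by have := ui i; rewrite -/(bc u i) ui0 ltxx.
Qed.

Lemma continuous_bc (X : topologicalType) (a : X -> Dl k) :
  (forall i, continuous (fun x => bc (a x) i)) -> continuous a.
Proof.
move=> ca; apply: continuous_comp_initial.
rewrite (_ : _ \o a = (fun x => \sum_(i < k.+1) bc (a x) i *: delta_mx 0 i)).
  apply: continuous_big => [|i _ x]; first exact: add_continuous.
  have h := @cvgZr_tmp K 'rV[K]_k.+1 _ (nbhs x) _ (fun x => bc (a x) i) (bc (a x) i)
    (delta_mx 0 i).
  by apply: h; exact: ca.
apply/funext => x /=; rewrite -[LHS]aff_sv /aff.
by apply: eq_bigr => i _; rewrite nth_sv.
Qed.

Lemma dist_le1 (u w : Dl k) : `|set_val u - set_val w| <= 1.
Proof.
rewrite -[`|_|]/(mx_norm _) mx_normrE; apply/bigmax_leP; split=> // -[i j] _ /=.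
rewrite ord1 !mxE; have := bc_ge0 u j; have := bc_ge0 w j.
have := bc_le1 u j; have := bc_le1 w j; rewrite /bc.
by rewrite ler_norml => ? ? ? ?; lra.
Qed.

Variable b : Dl k.

(* The point b may lie on the boundary, so that the radial retraction from b is not
   continuous: v is pushed away from the centre rctr v instead, an interior point
   for v <> b, which tends to b with v. *)
Definition rlam v : K := `|set_val v - set_val b| / 2.
Definition rctr v i : K := (1 - rlam v) * bc b i + rlam v * bc (bary K k) i.
(** The gauge of the simplex seen from the centre: for r > 0 the point [rctr v + (v - rctr v) / r]
    has nonnegative coordinates exactly when r is at least this maximum. So [rexit] is where the ray
    from the centre through v leaves the simplex. *)
Definition rgau v : K := \big[Order.max/0]_(i < k.+1) (1 - bc v i / rctr v i).
Definition rexit v i : K := rctr v i + (bc v i - rctr v i) / rgau v.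
Definition rmov v (t : K) i : K := bc v i + t * (rexit v i - bc v i).

Section Facts.
Variable v : Dl k.
Hypothesis vb : v <> b.

Lemma rlam_gt0 : 0 < rlam v.
Proof.
rewrite divr_gt0 // normr_gt0 subr_eq0; apply/eqP => /val_inj; exact: vb.
Qed.

Lemma rlam_le : rlam v <= 1 / 2.
Proof. by rewrite ler_pM2r ?invr_gt0 // dist_le1. Qed.

Lemma rctr_gt0 i : 0 < rctr v i.
Proof.
have l0 := rlam_gt0; have l1 := rlam_le; have b0 := bc_ge0 b i.
have a0 : 0 < bc (bary K k) i by rewrite bc_bary invr_gt0 ltr0n.
rewrite /rctr; apply: ltr_wpDl; last exact: mulr_gt0.
by apply: mulr_ge0 => //; lra.
Qed.

Lemma rctr_sum : \sum_i rctr v i = 1.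
Proof. by rewrite big_split /= -!mulr_sumr !bc_sum; lra. Qed.

(* If b = c + tau (v - c) with tau >= 1 (tau' = 1/tau), then v lies on the segment
   from the centre c to b, which is too short to contain v. *)
Lemma rctr_far (tau : K) : 0 <= tau <= 1 ->
  ~ (forall i, bc v i - rctr v i = tau * (bc b i - rctr v i)).
Proof.
move=> /andP[t0 t1] vt.
have E : set_val v - set_val b =
    ((1 - tau) * rlam v) *: (set_val (bary K k) - set_val b).
  apply/rowP => i; rewrite !mxE -/(bc v i) -/(bc b i) .
  have := vt i; rewrite /rctr bc_bary => h.
  have -> : bc v i - bc b i = (bc v i - ((1 - rlam v) * bc b i + rlam v * k.+1%:R^-1))
    + ((1 - rlam v) * bc b i + rlam v * k.+1%:R^-1) - bc b i by ring.
  by rewrite h; ring.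
have : `|set_val v - set_val b| <= rlam v.
  rewrite E normrZ ger0_norm; last by rewrite mulr_ge0 ?subr_ge0 // ltW ?rlam_gt0.
  rewrite -[leRHS]mulr1 ler_pM ?dist_le1 //.
    by rewrite mulr_ge0 ?subr_ge0 // ltW ?rlam_gt0.
  by apply: ler_piMl; [exact/ltW/rlam_gt0|rewrite gerBl].
by have := rlam_gt0; rewrite {2}/rlam /rlam; lra.
Qed.

Lemma rgau_ge i : 1 - bc v i / rctr v i <= rgau v.
Proof. exact: le_bigmax. Qed.

Lemma rgau_le1 : rgau v <= 1.
Proof.
apply: bigmax_le => // i _; rewrite lerBlDr lerDl divr_ge0 ?bc_ge0 //.
exact/ltW/rctr_gt0.
Qed.

(** Some coordinate of v is below that of the centre; otherwise v would be the centre, which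
    [rctr_far] excludes with tau = 0. *)
Lemma rgau_gt0 : 0 < rgau v.
Proof.
have [i vi] : exists i, bc v i < rctr v i.
  apply: contrapT => /forallNP h.
  have hi i : rctr v i <= bc v i by rewrite leNgt; apply/negP; exact: h.
  have : 0 <= (0 : K) <= 1 by rewrite lexx ler01.
  move=> /rctr_far; apply => i; rewrite mul0r.
  have : \sum_i (bc v i - rctr v i) = 0 by rewrite sumrB bc_sum rctr_sum subrr.
  have p0 j : true -> 0 <= bc v j - rctr v j by rewrite subr_ge0.
  by move/eqP; rewrite psumr_eq0 // => /allP/(_ i)/(_ (mem_index_enum _))/eqP.
apply: lt_le_trans (rgau_ge i).
by rewrite subr_gt0 ltr_pdivrMr ?rctr_gt0 // mul1r.
Qed.

Lemma rgau_eq : exists i, rgau v = 1 - bc v i / rctr v i.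
Proof.
have := rgau_gt0; rewrite /rgau.
elim/big_rec: _ => [|i x _ IH]; first by rewrite ltxx.
by rewrite /Order.max; case: ifP => // _ _; exists i.
Qed.

Lemma rexit_ge0 i : 0 <= rexit v i.
Proof.
have := rgau_ge i; rewrite lerBlDr -lerBlDl ler_pdivlMr ?rctr_gt0 // => h.
rewrite /rexit -[rctr v i in X in X + _](mulfK (lt0r_neq0 rgau_gt0)) -mulrDl.
by rewrite divr_ge0 ?(ltW rgau_gt0) //; move: h; rewrite mulrBl mul1r; lra.
Qed.

Lemma rexit_sum : \sum_i rexit v i = 1.
Proof. by rewrite big_split /= -mulr_suml sumrB rctr_sum bc_sum subrr mul0r addr0. Qed.

Lemma rexit_eq0 : exists i, rexit v i = 0.
Proof.
have [i gi] := rgau_eq; exists i; rewrite /rexit.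
have -> : bc v i - rctr v i = - (rgau v * rctr v i).
  by rewrite gi mulrBl mul1r divfK ?gt_eqF ?rctr_gt0 // opprB.
by rewrite mulNr mulrAC divff ?gt_eqF ?rgau_gt0 // mul1r subrr.
Qed.

Lemma rmov_ge0 t i : 0 <= t <= 1 -> 0 <= rmov v t i.
Proof.
move=> /andP[t0 t1]; have e0 := rexit_ge0 i; have v0 := bc_ge0 v i.
have -> : rmov v t i = (1 - t) * bc v i + t * rexit v i by rewrite /rmov; ring.
by rewrite addr_ge0 // mulr_ge0 // subr_ge0.
Qed.

Lemma rmov_sum t : \sum_i rmov v t i = 1.
Proof.
by rewrite big_split /= -mulr_sumr sumrB rexit_sum bc_sum subrr mulr0 addr0.
Qed.

Lemma rmov_neq t : 0 <= t <= 1 -> ~ (forall i, rmov v t i = bc b i).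
Proof.
move=> /andP[t0 t1] h; have g0 := rgau_gt0; have g1 := rgau_le1.
(* The moved point is [rctr v + (1 - t + t / rgau v) (v - rctr v)] and tau is the inverse of this
   factor: were the moved point b, then v would lie at the fraction tau of the way from the centre
   to b. *)
pose tau := rgau v / ((1 - t) * rgau v + t).
have d0 : 0 < (1 - t) * rgau v + t.
  have [t10|t1'] := eqVneq t 1; first by rewrite t10 subrr mul0r add0r ltr01.
  have : 0 < (1 - t) * rgau v by rewrite mulr_gt0 // subr_gt0 lt_neqAle t1' t1.
  by move=> ?; lra.
have tau01 : 0 <= tau <= 1.
  apply/andP; split; first by apply: divr_ge0; exact: ltW.
  rewrite /tau ler_pdivrMr // mul1r.
  have : 0 <= t * (1 - rgau v) by rewrite mulr_ge0 // subr_ge0.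
  by move=> ?; lra.
apply: (rctr_far tau01) => i; rewrite -h /rmov /rexit /tau.
by field; rewrite !gt_eqF.
Qed.

Lemma rmov_bd t i : bd v -> rmov v t i = bc v i.
Proof.
move=> [j vj]; have g1 : rgau v = 1.
  by apply: le_anti; rewrite rgau_le1 /=; have := rgau_ge j; rewrite vj mul0r subr0.
by rewrite /rmov /rexit g1 divr1; ring.
Qed.

End Facts.

Definition rpush v (t : K) : Dl k := vx (\row_i rmov v t i).

Lemma bc_rpush v t i : v <> b -> 0 <= t <= 1 -> bc (rpush v t) i = rmov v t i.
Proof.
move=> vb t01; rewrite /bc /rpush val_vx ?mxE //; split=> [j|].
  by rewrite mxE rmov_ge0.
by under eq_bigr do rewrite mxE; exact: rmov_sum.
Qed.

Lemma rpush_neq v t : v <> b -> 0 <= t <= 1 -> rpush v t <> b.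
Proof. by move=> vb t01 E; apply: (rmov_neq vb t01) => i; rewrite -bc_rpush // E. Qed.

Lemma rpush_bd v t : v <> b -> 0 <= t <= 1 -> bd v -> rpush v t = v.
Proof. by move=> vb t01 dv; apply: bc_inj => i; rewrite bc_rpush // rmov_bd. Qed.

Lemma rpush0 v : v <> b -> rpush v 0 = v.
Proof.
move=> vb; apply: bc_inj => i; rewrite bc_rpush //; last by rewrite lexx ler01.
by rewrite /rmov mul0r addr0.
Qed.

Lemma bd_rpush1 v : v <> b -> bd (rpush v 1).
Proof.
move=> vb; have [i ei] := rexit_eq0 vb; exists i.
rewrite bc_rpush //; last by rewrite ler01 lexx.
by rewrite /rmov mul1r ei sub0r subrr.
Qed.

Lemma rpush_continuous (X : topologicalType) (a : X -> Dl k) (q : X -> K) :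
  continuous a -> continuous q -> (forall x, a x <> b) -> (forall x, 0 <= q x <= 1) ->
  continuous (fun x => rpush (a x) (q x)).
Proof.
move=> ca cq ab q01; apply: continuous_bc => i.
rewrite (_ : (fun x => _) = (fun x => rmov (a x) (q x) i)); last first.
  by apply/funext => x; rewrite bc_rpush.
have cbc j x : bc (a y) j @[y --> x] --> bc (a x) j.
  by apply: (@continuous_comp _ _ _ a (fun v => bc v j)); [exact: ca|exact: bc_continuous].
have clam x : rlam (a y) @[y --> x] --> rlam (a x).
  apply: cvgMl; apply: (@cvg_norm _ 'rV[K]_k.+1); apply: cvgB; last exact: cvg_cst.
  apply: (@continuous_comp _ _ _ a (set_val : Dl k -> 'rV[K]_k.+1)); first exact: ca.
  exact: initial_continuous.
have cctr j x : rctr (a y) j @[y --> x] --> rctr (a x) j.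
  apply: cvgD; last by apply: cvgMl; exact: clam.
  by apply: cvgMl; apply: cvgB; [exact: cvg_cst|exact: clam].
have cgau x : rgau (a y) @[y --> x] --> rgau (a x).
  apply: cvg_big => [|j _]; first exact: max_continuous.
  apply: cvgB; first exact: cvg_cst.
  apply: cvgM; first exact: cbc.
  by apply: cvgV; [rewrite gt_eqF // rctr_gt0|exact: cctr].
move=> x; apply: cvgD; first exact: cbc.
apply: cvgM; first exact: cq.
apply: cvgB; last exact: cbc.
apply: cvgD; first exact: cctr.
apply: cvgM; first by apply: cvgB; [exact: cbc|exact: cctr].
by apply: cvgV; [rewrite gt_eqF // rgau_gt0|exact: cgau].
Qed.

End Retraction.

(** * Relative cohomology by cochains that vanish on a subset *)

Section Calculus.
Variables (K : realType) (M : zmodType).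
Local Notation Dl := (stdsimplex K).

Section OneSpace.
Variable T : topologicalType.
Implicit Types (A B C U V : set T) (c e g : cochain K M T).

Definition vanish A c : Prop := forall k (s : Dl k -> T), sin A s -> c k s = 0.

(** Relative cocycles of the pair (B, A), in all degrees at once; a single degree is singled out by
    [homog] where it matters. *)
Definition rcocycle B A c : Prop := vanish A c /\ vanish B (dl c).

Definition null B A c : Prop := exists2 e, vanish A e &
  forall k (s : Dl k -> T), sin B s -> c k s = dl e s.

Definition acyclic B A : Prop := forall c, rcocycle B A c -> null B A c.

Lemma vanish_sub A B c : A `<=` B -> vanish B c -> vanish A c.
Proof. by move=> AB c0 k s sA; apply: c0; exact: sin_sub sA. Qed.

Lemma dlB c g k (s : Dl k -> T) :
  dl (fun k s => c k s - g k s) s = dl c s - dl g s.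
Proof.
case: k s => [|k] s /=; first by rewrite subrr.
by rewrite -sumrB; apply: eq_bigr => i _; rewrite mulrzBl.
Qed.

Lemma dlD c g k (s : Dl k -> T) :
  dl (fun k s => c k s + g k s) s = dl c s + dl g s.
Proof.
case: k s => [|k] s /=; first by rewrite addr0.
by rewrite -big_split; apply: eq_bigr => i _; rewrite mulrzDl.
Qed.

Lemma dl_vanish A c : vanish A c -> vanish A (dl c).
Proof.
move=> c0 [|k] s sA //=; rewrite big1 // => i _.
by rewrite c0 ?mul0rz //; exact: sin_coface.
Qed.

Lemma dl_dl c k (s : Dl k -> T) : dl (dl c) s = 0.
Proof.
rewrite -[LHS](@ocl_sv K M T k s (dl (dl c))) -ocl_dl.
rewrite -[RHS](@dlo_dlo M _ (ocl (s \o @vx K k) c) (sv K k)).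
by congr (dlo _ _); apply/funext => l; rewrite ocl_dl.
Qed.

Lemma rcocycleB A B c g : rcocycle B A c -> rcocycle B A g ->
  rcocycle B A (fun k s => c k s - g k s).
Proof.
move=> [c0 c1] [g0 g1]; split=> k s sA; first by rewrite c0 // g0 // subrr.
by rewrite dlB c1 // g1 // subrr.
Qed.

Lemma rcocycle_sub B B' A A' c : B' `<=` B -> A' `<=` A ->
  rcocycle B A c -> rcocycle B' A' c.
Proof. by move=> BB AA [? ?]; split; [exact: vanish_sub AA _|exact: vanish_sub BB _]. Qed.

(** The triple (C, B, A): after subtracting the coboundary of a primitive over (B, A), what is left
    is a cocycle of (C, B). *)
Lemma acyclic_trans A B C : A `<=` B -> B `<=` C ->
  acyclic B A -> acyclic C B -> acyclic C A.
Proof.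
move=> AB BC aBA aCB c cc.
have [e e0 ce] := aBA c (rcocycle_sub BC (@subset_refl _ A) cc).
have [|g g0 cg] := aCB (fun k s => c k s - dl e s).
  split=> k s sA; first by rewrite ce // subrr.
  by rewrite dlB dl_dl subr0 cc.2.
exists (fun k s => e k s + g k s) => k s sA.
  by rewrite e0 // g0 ?addr0 //; exact: sin_sub sA.
by rewrite dlD -cg // addrC subrK.
Qed.

(** Excision in the form used throughout. The small simplices are those inside U or V; g vanishes on
    them, and the primitive [hsub] vanishes on them again. *)
Lemma small2 B U V g : open U -> open V -> B `<=` U `|` V ->
  vanish B (dl g) -> vanish (B `&` U) g -> vanish (B `&` V) g ->
  exists h, [/\ vanish (B `&` U) h, vanish (B `&` V) h &
    forall k (s : Dl k -> T), sin B s -> g k s = dl h s].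
Proof.
move=> oU oV BUV g_dl gU gV.
pose O : set (set T) := [set U; V].
have openO W : O W -> open W by case=> ->.
have cB x : B x -> exists2 W, O W & W x.
  by move=> /BUV[Ux|Vx]; [exists U; [left|]|exists V; [right|]].
have g0 k (s : Dl k -> T) : sin B s -> small O s -> g k s = 0.
  move=> [cs sB] [W OW sW]; have : sin (B `&` W) s.
    by split=> // x xs; split; [exact: (sB _ xs)|exact: (sW _ xs)].
  by case: OW => ->; [exact: gU|exact: gV].
exists (hsub O g); split=> k s sB.
- apply: (hsub_small openO cB g0); first by apply: sin_sub sB => x [].
  by exists U; [left|move=> x /sB.2[]].
- apply: (hsub_small openO cB g0); first by apply: sin_sub sB => x [].
  by exists V; [right|move=> x /sB.2[]].
- by rewrite (dl_hsub openO cB g_dl g0).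
Qed.

(** The prism on c vanishes on A because the homotopy preserves A, and the end of the homotopy
    contributes 0 because it lies in A. *)
Lemma acyclic_retract A B (h : T -> K -> T) : simplexwise h B B -> simplexwise h A A ->
  (forall x, B x -> h x 0 = x) -> (forall x, B x -> A (h x 1)) -> acyclic B A.
Proof.
move=> hB hA h0 h1 c [cA cB]; exists (hprism h c).
  by move=> k s sA; apply: hprism_eq0 hA cA sA.
move=> k s sB; rewrite (dl_hprism hB cB sB).
rewrite [X in _ = _ - X](cA _ (fun u => h (s u) 1)) ?subr0.
  by congr (c k _); apply/funext => u; rewrite h0 //; apply: sB.2; exists u.
have c1' : continuous (fun _ : Dl k => 1 : K) by exact: cst_continuous.
have [|c1 _] := @hB k s (fun=> 1) sB c1'; first by move=> u; rewrite ler01 lexx.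
by split=> // _ [u _ <-]; apply: h1; apply: sB.2; exists u.
Qed.

End OneSpace.

Lemma dl_comp (T T' : topologicalType) (f : T' -> T) (c : cochain K M T) k
    (s : Dl k -> T') :
  dl (fun k (s : Dl k -> T') => c k (f \o s)) s = dl c (f \o s).
Proof. by case: k s. Qed.

Lemma sin_comp (T T' : topologicalType) (f : T' -> T) (A : set T) (A' : set T') k
    (s : Dl k -> T') : continuous f -> A' `<=` f @^-1` A -> sin A' s -> sin A (f \o s).
Proof.
move=> cf fA [cs sA']; split=> [u|_ [u _ <-]].
  by apply: continuous_comp; [exact: cs|exact: cf].
by apply: fA; apply: sA'; exists u.
Qed.

Lemma compact_embedding (X Y : topologicalType) (f : X -> Y) :
  compact [set: X] -> hausdorff_space Y -> continuous f -> injective f ->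
  embedding f.
Proof.
move=> cX hY cf inf; split=> // U oU; exists (~` (f @` (~` U))).
  rewrite openC; apply: compact_closed => //; apply: continuous_compact.
    exact: continuous_subspaceT.
  by apply: (subclosed_compact _ cX) => //; rewrite closedC.
rewrite eqEsubset; split=> x /=.
  by move=> Ux [y nUy /inf yx]; apply: nUy; rewrite yx.
by move=> h; apply: contrapT => nUx; apply: h; exists x.
Qed.

Lemma inj_hausdorff (X Y : topologicalType) (f : X -> Y) :
  hausdorff_space Y -> continuous f -> injective f -> hausdorff_space X.
Proof.
move=> hY cf inf p q cpq; apply: inf; apply: hY => A B /cf fA /cf fB.
by have [x [Ax Bx]] := cpq _ _ fA fB; exists (f x).
Qed.

Lemma simplex_hausdorff k : hausdorff_space (Dl k).
Proof.
apply: (@inj_hausdorff _ _ (set_val : Dl k -> 'rV[K]_k.+1)).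
- exact: norm_hausdorff.
- exact: initial_continuous.
- by move=> x y /val_inj.
Qed.

Lemma coface_inj k (i : 'I_k.+2) : injective (@coface K k i).
Proof.
move=> u v /(congr1 (fun w => set_val w)) /= /rowP uv; apply: bc_inj => j.
by have := uv (lift i j); rewrite !mxE liftK.
Qed.

Lemma coface_embedding k (i : 'I_k.+2) : embedding (@coface K k i).
Proof.
apply: compact_embedding; [exact: simplex_compact|exact: simplex_hausdorff| |].
- exact: coface_continuous.
- exact: coface_inj.
Qed.

Lemma bc_coface k (i : 'I_k.+2) (u : Dl k) j :
  bc (coface i u) j = if unlift i j is Some j' then bc u j' else 0.
Proof. by rewrite /bc /= mxE. Qed.

Definition facets k (P : pred 'I_k.+1) : set (Dl k) :=
  [set u | exists2 i, P i & bc u i = 0].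

Lemma facets_closed k (P : pred 'I_k.+1) : closed (facets P).
Proof.
have -> : facets P = (fun u : Dl k => \prod_(i | P i) bc u i) @^-1` [set 0].
  rewrite eqEsubset; split=> u /=.
    by move=> [i Pi ui]; rewrite (bigD1 i) //= ui mul0r.
  by move/eqP/prodf_eq0 => [i Pi /eqP ui]; exists i.
apply: preimage_closed => [u _|]; last exact: closed_eq.
apply: continuous_big => [|i _]; first exact: mul_continuous.
exact: bc_continuous.
Qed.

Lemma bd_facets k : bd (n := k) = facets xpredT.
Proof. by rewrite eqEsubset; split=> u [i]; [exists i|move=> _; exists i]. Qed.

Lemma bd_closed k : closed (bd (K := K) (n := k)).
Proof. by rewrite bd_facets; exact: facets_closed. Qed.

Lemma bary_nbd k : ~ bd (bary K k).
Proof. by move=> [i /eqP]; rewrite bc_bary invr_eq0 pnatr_eq0. Qed.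

End Calculus.

Section Attach.
Variable K : realType.
Local Notation Dl := (stdsimplex K).

Section OneCell.
Variables (T : topologicalType) (A : set T) (k : nat) (phi : Dl k -> T).
Hypothesis closedA : closed A.
Hypothesis closed_phi : closed (range phi).
Hypothesis emb_phi : embedding phi.
Hypothesis phi_bd : forall u, bd u -> A (phi u).
Hypothesis phi_int : forall u, A (phi u) -> bd u.

Let cphi : continuous phi. Proof. by case: emb_phi. Qed.
Let iphi : injective phi. Proof. by case: emb_phi. Qed.

Definition phinv (x : T) : Dl k := xget (bary K k) [set u | phi u = x].

Lemma phinvK x : range phi x -> phi (phinv x) = x.
Proof. by move=> [u _ <-]; rewrite /phinv; case: xgetP => [v _ //|h]; have := h u erefl. Qed.

Lemma phiK u : phinv (phi u) = u.
Proof. by apply: iphi; apply: phinvK; exists u. Qed.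

Lemma phinv_continuous (X : topologicalType) (p : X -> T) :
  continuous p -> (forall x, range phi (p x)) -> continuous (phinv \o p).
Proof.
move=> cp rp; apply/continuousP => U oU; case: emb_phi => _ _ /(_ U oU)[V oV UV].
rewrite (_ : _ @^-1` U = p @^-1` V); first by move/continuousP: cp; exact.
by rewrite UV eqEsubset; split=> x /=; rewrite phinvK.
Qed.

Lemma sin_phinv (E : set T) m (s : Dl m -> T) : E `<=` range phi ->
  sin E s -> sin (phi @^-1` E) (phinv \o s).
Proof.
move=> EB [cs sE]; split=> [|_ [u _ <-] /=].
  by apply: phinv_continuous => // u; apply/EB/sE; exists u.
by rewrite phinvK; [apply: sE; exists u|apply/EB/sE; exists u].
Qed.

Section Puncture.
Variable b : Dl k.

Definition push (x : T) (t : K) : T :=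
  if pselect (range phi x) then phi (rpush b (phinv x) t) else x.

Lemma push_phi u t : push (phi u) t = phi (rpush b u t).
Proof. by rewrite /push; case: pselect => [?|[]]; [rewrite phiK|exists u]. Qed.

Lemma push_A x t : A x -> x <> phi b -> 0 <= t <= 1 -> push x t = x.
Proof.
move=> + + t01; have [[u _ <-]|nx] := pselect (range phi x); last first.
  by rewrite /push; case: pselect.
move=> Ax xb; rewrite push_phi rpush_bd //.
  by move=> ub; apply: xb; rewrite ub.
exact: phi_int.
Qed.

Let B := A `|` range phi.

(** A stays fixed and the closed cell moves radially. Both are closed, so continuity along a simplex
    is checked on two closed preimages. *)
Lemma simplexwise_push : simplexwise push (B `\ phi b) (B `\ phi b).
Proof.
move=> m p q [cp pB] cq q01.
have pBu u : B (p u) /\ p u <> phi b by apply: pB; exists u.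
split; last first.
  move=> _ [u _ <-]; have [[Au|[v _ vu]] nb] := pBu u.
    by rewrite push_A //; exact: pBu.
  have vb : v <> b by move=> vb; apply: nb; rewrite -vu vb.
  rewrite -vu push_phi; split; first by right; exists (rpush b v (q u)).
  by move=> /iphi; exact: rpush_neq.
apply/continuous_subspace_setT.
have -> : [set: Dl m] = (p @^-1` A) `|` (p @^-1` range phi).
  by rewrite eqEsubset; split=> u // _; have [] := pBu u.
apply: withinU_continuous.
- by apply: preimage_closed => // u _; exact: cp.
- by apply: preimage_closed => // u _; exact: cp.
- apply/subspace_sigL_continuousP.
  rewrite (_ : sigL _ _ = p \o set_val).
    move=> u; apply: continuous_comp; last exact: cp.
    exact: initial_continuous.
  apply/funext => -[u /= uA]; rewrite /sigL /= push_A //; first exact: set_mem uA.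
  by have [] := pBu u.
- apply/subspace_sigL_continuousP.
  set C := p @^-1` range phi.
  have cv : continuous (set_val : C -> Dl m) by exact: initial_continuous.
  have cr : continuous (fun y : C => rpush b ((phinv \o (p \o set_val)) y)
     ((q \o set_val) y)).
    apply: rpush_continuous.
    + apply: phinv_continuous => [y|y]; last exact: set_mem (valP y).
      by apply: continuous_comp; [exact: cv|exact: cp].
    + by move=> y; apply: continuous_comp; [exact: cv|exact: cq].
    + move=> y yb; have [_] := pBu (set_val y); apply; rewrite -yb /= phinvK //.
      exact: set_mem (valP y).
    + by move=> y; exact: q01.
  rewrite (_ : sigL _ _ = phi \o (fun y : C => rpush b ((phinv \o (p \o set_val)) y)
     ((q \o set_val) y))).
    by move=> y; apply: continuous_comp; [exact: cr|exact: cphi].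
  apply/funext => -[u /= uA]; rewrite /sigL /= /push; case: pselect => // -[].
  exact: set_mem uA.
Qed.

(** The point b may lie on the boundary of the simplex, and the puncture then affects A too. This
    case occurs when a point of a cell y is removed from the cofaces of y. *)
Lemma acyclic_puncture (M : zmodType) : acyclic K M (B `\ phi b) (A `\ phi b).
Proof.
apply: (acyclic_retract simplexwise_push).
- move=> m p q [cp pA] cq q01.
  rewrite (_ : (fun u => _) = p); first by split.
  apply/funext => u; have [|Au nb] := pA (p u); first by exists u.
  by rewrite push_A.
- move=> x [[Ax|[u _ <-]] xb]; first by rewrite push_A // lexx ler01.
  by rewrite push_phi rpush0 // => ub; apply: xb; rewrite ub.
- move=> x [[Ax|[u _ <-]] xb].
    by rewrite push_A ?ler01 ?lexx //; split.
  have ub : u <> b by move=> ub; apply: xb; rewrite ub.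
  rewrite push_phi; split; first by apply/phi_bd/bd_rpush1.
  by move=> /iphi; apply: rpush_neq => //; rewrite ler01 lexx.
Qed.

End Puncture.
End OneCell.

Lemma acyclic_bd (M : zmodType) k : acyclic K M (~` [set bary K k]) (@bd K k).
Proof.
have h := @acyclic_puncture _ (@bd K k) k id (@bd_closed K k).
have e : embedding (@id (Dl k)).
  by split=> [x|x y //|U oU]; [exact: cvg_id|exists U].
have := h _ e (fun _ => id) (fun _ => id) (bary K k) M.
rewrite (_ : _ `\ _ = ~` [set bary K k]); last first.
  by rewrite eqEsubset; split=> x /=; [case|split=> //; right; exists x].
rewrite (_ : bd (n := k) `\ _ = bd (n := k)); last first.
  rewrite eqEsubset; split=> x; [by case|split=> // xb].
  by apply: (@bary_nbd K k); rewrite -xb.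
by apply; rewrite (_ : range id = setT) ?closedT //; rewrite eqEsubset; split=> // x; exists x.
Qed.

(** Together with [simplex_cocycle]: the cohomology of the simplex modulo its boundary is M, in
    degree k, by evaluation on the identity. *)
Definition simplex_null (M : zmodType) k := forall c : cochain K M (Dl k),
  rcocycle setT (@bd K k) c -> c k id = 0 -> null setT (@bd K k) c.

Definition simplex_cocycle (M : zmodType) k := forall m : M,
  exists2 c : cochain K M (Dl k), rcocycle setT (@bd K k) c & c k id = m.

Lemma dl_id_bd (M : zmodType) k (c : cochain K M (Dl k)) (A : set (Dl k)) :
  @bd K k `<=` A -> vanish A c -> dl c (@id (Dl k)) = 0.
Proof.
case: k c A => [//|k] c A bA c0 /=; rewrite big1 // => i _.
rewrite c0 ?mul0rz //; split; first exact: coface_continuous.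
by move=> _ [u _ <-]; apply: bA; exists i; rewrite bc_coface unlift_none.
Qed.

Section OneCellCohomology.
Variables (T : topologicalType) (A : set T) (k : nat) (phi : Dl k -> T).
Variable M : zmodType.
Hypothesis closedA : closed A.
Hypothesis closed1 : forall x : T, closed [set x].
Hypothesis closed_phi : closed (range phi).
Hypothesis emb_phi : embedding phi.
Hypothesis phi_bd : forall u, bd u -> A (phi u).
Hypothesis phi_int : forall u, A (phi u) -> bd u.

Let B := A `|` range phi.
Let b := phi (bary K k).
Let iphi : injective phi. Proof. by case: emb_phi. Qed.
Let cphi : continuous phi. Proof. by case: emb_phi. Qed.
Let bA : ~ A b. Proof. by move=> /phi_int /bary_nbd. Qed.
Let Ab : A `<=` B `\ b.
Proof. by move=> x Ax; split; [left|move=> xb; apply: bA; rewrite -xb]. Qed.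
Let oA : open (~` A). Proof. by rewrite openC. Qed.
Let ob : open (~` [set b]). Proof. by rewrite openC. Qed.
Let BUV : B `<=` (~` A) `|` (~` [set b]).
Proof.
by move=> x Bx; have [Ax|] := pselect (A x); [right=> xb; apply: bA; rewrite -xb|left].
Qed.
Let intphi x : B x -> ~ A x -> range phi x. Proof. by case. Qed.

Lemma acyclic_attach : acyclic K M (B `\ b) A.
Proof.
have := @acyclic_puncture _ _ _ _ closedA closed_phi emb_phi phi_bd phi_int (bary K k) M.
rewrite (_ : A `\ phi (bary K k) = A) //.
by rewrite eqEsubset; split=> x; [case|split=> // xb; apply: bA; rewrite /b -xb].
Qed.

(** Transport of e to the open cell. It commutes with [dl] only on simplices inside the open cell;
    the defect elsewhere is repaired by [small2]. *)
Definition pushc (e : cochain K M (Dl k)) : cochain K M T := fun m s =>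
  if `[< sin (B `&` ~` A) s >] then e m (phinv phi \o s) else 0.

Lemma dl_pushc e m (s : Dl m -> T) : sin (B `&` ~` A) s ->
  dl (pushc e) s = dl e (phinv phi \o s).
Proof.
case: m s => [//|m] s sz /=; apply: eq_bigr => i _; congr (_ *~ _).
by rewrite /pushc asboolT //; exact: sin_coface.
Qed.

Lemma pushc_eq0 e : vanish (~` [set bary K k]) e -> vanish (B `\ b) (pushc e).
Proof.
move=> e0 m s sb; rewrite /pushc; case: asboolP => // sz.
apply: e0; have zr : B `&` ~` A `<=` range phi by move=> x [? ?]; exact: intphi.
split; first by have [] := sin_phinv emb_phi zr sz.
move=> _ [u _ <-] /= h; have [|_ su] := sb.2 (s u); first by exists u.
apply: su; rewrite /b -h phinvK //; apply: zr; apply: sz.2; by exists u.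
Qed.

(** Once a primitive on the space punctured at b is subtracted, c only sees simplices through b.
    Pulled back to the simplex it is a coboundary by [simplex_null], and the primitive is
    transported back. The remaining error vanishes on the open cell and off b, so [small2] removes
    it. *)
Lemma attach_null (c : cochain K M T) : simplex_null M k ->
  rcocycle B A c -> c k phi = 0 -> null B A c.
Proof.
move=> SK cc cphi0.
have [e1 e10 ce1] : null (B `\ b) A c.
  by apply: acyclic_attach; apply: rcocycle_sub cc => // x [].
pose c1 : cochain K M T := fun m s => c m s - dl e1 s.
have c1b : vanish (B `\ b) c1 by move=> m s sb; rewrite /c1 ce1 // subrr.
have c1B : vanish B (dl c1) by move=> m s sB; rewrite dlB dl_dl cc.2 // subrr.
have [e2 e20 ce2] : null setT (@bd K k) (fun m s => c1 m (phi \o s)).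
  apply: SK; first split=> m s ss.
  - apply: c1b; apply: sin_comp ss => // u du; apply: Ab; exact: phi_bd.
  - rewrite (dl_comp phi c1); apply: c1B.
    by apply: sin_comp ss => // u _; right; exists u.
  rewrite /c1 /= (_ : phi \o id = phi) // cphi0 sub0r -(dl_comp phi e1 id).
  rewrite (@dl_id_bd _ _ _ (@bd K k)) ?oppr0 // => m s ss.
  by apply: e10; apply: sin_comp ss => // u; exact: phi_bd.
(* As c1 vanishes off b, e2 is a relative cocycle of the punctured simplex, hence a coboundary
   there; subtracting it gives a primitive e3 that vanishes off the barycentre. *)
have [g g0 eg] : null (~` [set bary K k]) (@bd K k) e2.
  apply: acyclic_bd; split=> // m s ss; rewrite -ce2; last by case: ss.
  apply: c1b; apply: sin_comp ss => // u /= ub.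
  by split; [right; exists u|move=> /iphi].
pose e3 : cochain K M (Dl k) := fun m s => e2 m s - dl g s.
have e30 : vanish (~` [set bary K k]) e3 by move=> m s ss; rewrite /e3 eg // subrr.
have ce3 m (s : Dl m -> Dl k) : sin setT s -> c1 m (phi \o s) = dl e3 s.
  by move=> ss; rewrite ce2 // dlB dl_dl subr0.
pose c2 : cochain K M T := fun m s => c1 m s - dl (pushc e3) s.
have c2B : vanish B (dl c2) by move=> m s ss; rewrite dlB dl_dl c1B // subrr.
have c2A : vanish (B `&` ~` A) c2.
  move=> m s ss; rewrite /c2 dl_pushc // -ce3; last first.
    have zr : B `&` ~` A `<=` range phi by move=> x [? ?]; exact: intphi.
    by have [cs _] := sin_phinv emb_phi zr ss; split.
  rewrite (_ : phi \o _ = s) ?subrr //; apply/funext => u /=; rewrite phinvK //.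
  by have [|Bs nA] := ss.2 (s u); [exists u|exact: intphi].
have c2b : vanish (B `&` ~` [set b]) c2.
  move=> m s ss; rewrite /c2 c1b // sub0r; apply/eqP; rewrite oppr_eq0; apply/eqP.
  exact: dl_vanish (pushc_eq0 e30) _ _ ss.
have [h [_ h0 ch]] := small2 oA ob BUV c2B c2A c2b.
exists (fun m s => e1 m s + (pushc e3 s + h m s)) => m s ss.
  by rewrite e10 // (pushc_eq0 e30) ?h0 ?addr0 //; apply: sin_sub ss; exact: Ab.
rewrite (dlD e1) (dlD (pushc e3)) -(ch _ _ ss) /c2.
by rewrite [X in _ + X]addrC subrK /c1 addrC subrK.
Qed.

(** A cocycle of the simplex is made to vanish off the barycentre and transported. It fails to be a
    cocycle only on simplices that contain b and meet A, and [small2] corrects this. *)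
Lemma attach_cocycle (m0 : M) : simplex_cocycle M k ->
  exists2 c : cochain K M T, rcocycle B A c & c k phi = m0.
Proof.
move=> /(_ m0)[u [u0 uT] um].
have [e e0 ue] : null (~` [set bary K k]) (@bd K k) u.
  by apply: acyclic_bd; split=> // m s ss; apply: uT; apply: sin_sub ss.
pose u1 : cochain K M (Dl k) := fun m s => u m s - dl e s.
have u10 : vanish (~` [set bary K k]) u1.
  by move=> m s ss; rewrite /u1 ue // subrr.
have u1T : vanish setT (dl u1) by move=> m s ss; rewrite dlB dl_dl uT // subrr.
have u1m : u1 k id = m0 by rewrite /u1 um (dl_id_bd (A := @bd K k)) // subr0.
have zr : B `&` ~` A `<=` range phi by move=> x [? ?]; exact: intphi.
have uA : vanish (B `&` ~` A) (dl (pushc u1)).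
  move=> m s ss; rewrite dl_pushc // u1T //.
  by have [cs _] := sin_phinv emb_phi zr ss; split.
have ub : vanish (B `&` ~` [set b]) (dl (pushc u1)) := dl_vanish (pushc_eq0 u10).
have [h [hA hb gh]] := small2 oA ob BUV (fun m s _ => dl_dl _ _) uA ub.
exists (fun m s => pushc u1 s - h m s).
  split=> m s ss; last by rewrite dlB gh // subrr.
  have sb : sin (B `\ b) s by apply: sin_sub ss; exact: Ab.
  by rewrite (pushc_eq0 u10) // hb // subr0.
(* The effect of the correction on phi. This is a cocycle that vanishes on the interior and off the
   barycentre, so it has a primitive that vanishes on the boundary; the coboundary of such a
   primitive is 0 on the identity. *)
pose w : cochain K M (Dl k) := fun m s =>
  (pushc u1 (phi \o s) - h m (phi \o s)) - u1 m s.
have wT : vanish setT (dl w).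
  move=> m s ss.
  rewrite (dlB (fun m s => pushc u1 (phi \o s) - h m (phi \o s)) u1).
  rewrite (dlB (fun m s => pushc u1 (phi \o s)) (fun m s => h m (phi \o s))).
  rewrite (dl_comp phi (pushc u1)) (dl_comp phi h) u1T // subr0 gh ?subrr //.
  by apply: sin_comp ss => // v _; right; exists v.
have wA : vanish (setT `&` ~` (@bd K k)) w.
  move=> m s ss; have sz : sin (B `&` ~` A) (phi \o s).
    by apply: sin_comp ss => // v [_ vb]; split=> [|/phi_int //]; right; exists v.
  rewrite /w hA // subr0 /pushc asboolT //.
  rewrite (_ : phinv phi \o (phi \o s) = s) ?subrr //.
  by apply/funext => v /=; rewrite phiK.
have wb : vanish (setT `&` ~` [set bary K k]) w.
  move=> m s ss; have sz : sin (B `\ b) (phi \o s).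
    apply: sin_comp ss => // v [_ vb]; split; first by right; exists v.
    by move=> /iphi; exact: vb.
  rewrite /w hb // subr0 (pushc_eq0 u10) // sub0r u10 ?oppr0 //.
  by apply: sin_sub ss => v [].
have o1 : open (~` (@bd K k)) by rewrite openC; exact: bd_closed.
have o2 : open (~` [set bary K k]).
  rewrite openC; apply: compact_closed; first exact: simplex_hausdorff.
  exact: compact_set1.
have cov : setT `<=` (~` (@bd K k)) `|` (~` [set bary K k]).
  move=> v _; have [->|] := pselect (v = bary K k); [left|by right].
  exact: bary_nbd.
have [h' [_ h'0 wh]] := small2 o1 o2 cov wT wA wb.
have : w k id = 0.
  rewrite wh; last by split=> // x; exact: cvg_id.
  apply: (dl_id_bd (A := setT `&` ~` [set bary K k])) => // v vb.
  by split=> // vb'; apply: (@bary_nbd K k); rewrite -vb'.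
by move/eqP; rewrite /w subr_eq0 u1m => /eqP.
Qed.

End OneCellCohomology.
End Attach.

(** * Cohomology of a simplex modulo its boundary *)

Section SimplexCohomology.
Variables (K : realType) (M : zmodType).
Local Notation Dl := (stdsimplex K).

Lemma hausdorff_closed1 (T : topologicalType) (x : T) :
  hausdorff_space T -> closed [set x].
Proof. by move=> hT; apply: compact_closed => //; exact: compact_set1. Qed.

Lemma simplex0_eq m (s s' : Dl m -> Dl 0) : s = s'.
Proof.
apply/funext => u; apply: bc_inj => i; rewrite ord1.
by have := bc_sum (s u); have := bc_sum (s' u); rewrite !big_ord1 => -> ->.
Qed.

Lemma alt_sum (x : M) n : \sum_(i < n) x *~ (-1) ^+ i = if odd n then x else 0.
Proof.
elim: n => [|n IH]; first by rewrite big_ord0.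
rewrite big_ord_recr /= IH; case: (odd n) (signr_odd int n) => /= <-.
  by rewrite expr1 mulrNz mulr1z subrr.
by rewrite expr0 mulr1z add0r.
Qed.

Let c0 : forall m, Dl m -> Dl 0 := fun m _ => bary K 0.

Lemma dl_simplex0 (c : cochain K M (Dl 0)) m (s : Dl m -> Dl 0) :
  dl c s = if m is m'.+1 then if odd m then 0 else c m' (@c0 m') else 0.
Proof.
case: m s => [//|m] s /=.
under eq_bigr do rewrite (simplex0_eq (s \o _) (@c0 m)).
by rewrite alt_sum /= negbK if_neg.
Qed.

Lemma sin_c0 m : sin setT (@c0 m).
Proof. by split=> //; exact: cst_continuous. Qed.

(** A point has one simplex in each degree and [dl] is alternately 0 and the identity; so in odd
    degree m the primitive is c in degree m + 1. *)
Lemma simplex_null0 : simplex_null K M 0.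
Proof.
move=> c [_ cT] cid.
exists (fun m s => if odd m then c m.+1 (@c0 m.+1) else 0).
  move=> m s [_ sb]; have [i] := sb _ (imageT s (bary K m)).
  rewrite ord1 => /eqP; have := bc_sum (s (bary K m)); rewrite big_ord1 => ->.
  by rewrite oner_eq0.
move=> m s ss; rewrite dl_simplex0 (simplex0_eq s (@c0 m)).
case: m s ss => [|m] s ss; first by rewrite -[RHS]cid (simplex0_eq id (@c0 0)).
have := cT _ _ (sin_c0 m.+2); rewrite dl_simplex0 /=.
by case: (odd m).
Qed.

Lemma simplex_cocycle0 : simplex_cocycle K M 0.
Proof.
move=> m0; exists (fun m _ => if m is 0 then m0 else 0) => //; split.
  move=> m s [_ sb]; have [i] := sb _ (imageT s (bary K m)).
  rewrite ord1 => /eqP; have := bc_sum (s (bary K m)); rewrite big_ord1 => ->.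
  by rewrite oner_eq0.
by move=> m s _; rewrite dl_simplex0; case: m s => [//|[|m]] s //=; case: ifP.
Qed.

Section Step.
Variable k : nat.
Let horn : set (Dl k.+1) := facets (fun i => i != ord0).
Let phi := @coface K k ord0.

Let slide_ge0 (u : Dl k.+1) (t : K) : 0 <= t <= 1 ->
  forall i, 0 <= (1 - t) * bc u i + t * (i == ord0)%:R.
Proof.
by move=> /andP[t0 t1] i; rewrite addr_ge0 ?mulr_ge0 ?bc_ge0 ?ler0n ?subr_ge0.
Qed.

Let slide_sum (u : Dl k.+1) (t : K) :
  \sum_i ((1 - t) * bc u i + t * (i == ord0)%:R) = 1.
Proof.
rewrite big_split /= -!mulr_sumr bc_sum (bigD1 ord0) //= big1 => [|i /negPf->//].
by rewrite addr0 !mulr1 subrK.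
Qed.

Let slide (u : Dl k.+1) (t : K) : Dl k.+1 :=
  vx (\row_i ((1 - t) * bc u i + t * (i == ord0)%:R)).

Let bc_slide u t i : 0 <= t <= 1 ->
  bc (slide u t) i = (1 - t) * bc u i + t * (i == ord0)%:R.
Proof.
move=> t01; rewrite /slide; set r := \row_i _.
have -> : r = set_val (mksimplex (slide_ge0 u t01) (slide_sum u t)) by [].
by rewrite vxK bc_mk.
Qed.

Let hmt_slide (A : set (Dl k.+1)) :
  (forall u t, A u -> 0 <= t <= 1 -> A (slide u t)) -> simplexwise slide A A.
Proof.
move=> Aslide m p q [cp pA] cq q01; split; last first.
  by move=> _ [u _ <-]; apply: Aslide => //; apply: pA; exists u.
apply: continuous_bc => i.
rewrite (_ : (fun x => _) = fun u => (1 - q u) * bc (p u) i + q u * (i == ord0)%:R).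
  move=> u; have hq : q y @[y --> u] --> q u by exact: cq.
  have hb : bc (p y) i @[y --> u] --> bc (p u) i.
    by apply: (@continuous_comp _ _ _ p (fun v => bc v i)); [exact: cp|exact: bc_continuous].
  have h1 : (1 - q y) @[y --> u] --> 1 - q u by exact: (cvgB (@cvg_cst _ (1 : K) _ (nbhs u) _) hq).
  exact: (cvgD (cvgM h1 hb) (cvgM hq (cvg_cst _))).
by apply/funext => u; rewrite bc_slide.
Qed.

(** The vertex 0 belongs to every facet of the horn. Sliding towards it preserves the horn and ends
    in it. *)
Let acyclic_horn : acyclic K M setT horn.
Proof.
have t1 : (0 : K) <= (1 : K) <= (1 : K) by rewrite ler01 lexx.
have t0 : (0 : K) <= (0 : K) <= (1 : K) by rewrite lexx ler01.
apply: (acyclic_retract (h := slide)).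
- exact: hmt_slide.
- apply: hmt_slide => u t [i i0 ui] t01; exists i => //.
  by rewrite bc_slide // ui (negPf i0) !mulr0 addr0.
- by move=> u _; apply: bc_inj => i; rewrite bc_slide // subr0 mul1r mul0r addr0.
- move=> u _; exists ord_max => //.
  by rewrite bc_slide // subrr mul0r add0r mulr0.
Qed.

Let phi_bd u : bd u -> horn (phi u).
Proof.
move=> [i ui]; exists (lift ord0 i); first by rewrite eq_sym neq_lift.
by rewrite bc_coface liftK.
Qed.

Let phi_int u : horn (phi u) -> bd u.
Proof.
move=> [i i0]; rewrite bc_coface; case: unliftP i0 => [j -> _ uj|->].
  by exists j.
by rewrite eqxx.
Qed.

Let bd_horn : @bd K k.+1 = horn `|` range phi.
Proof.
rewrite eqEsubset; split=> [u [i ui]|u [[i _ ui]|[v _ <-]]].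
- have [i0|i0] := eqVneq i ord0; last by left; exists i.
  right; have v0 j : 0 <= bc u (lift ord0 j) by exact: bc_ge0.
  have v1 : \sum_j bc u (lift ord0 j) = 1.
    by have := bc_sum u; rewrite big_ord_recl -{1}i0 ui add0r.
  exists (mksimplex v0 v1) => //; apply: bc_inj => j; rewrite bc_coface.
  by case: unliftP => [j' ->|->]; rewrite ?bc_mk // -i0 ui.
- by exists i.
- by exists ord0; rewrite bc_coface unlift_none.
Qed.

Let closed_range : closed (range phi).
Proof.
apply: compact_closed; first exact: simplex_hausdorff.
apply: continuous_compact; last exact: simplex_compact.
by apply: continuous_subspaceT; exact: coface_continuous.
Qed.

Let closed1 (x : Dl k.+1) : closed [set x].
Proof. by apply: hausdorff_closed1; exact: simplex_hausdorff. Qed.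

Let dl_id (e : cochain K M (Dl k.+1)) : vanish horn e -> dl e id = e k phi.
Proof.
move=> e0 /=; rewrite (bigD1 ord0) //= mulr1z big1 ?addr0 // => i i0.
rewrite e0 ?mul0rz //; split; first exact: coface_continuous.
by move=> _ [u _ <-]; exists i => //; rewrite bc_coface unlift_none.
Qed.

(** The connecting map of the triple simplex, boundary, horn. A primitive e of c that vanishes on
    the horn is itself a relative cocycle of the boundary modulo the horn, and the boundary is the
    horn with the facet 0 attached. *)
Lemma simplex_nullS : simplex_null K M k -> simplex_null K M k.+1.
Proof.
move=> IH c cc cid; have hb : horn `<=` @bd K k.+1 by rewrite bd_horn; exact: subsetUl.
have [e e0 ce] := acyclic_horn (rcocycle_sub (@subset_refl _ setT) hb cc).
have [g g0 eg] : null (@bd K k.+1) horn e.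
  have := @attach_null K _ horn k phi M (@facets_closed K k.+1 _) closed1
    closed_range (@coface_embedding K k ord0) phi_bd phi_int e IH.
  rewrite -bd_horn; apply.
    split=> // m s sb; rewrite -ce; first exact: cc.1.
    by case: sb; split.
  by rewrite -cid ce ?dl_id //; split=> // x; exact: cvg_id.
exists (fun m s => e m s - dl g s) => m s ss; first by rewrite eg // subrr.
by rewrite dlB dl_dl subr0 ce.
Qed.

Lemma simplex_cocycleS : simplex_cocycle K M k -> simplex_cocycle K M k.+1.
Proof.
move=> IH m0.
have [c [ch cB] cm] := @attach_cocycle K _ horn k phi M (@facets_closed K k.+1 _) closed1
  (@coface_embedding K k ord0) phi_int m0 IH.
exists (dl c); last by rewrite dl_id.
by split; [rewrite bd_horn|move=> m s _; exact: dl_dl].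
Qed.

End Step.

Lemma simplex_nullP k : simplex_null K M k.
Proof. by elim: k => [|k IH]; [exact: simplex_null0|exact: simplex_nullS]. Qed.

Lemma simplex_cocycleP k : simplex_cocycle K M k.
Proof. by elim: k => [|k IH]; [exact: simplex_cocycle0|exact: simplex_cocycleS]. Qed.

End SimplexCohomology.

(** * Invariance of domain *)

Section BorsukUlam.
Variables (K : realType) (n : nat) (M : zmodType) (one : M).
Hypothesis M2 : forall x : M, x + x = 0.
Local Notation Dl := (stdsimplex K).
Local Notation W := 'rV[K]_n.+1.

Lemma char2_opp (x : M) : - x = x.
Proof. by apply/eqP; rewrite -subr_eq0 -opprD M2 oppr0. Qed.

Definition hpart (T : Type) q (c : cochain K M T) : cochain K M T := fun k s =>
  if k == q then c k s else 0.

Lemma dl_hpart (T : Type) q (c : cochain K M T) k (s : Dl k -> T) :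
  dl (hpart q c) s = hpart q.+1 (dl c) s.
Proof.
case: k s => [|k] s; first by rewrite /hpart.
rewrite /hpart eqSS /=; case: ifP => // _.
by rewrite big1 // => i _; rewrite mul0rz.
Qed.

Lemma dlS (T : Type) (c : cochain K M T) k (s : Dl k.+1 -> T) :
  dl c s = \sum_(i < k.+2) c k (s \o coface i) *~ (-1) ^+ i.
Proof. by []. Qed.

(** Coordinates beyond the last are 0, so that the degree of a simplex can serve as an index. *)
Definition crd (i : nat) (w : W) : K := if insub i is Some j then w 0 (j : 'I_n.+1) else 0.

Lemma crdN i w : crd i (- w) = - crd i w.
Proof. by rewrite /crd; case: insubP => [j _ _|_]; rewrite ?mxE // oppr0. Qed.

Definition lexpos (w : W) : Prop :=
  exists2 i, 0 < crd i w & forall j, (j < i)%N -> crd j w = 0.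

Lemma lexposN w : w <> 0 -> lexpos (- w) <-> ~ lexpos w.
Proof.
move=> w0; split=> [[i wi ij] [i' wi' ij']|nw].
  case: (ltngtP i i') => [/ij' wi0|/ij wi0|ii'].
  - by move: wi; rewrite crdN wi0 oppr0 ltxx.
  - by move: wi'; rewrite -[crd i' w]opprK -crdN wi0 oppr0 ltxx.
  - by move: wi; rewrite crdN ii' oppr_gt0 => /lt_trans /(_ wi'); rewrite ltxx.
have exi : exists i, crd i w != 0.
  apply: contrapT => /forallNP h; apply: w0; apply/rowP => i; rewrite mxE.
  have /negP := h (i : nat); rewrite negbK /crd valK => /eqP //.
case: (ex_minnP exi) => i wi imin.
have ij j : (j < i)%N -> crd j w = 0.
  by move=> ji; apply/eqP; apply: contraLR ji => /imin; rewrite -leqNgt.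
exists i => [|j /ij wj]; last by rewrite crdN wj oppr0.
rewrite crdN oppr_gt0 lt_neqAle wi leNgt; apply/negP => wi0.
by apply: nw; exists i.
Qed.

Definition cpos k (s : Dl k -> W) : Prop := forall u, 0 < crd k (s u).
Definition cneg k (s : Dl k -> W) : Prop := forall u, crd k (s u) < 0.

(** A choice of one simplex in each antipodal pair ([tposN]). In degree k the sign of coordinate k
    decides when it is constant, which makes [dl antip] vanish on simplices in a half-space; the
    lexicographic sign at the first vertex settles the other cases. *)
Definition tpos k (s : Dl k -> W) : Prop :=
  cpos s \/ (~ cneg s /\ lexpos (s (vertex K ord0))).

Definition neg (T : Type) (s : T -> W) : T -> W := fun u => - s u.

Lemma tposN k (s : Dl k -> W) : (forall u, s u <> 0) -> tpos (neg s) <-> ~ tpos s.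
Proof.
move=> s0; have L := lexposN (s0 (vertex K ord0)).
have PN : cpos s -> ~ cneg s.
  by move=> p q; have := p (bary K k); have := q (bary K k); lra.
have NP : cpos (neg s) <-> cneg s.
  by split=> h u; have := h u; rewrite /neg crdN oppr_gt0.
have NN : cneg (neg s) <-> cpos s.
  by split=> h u; have := h u; rewrite /neg crdN oppr_lt0.
rewrite /tpos; split; last first.
  move=> /not_orP[np /not_andP nn]; have [q|nq] := pselect (cneg s).
    by left; exact/NP.
  by right; split; [move=> /NN|apply/L; case: nn].
move=> [/NP q [/PN //|[]//]|[np /L l] [p|[_ //]]].
by apply: np; exact/NN.
Qed.

(* By construction the sum of antip over a simplex and its antipode is [one] in
   degree 0, and dl antip in higher degrees. *)
Fixpoint antipF k : (Dl k -> W) -> M :=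
  match k with
  | 0 => fun s => if `[< tpos s >] then one else 0
  | k'.+1 => fun s => if `[< tpos s >] then
      \sum_(i < k'.+2) antipF (s \o coface i) *~ (-1) ^+ i else 0
  end.

Definition antip : cochain K M W := antipF.

Lemma antip0 (s : Dl 0 -> W) : antip s = if `[< tpos s >] then one else 0.
Proof. by []. Qed.

Lemma antipS k (s : Dl k.+1 -> W) : antip s = if `[< tpos s >] then dl antip s else 0.
Proof. by []. Qed.

Lemma asbool_tposN k (s : Dl k -> W) : (forall u, s u <> 0) ->
  `[< tpos (neg s) >] = ~~ `[< tpos s >].
Proof.
by move=> s0; apply/asboolP/negP => [/tposN h /asboolP|h]; [exact: h|
  apply/tposN => // p; apply: h; exact/asboolP].
Qed.

Lemma antip_neg0 (s : Dl 0 -> W) : (forall u, s u <> 0) -> antip s + antip (neg s) = one.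
Proof.
by move=> s0; rewrite !antip0 asbool_tposN //; case: asboolP; rewrite ?addr0 ?add0r.
Qed.

(** By induction, the sum over s and its antipode is the coboundary of [dl antip], hence 0. In
    degree 1 it is the coboundary of the constant [one]. *)
Lemma dl_antip_neg k (s : Dl k -> W) : (forall u, s u <> 0) -> dl antip (neg s) = dl antip s.
Proof.
move=> s0; apply/eqP; rewrite -subr_eq0 char2_opp addrC; apply/eqP.
elim: k s s0 => [|k IH] s s0; first by rewrite addr0.
have -> : dl antip s + dl antip (neg s) =
    \sum_(i < k.+2) (antip (s \o coface i) + antip (neg (s \o coface i))) *~ (-1) ^+ i.
  by rewrite -big_split; apply: eq_bigr => i _; rewrite mulrzDl.
case: k IH s s0 => [|k] IH s s0.
  rewrite (eq_bigr (fun i : 'I_2 => one *~ (-1) ^+ i)) ?alt_sum // => i _.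
  by rewrite antip_neg0 // => u; exact: s0.
rewrite -[RHS](dl_dl antip s); apply: eq_bigr => i _; congr (_ *~ _).
have f0 u : (s \o coface i) u <> 0 by exact: s0.
have /eqP := IH _ f0; rewrite addr_eq0 char2_opp => /eqP E.
rewrite !antipS -E asbool_tposN //.
by case: asboolP; rewrite ?addr0 ?add0r.
Qed.

Lemma antip_neg k (s : Dl k.+1 -> W) : (forall u, s u <> 0) ->
  antip s + antip (neg s) = dl antip s.
Proof.
move=> s0; rewrite !antipS dl_antip_neg // asbool_tposN //.
by case: asboolP; rewrite ?addr0 ?add0r.
Qed.

Definition onesign j k (s : Dl k -> W) : Prop :=
  (forall u, 0 < crd j (s u)) \/ (forall u, crd j (s u) < 0).

Lemma onesign_coface j k (s : Dl k.+1 -> W) i : onesign j s -> onesign j (s \o coface i).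
Proof. by case=> h; [left|right] => u; exact: h. Qed.

(** If j is the dimension of the faces of s, then either all of them are [tpos], and [antip] agrees
    with [dl antip] (or with [one]) on them, or none is. Smaller j reduce to the faces by
    induction. *)
Lemma dl_tt_onesign j k (s : Dl k -> W) : (j < k)%N -> onesign j s -> dl antip s = 0.
Proof.
elim: k s => [//|k IH] s jk js; rewrite ltnS in jk.
have [jk'|kj] := ltnP j k.
  case: k s IH jk js jk' => [//|k] s IH jk js jk'; rewrite dlS big1 // => i _.
  by rewrite antipS (IH _ jk' (onesign_coface i js)) if_same mul0rz.
have {}kj : j = k by apply/anti_leq; rewrite jk.
rewrite {}kj in js *; case: js => js; last first.
  rewrite dlS big1 // => i _; have nt : ~ tpos (s \o coface i).
    move=> [p|[nn _]]; last by apply: nn => u; exact: js.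
    by have := p (bary K k); have := js (coface i (bary K k)); rewrite /=; lra.
  case: k s i {IH jk js} nt => [|k] s i nt.
    by rewrite antip0 asboolF // mul0rz.
  by rewrite antipS asboolF // mul0rz.
have pt i : tpos (s \o coface i) by left=> u; exact: js.
case: k s {IH jk js} pt => [|k] s pt; rewrite dlS.
  rewrite (eq_bigr (fun i : 'I_2 => one *~ (-1) ^+ i)) ?alt_sum // => i _.
  by rewrite antip0 asboolT.
rewrite -[RHS](dl_dl antip s); apply: eq_bigr => i _; congr (_ *~ _).
by rewrite antipS asboolT.
Qed.

Definition punct : set W := [set w | w <> 0].

Lemma crd_continuous i : continuous (crd i).
Proof.
rewrite /crd; case: insubP => [j _ _|_]; last exact: cst_continuous.
exact: coord_continuous.
Qed.

Definition octants : set (set W) :=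
  [set U | exists2 i, (i < n.+1)%N & U = [set w | 0 < crd i w] \/ U = [set w | crd i w < 0]].

Lemma octants_open U : octants U -> open U.
Proof.
move=> [i _ [->|->]].
  by apply: (@open_comp _ _ (crd i) [set x | 0 < x]) => [w _|]; [exact: crd_continuous|exact: open_gt].
by apply: (@open_comp _ _ (crd i) [set x | x < 0]) => [w _|]; [exact: crd_continuous|exact: open_lt].
Qed.

Lemma octants_cover w : punct w -> exists2 U, octants U & U w.
Proof.
move=> w0; have [i wi] : exists i : 'I_n.+1, w 0 i != 0.
  apply: contrapT => /forallNP h; apply: w0; apply/rowP => i; rewrite mxE.
  by have /negP := h i; rewrite negbK => /eqP.
have E : crd i w = w 0 i by rewrite /crd valK.
case: (ltrgt0P (w 0 i)) wi => // wi _.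
  by exists [set w | 0 < crd i w]; [exists (i : nat) => //; left|rewrite /= E].
by exists [set w | crd i w < 0]; [exists (i : nat) => //; right|rewrite /= E].
Qed.

(** In degree n + 1 the simplices inside a half-space have a coordinate of constant sign and index
    at most n, so [dl antip] vanishes on them. Its primitive h is even, and [antip] minus h is in
    degree n a cocycle of the punctured space. *)
Let g : cochain K M W := hpart n.+1 (dl antip).

Lemma g_dl k (s : Dl k -> W) : sin punct s -> dl g s = 0.
Proof. by move=> _; rewrite dl_hpart /hpart dl_dl if_same. Qed.

Lemma g_small k (s : Dl k -> W) : sin punct s -> small octants s -> g s = 0.
Proof.
move=> _ [U [i iN OU] sU]; rewrite /g /hpart; case: eqP => // kn.
apply: (@dl_tt_onesign i); first by rewrite kn.
case: OU => OU; [left|right] => u; have : U (s u) by apply: sU; exists u.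
  by rewrite OU.
by rewrite OU.
Qed.

Let h := hsub octants g.

Lemma h_neg k (s : Dl k -> W) : sin punct s -> h (neg s) = h s.
Proof.
move=> ss; apply: (hsub_sym octants_open octants_cover g_small _ ss).
move=> m p [cp p0]; split.
  split=> [u|_ [u _ <-] /= /eqP].
    by apply: (@continuous_comp _ _ _ p -%R); [exact: cp|exact: opp_continuous].
  by rewrite oppr_eq0 => /eqP; apply: p0; exists u.
rewrite /g /hpart; case: ifP => // _.
by apply: dl_antip_neg => u; apply: p0; exists u.
Qed.

Definition sphc : cochain K M W := fun k s => hpart n antip s - hpart n h s.

Lemma sphc_dl : vanish punct (dl sphc).
Proof.
move=> k s ss; rewrite dlB !dl_hpart /hpart.
case: eqP => [kn|_]; last by rewrite subrr.
rewrite (dl_hsub octants_open octants_cover g_dl g_small ss).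
by move/eqP: kn => kn; rewrite /g /hpart kn subrr.
Qed.

Definition vtx (i : nat) (e : K) : W := \row_j (if (j : nat) == i then e else 0).

(* Omega sums a function over the facets of the octahedral sphere. *)
Fixpoint Omega m (F : seq W -> M) : M :=
  if m is m'.+1 then
    Omega m' (fun l => F (vtx m' 1 :: l)) + Omega m' (fun l => F (vtx m' (-1) :: l))
  else F [::].

Lemma OmegaS m (F : seq W -> M) : Omega m.+1 F =
  Omega m (fun l => F (vtx m 1 :: l)) + Omega m (fun l => F (vtx m (-1) :: l)).
Proof. by []. Qed.

(** The lists over which [Omega] sums, one vertex from each antipodal pair. *)
Fixpoint slist m (l : seq W) : Prop :=
  if m is m'.+1 then
    if l is x :: l' then (x = vtx m' 1 \/ x = vtx m' (-1)) /\ slist m' l' else False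
  else l = [::].

Lemma Omega_eq m (F G : seq W -> M) : (forall l, slist m l -> F l = G l) ->
  Omega m F = Omega m G.
Proof.
elim: m F G => [|m IH] F G FG /=; first exact: FG.
by congr (_ + _); apply: IH => l ml; apply: FG; split=> //; [left|right].
Qed.

Lemma OmegaD m (F G : seq W -> M) :
  Omega m (fun l => F l + G l) = Omega m F + Omega m G.
Proof.
elim: m F G => [//|m IH] F G /=.
by rewrite (IH (fun l => F (_ :: l))) (IH (fun l => F (vtx m (-1) :: l))) addrACA.
Qed.

Lemma OmegaB m (F G : seq W -> M) :
  Omega m (fun l => F l - G l) = Omega m F - Omega m G.
Proof.
rewrite -[X in _ - X]char2_opp opprK -OmegaD; apply: Omega_eq => l _.
by rewrite char2_opp.
Qed.

(** Each face of codimension 1 of the octahedral sphere lies in two facets, and 2 is 0 in M. *)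
Lemma Omega_dlo m (F : seq W -> M) : Omega m (dlo F) = 0.
Proof.
elim: m F => [//|m IH] F /=.
rewrite (OmegaB m F (dlo (fun t => F (vtx m 1 :: t)))).
rewrite (OmegaB m F (dlo (fun t => F (vtx m (-1) :: t)))) !IH !subr0.
exact: M2.
Qed.

Lemma vtxN i e : - vtx i e = vtx i (- e).
Proof. by apply/rowP => j; rewrite !mxE; case: ifP; rewrite ?oppr0. Qed.

Lemma Omega_sym m (F : seq W -> M) :
  Omega m (fun l => F (map -%R l)) = Omega m F.
Proof.
elim: m F => [//|m IH] F /=; rewrite addrC.
rewrite (IH (fun l => F (- vtx m (-1) :: l))) (IH (fun l => F (- vtx m 1 :: l))).
by rewrite !vtxN opprK.
Qed.

Lemma Omega_even m (F : seq W -> M) : (forall l, slist m.+1 l -> F (map -%R l) = F l) ->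
  Omega m.+1 F = 0.
Proof.
move=> FN /=; rewrite -(Omega_sym m (fun l => F (vtx m (-1) :: l))).
rewrite (@Omega_eq m _ (fun l => F (vtx m 1 :: l))) ?M2 //.
by move=> l ml; rewrite -[in RHS]FN /= ?vtxN //; split=> //; left.
Qed.

Lemma slist_size m l : slist m l -> size l = m.
Proof. by elim: m l => [|m IH] [|x l] //= [_ /IH ->]. Qed.

Lemma slist_nth m l i : slist m l -> (i < m)%N ->
  l`_i = vtx (m.-1 - i) 1 \/ l`_i = vtx (m.-1 - i) (-1).
Proof.
elim: m l i => [//|m IH] [//|x l] [|i] [xm ml] im /=; first by rewrite subn0.
have -> : (m - i.+1 = m.-1 - i)%N by lia.
exact: IH.
Qed.

Definition Sph : set W := [set w | \sum_i `|w 0 i| = 1].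

Lemma slist_Sph m l (u : Dl m) : (m < n.+1)%N -> slist m.+1 l -> Sph (aff l u).
Proof.
move=> mn ml; rewrite /Sph /= -(bc_sum u).
have E (j : 'I_n.+1) : `|(aff l u) 0 j| =
    \sum_(i < m.+1) (if (j : nat) == (m - i)%N then bc u i else 0).
  rewrite /aff summxE; have [jm|mj] := leqP j m; last first.
    rewrite !big1 ?normr0 // => i _; rewrite ?mxE.
      by case: eqP => // jmi; move: mj; rewrite jmi; lia.
    have : j != (m - i)%N :> nat by apply/eqP => jmi; move: mj; rewrite jmi; lia.
    by move/negPf => h'; case: (slist_nth ml (ltn_ord i)) => ->; rewrite mxE h' mulr0.
  have mjm : (m - j < m.+1)%N by lia.
  have h' (i : 'I_m.+1) : i != Ordinal mjm -> ((j : nat) == (m - i)%N) = false.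
    move=> ij; apply/eqP => jmi; case/eqP: ij; apply: val_inj => /=.
    by have := ltn_ord i; lia.
  rewrite (bigD1 (Ordinal mjm)) //= big1 ?addr0 => [|i ij]; last first.
    by rewrite mxE; case: (slist_nth ml (ltn_ord i)) => ->; rewrite mxE h' ?mulr0.
  rewrite [RHS](bigD1 (Ordinal mjm)) //= [X in _ = _ + X]big1 ?addr0 => [|i ij]; last first.
    by rewrite h'.
  rewrite subKn // eqxx mxE normrM (ger0_norm (bc_ge0 _ _)).
  case: (slist_nth ml mjm) => /= ->; rewrite mxE subKn // eqxx ?normrN normr1 mulr1 //.
under eq_bigr do rewrite E.
rewrite exchange_big /=; apply: eq_bigr => i _.
have im : (m - i < n.+1)%N by lia.
rewrite (bigD1 (Ordinal im)) //= eqxx big1 ?addr0 // => j ji.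
by case: eqP => // jmi; case/eqP: ji; apply: val_inj.
Qed.

Section Odd.
Variable f : W -> W.
Hypothesis f_odd : forall x, Sph x -> f (- x) = - f x.
Hypothesis f_neq0 : forall x, Sph x -> f x <> 0.
Hypothesis f_cont : forall m (p : Dl m -> W), sin Sph p -> continuous (f \o p).

Lemma ocl_odd (c : cochain K M W) m l : (m < n.+1)%N -> slist m.+1 l ->
  ocl f c (map -%R l) = c m (neg (f \o (fun u => aff l u))) /\
  ocl f c l = c m (f \o (fun u => aff l u)).
Proof.
move=> mn ml; rewrite /ocl size_map (slist_size ml); split=> //.
congr (c m _); apply/funext => u; rewrite /neg /= -f_odd; last exact: slist_Sph.
rewrite (aff_map -%R) ?(slist_size ml) //.
Qed.

(** The antipode folds the facets onto the upper half. There [antip] plus its antipodal value is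
    [dl antip], so the sum becomes that of [antip] over the equator. *)
Lemma Omega_tt m : (m < n.+1)%N -> Omega m.+1 (ocl f antip) = one.
Proof.
elim: m => [|m IH] mn.
  have l0 : slist 1 [:: vtx 0 1] by split=> //; left.
  have [N0 P0] := ocl_odd antip mn l0.
  rewrite /= P0 -[vtx 0 (-1)]opprK vtxN opprK -[X in ocl f antip X]/(map -%R [:: vtx 0 1]) N0.
  by apply: antip_neg0 => u; apply: f_neq0; exact: slist_Sph.
have -> : Omega m.+2 (ocl f antip) = Omega m.+1 (fun l => dlo (ocl f antip) (vtx m.+1 1 :: l)).
  rewrite [LHS]OmegaS -(Omega_sym m.+1 (fun l => ocl f antip (vtx m.+1 (-1) :: l))).
  rewrite -OmegaD; apply: Omega_eq => l ml.
  have ml2 : slist m.+2 (vtx m.+1 1 :: l) by split=> //; left.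
  have [N0 P0] := ocl_odd antip mn ml2.
  rewrite ocl_dl; have [_ ->] := ocl_odd (dl antip) mn ml2.
  rewrite P0 -vtxN -[_ :: map _ _]/(map -%R (vtx m.+1 1 :: l)) N0.
  by apply: antip_neg => u; apply: f_neq0; exact: slist_Sph.
rewrite (OmegaB m.+1 (ocl f antip) (dlo (fun t => ocl f antip (vtx m.+1 1 :: t)))).
by rewrite Omega_dlo subr0 IH // ltnW.
Qed.

Lemma Omega_sphc : Omega n.+1 (ocl f sphc) = one.
Proof.
rewrite (@Omega_eq _ _ (fun l => ocl f antip l - ocl f h l)); last first.
  by move=> l nl; rewrite /ocl (slist_size nl) /sphc /hpart eqxx.
rewrite OmegaB Omega_tt // [X in _ - X]Omega_even ?subr0 // => l nl.
have [-> ->] := ocl_odd h (ltnSn n) nl; apply: h_neg; split.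
  apply: f_cont; split; first exact: aff_continuous.
  by move=> _ [u _ <-]; exact: slist_Sph.
by move=> _ [u _ <-]; apply: f_neq0; exact: slist_Sph.
Qed.

End Odd.

Lemma Omega_htp (H : W -> K -> W) : simplexwise H Sph punct ->
  Omega n.+1 (ocl (H^~ 0) sphc) = Omega n.+1 (ocl (H^~ 1) sphc).
Proof.
move=> hH; apply/eqP; rewrite -subr_eq0 -OmegaB; apply/eqP.
rewrite -(Omega_dlo n.+1 (ocl id (hprism H sphc))); apply: Omega_eq => l nl.
rewrite ocl_dl /ocl (slist_size nl) (dl_hprism hH sphc_dl) //.
split; first exact: aff_continuous.
by move=> _ [u _ <-]; exact: slist_Sph.
Qed.

Lemma Omega_cst (y : W) : Omega n.+1 (ocl (fun=> y) sphc) = 0.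
Proof.
by apply: Omega_even => l nl; rewrite /ocl size_map (slist_size nl).
Qed.

End BorsukUlam.

Section RV.
Variables (K : realType) (n : nat) (X : topologicalType).
Implicit Types (f g : X -> 'rV[K]_n) (q : X -> K).
Lemma rv_contD f g : continuous f -> continuous g -> continuous (fun x => f x + g x).
Proof. by move=> cf cg x; apply: (@cvgD K 'rV[K]_n X (nbhs x) _ f g); [exact: cf|exact: cg]. Qed.
Lemma rv_contN f : continuous f -> continuous (fun x => - f x).
Proof. by move=> cf x; apply: (@cvgN K 'rV[K]_n X (nbhs x) _ f); exact: cf. Qed.
Lemma rv_contB f g : continuous f -> continuous g -> continuous (fun x => f x - g x).
Proof. by move=> cf cg; apply: rv_contD => //; exact: rv_contN. Qed.
Lemma rv_contZ q f : continuous q -> continuous f -> continuous (fun x => q x *: f x).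
Proof. by move=> cq cf x; apply: (@cvgZ K 'rV[K]_n X (nbhs x) _ q f); [exact: cq|exact: cf]. Qed.
Lemma rv_cont1B q : continuous q -> continuous (fun x => 1 - q x).
Proof. by move=> cq x; exact: (cvgB (@cvg_cst _ (1 : K) _ (nbhs x) _) (cq x)). Qed.
End RV.

Section InvarianceOfDomain.
Variable K : realType.
Local Notation Dl := (stdsimplex K).

Lemma F2_addrr (x : 'F_2) : x + x = 0.
Proof. by rewrite -mulr2n (@mulrn_pchar _ 2%N) // char_Fp. Qed.

Lemma norm_le m (x : 'rV[K]_m) e : 0 <= e -> (forall i, `|x 0 i| <= e) -> `|x| <= e.
Proof.
move=> e0 xe; rewrite -[`|x|]/(mx_norm x) mx_normrE; apply/bigmax_leP.
by split=> // -[i j] _ /=; rewrite ord1.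
Qed.

Lemma Sph_norm n (w : 'rV[K]_n.+1) : Sph w -> `|w| <= 1.
Proof.
move=> w1; apply: norm_le => // i; rewrite -[leRHS]w1 (bigD1 i) //=.
by rewrite lerDl sumr_ge0.
Qed.

Lemma Sph_neq0 n (w : 'rV[K]_n.+1) : Sph w -> w <> 0.
Proof.
rewrite /Sph /= => + w0; rewrite w0 big1 => [/eqP|i _]; last by rewrite mxE normr0.
by rewrite eq_sym oner_eq0.
Qed.

Lemma Sph_compact n : compact (@Sph K n).
Proof.
apply: bounded_closed_compact.
  exists 1; split; first exact: num_real.
  by move=> r r1 u /Sph_norm u1 /=; exact: le_trans u1 (ltW r1).
apply: (@preimage_closed _ _ (fun w : 'rV[K]_n.+1 => \sum_i `|w 0 i|) [set 1]) => [w _|].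
  apply: continuous_big => [|i _ x]; first exact: add_continuous.
  apply: (@continuous_comp _ _ _ (fun w : 'rV[K]_n.+1 => w 0 i) (fun z : K => `|z|)).
    exact: coord_continuous.
  exact: norm_continuous.
exact: closed_eq.
Qed.

Lemma hmt_continuous n (H : 'rV[K]_n.+1 -> K -> 'rV[K]_n.+1) :
  (forall (X : topologicalType) (p : X -> 'rV[K]_n.+1) (q : X -> K),
     continuous p -> continuous q -> continuous (fun x => H (p x) (q x))) ->
  (forall w (t : K), Sph w -> 0 <= t <= 1 -> H w t <> 0) ->
  simplexwise H (@Sph K n) (@punct K n).
Proof.
move=> cH H0 m p q [cp pS] cq q01; split; first exact: cH.
by move=> _ [u _ <-]; apply: H0 => //; apply: pS; exists u.
Qed.

(** Were c missed, the odd map [g w - g (- w)] would deform to [g w - g 0], then to [g w - c], then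
    to a constant, avoiding 0 throughout. But the sum of [sphc] over the octahedral sphere is 1 for
    an odd map and 0 for a constant one. The second deformation avoids 0 because e is the distance
    from g 0 to the image of the sphere. *)
Lemma invariance_of_domainS n (g : 'rV[K]_n.+1 -> 'rV[K]_n.+1) :
  continuous g -> (forall x y, `|x| <= 1 -> `|y| <= 1 -> g x = g y -> x = y) ->
  exists2 e : K, 0 < e & forall c, `|c - g 0| < e -> exists2 x, `|x| <= 1 & g x = c.
Proof.
move=> cg ig.
have cgc (X : topologicalType) (p : X -> 'rV[K]_n.+1) : continuous p -> continuous (g \o p).
  by move=> cp x; apply: continuous_comp; [exact: cp|exact: cg].
have S0 : @Sph K n !=set0.
  exists (delta_mx 0 ord0); rewrite /Sph /= (bigD1 ord0) //= big1 => [|i i0].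
    by rewrite mxE !eqxx normr1 addr0.
  by rewrite mxE (negPf i0) normr0.
have [|w0 /set_mem w0S w0min] := compact_EVT_min (f := fun w => `|g w - g 0|) S0
    (@Sph_compact n).
  apply: continuous_subspaceT => w.
  exact: (cvg_norm (cvgB (cg w) (@cvg_cst _ (g 0) _ (nbhs w) _))).
exists `|g w0 - g 0|.
  rewrite normr_gt0 subr_eq0; apply/eqP => /ig h; apply: (Sph_neq0 w0S).
  by apply: h; rewrite ?normr0 ?Sph_norm.
move=> c cg0; apply: contrapT => /forall2NP nc.
pose s := @sphc K n 'F_2 1.
have gS (w : 'rV[K]_n.+1) : Sph w -> g w <> g 0.
  by move=> wS /ig h; apply: (Sph_neq0 wS); apply: h; rewrite ?normr0 ?Sph_norm.
have tn (w : 'rV[K]_n.+1) (t : K) : Sph w -> 0 <= t <= 1 -> `|(1 - t) *: w| <= 1.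
  move=> wS; have w1 := Sph_norm wS; move=> /andP[t0 t1]; rewrite normrZ ger0_norm ?subr_ge0 //.
  by apply: mulr_ile1 => //; [rewrite subr_ge0|rewrite gerBl].
pose H1 (w : 'rV[K]_n.+1) (t : K) := g w - g (- ((1 - t) *: w)).
pose H2 (w : 'rV[K]_n.+1) (t : K) := g w - ((1 - t) *: g 0 + t *: c).
pose H3 (w : 'rV[K]_n.+1) (t : K) := g ((1 - t) *: w) - c.
have cs (X : topologicalType) (p : X -> 'rV[K]_n.+1) (q : X -> K) :
    continuous p -> continuous q -> continuous (fun x => (1 - q x) *: p x).
  by move=> cp cq; apply: rv_contZ => //; exact: rv_cont1B.
have cc (X : topologicalType) (y : 'rV[K]_n.+1) : continuous (fun _ : X => y).
  exact: cst_continuous.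
have h1 : simplexwise H1 (@Sph K n) (@punct K n).
  apply: hmt_continuous => [X p q cp cq|w t wS t01].
    apply: rv_contB; first exact: cgc.
    by apply: (cgc _ (fun x => - ((1 - q x) *: p x))); apply: rv_contN; exact: cs.
  rewrite /H1 => /eqP; rewrite subr_eq0 => /eqP /ig h.
  have := h (Sph_norm wS); rewrite normrN => /(_ (tn _ _ wS t01)) /eqP.
  rewrite -subr_eq0 opprK -{1}[w]scale1r -scalerDl scaler_eq0 => /orP[/eqP|/eqP].
    by move: t01; lra.
  exact: Sph_neq0.
have h2 : simplexwise H2 (@Sph K n) (@punct K n).
  apply: hmt_continuous => [X p q cp cq|w t wS /andP[t0 t1]].
    apply: rv_contB; first exact: cgc.
    by apply: rv_contD; [exact: cs|exact: rv_contZ].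
  move=> /eqP; rewrite /H2 subr_eq0 => /eqP E.
  have := w0min w (mem_set wS); rewrite E.
  have -> : (1 - t) *: g 0 + t *: c - g 0 = t *: (c - g 0).
    by rewrite scalerBl scale1r scalerBr addrAC [g 0 - _]addrC addrK addrC.
  rewrite normrZ ger0_norm // => h; have : t * `|c - g 0| <= `|c - g 0| by rewrite ler_piMl.
  by move: cg0; lra.
have h3 : simplexwise H3 (@Sph K n) (@punct K n).
  apply: hmt_continuous => [X p q cp cq|w t wS t01].
    by apply: rv_contB => //; apply: (cgc _ (fun x => (1 - q x) *: p x)); exact: cs.
  rewrite /H3 => /eqP; rewrite subr_eq0 => /eqP gc.
  by have [] := nc ((1 - t) *: w); [case|apply]; rewrite ?gc ?tn.
have := Omega_htp 1 F2_addrr h1; have := Omega_htp 1 F2_addrr h2.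
have := Omega_htp 1 F2_addrr h3.
rewrite (_ : H3^~ 1 = fun=> g 0 - c); last first.
  by apply/funext => w; rewrite /H3 subrr scale0r.
rewrite (Omega_cst 1 F2_addrr).
rewrite (_ : H3^~ 0 = H2^~ 1); last first.
  by apply/funext => w; rewrite /H3 /H2 subr0 subrr scale0r add0r !scale1r.
move=> ->; rewrite (_ : H2^~ 0 = H1^~ 1); last first.
  by apply/funext => w; rewrite /H1 /H2 subr0 subrr !scale0r addr0 oppr0 scale1r.
move=> -> E; have := Omega_sphc (f := H1^~ 0) 1 F2_addrr.
rewrite E => h; suff : (0 : 'F_2) = 1 by [].
apply: h => [x xS|x xS|m p [cp pS]].
- by rewrite /H1 !subr0 !scale1r opprK opprB.
- rewrite /H1 subr0 scale1r => /eqP; rewrite subr_eq0 => /eqP /ig h.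
  have := h (Sph_norm xS); rewrite normrN => /(_ (Sph_norm xS)) /eqP.
  rewrite -subr_eq0 opprK -mulr2n -scaler_nat scaler_eq0 pnatr_eq0 /= => /eqP.
  exact: Sph_neq0.
- apply: rv_contB; first exact: cgc.
  apply: (cgc _ (fun x => - ((1 - 0) *: p x))); apply: rv_contN; apply: rv_contZ => //.
  exact: cst_continuous.
Qed.

Lemma invariance_of_domain n (g : 'rV[K]_n -> 'rV[K]_n) :
  continuous g -> (forall x y, `|x| <= 1 -> `|y| <= 1 -> g x = g y -> x = y) ->
  exists2 e : K, 0 < e & forall c, `|c - g 0| < e -> exists2 x, `|x| <= 1 & g x = c.
Proof.
case: n g => [|n] g; last exact: invariance_of_domainS.
move=> _ _; exists 1 => // c _; exists 0; first by rewrite normr0.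
by apply/rowP; case.
Qed.

End InvarianceOfDomain.

(** * Charts on the boundary of a simplex *)

Section BoundaryChart.
Variables (K : realType) (d : nat).
Local Notation Dl := (stdsimplex K).
Variables (v : Dl d.+1) (j : 'I_d.+2).
Hypothesis vj : bc v j = 0.

Let b : K := d.+2%:R^-1.

(* The disk v + L y, transverse at v to the line through the barycentre, is
   projected to the boundary from the barycentre. *)
Definition chL (y : 'rV[K]_d) (i : 'I_d.+2) : K :=
  if unlift j i is Some i' then
    if unlift ord_max i' is Some i'' then y 0 i'' else - \sum_m y 0 m
  else 0.
Definition chw y i : K := bc v i + chL y i.
Definition chG y : K := \big[Order.max/0]_i (1 - d.+2%:R * chw y i).
Definition chr y i : K := b + (chw y i - b) / chG y.
Definition chart (y : 'rV[K]_d) : Dl d.+1 := vx (\row_i chr y i).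

Lemma chL_sum y : \sum_i chL y i = 0.
Proof.
rewrite (bigD1_ord j) //= {1}/chL unlift_none add0r.
rewrite (bigD1_ord ord_max) //= {1}/chL liftK unlift_none.
rewrite [X in _ + X](eq_bigr (fun m => y 0 m)) ?addNr // => m _.
by rewrite /chL !liftK.
Qed.

Lemma chw_sum y : \sum_i chw y i = 1.
Proof. by rewrite big_split /= bc_sum chL_sum addr0. Qed.

Lemma chw_j y : chw y j = 0.
Proof. by rewrite /chw /chL unlift_none addr0. Qed.

Lemma chG_ge y i : 1 - d.+2%:R * chw y i <= chG y.
Proof. exact: le_bigmax. Qed.

Lemma chG_ge1 y : 1 <= chG y.
Proof. by have := chG_ge y j; rewrite chw_j mulr0 subr0. Qed.

Lemma chG_gt0 y : 0 < chG y.
Proof. exact: lt_le_trans ltr01 (chG_ge1 y). Qed.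

Let b0 : 0 < b. Proof. by rewrite invr_gt0 ltr0n. Qed.
Let bE : d.+2%:R * b = 1. Proof. by rewrite mulfV // pnatr_eq0. Qed.

Lemma chr_ge0 y i : 0 <= chr y i.
Proof.
have g0 := chG_gt0 y; have := chG_ge y i.
rewrite -(ler_pM2l b0) mulrBr mulr1 mulrA [b * _]mulrC bE mul1r => h.
rewrite /chr -[b in X in X + _](mulfK (lt0r_neq0 g0)) -mulrDl.
by rewrite divr_ge0 ?(ltW g0) //; lra.
Qed.

Lemma chr_sum y : \sum_i chr y i = 1.
Proof.
rewrite big_split /= -mulr_suml sumrB chw_sum sumr_const card_ord.
by rewrite -[b *+ _]mulr_natl bE subrr mul0r addr0.
Qed.

Lemma bc_chart y i : bc (chart y) i = chr y i.
Proof.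
rewrite /bc /chart val_vx ?mxE //; split=> [m|]; first by rewrite mxE chr_ge0.
by under eq_bigr do rewrite mxE; exact: chr_sum.
Qed.

Lemma chart_bd y : bd (chart y).
Proof.
have [i gi] : exists i, chG y = 1 - d.+2%:R * chw y i.
  have := chG_gt0 y; rewrite /chG.
  elim/big_rec: _ => [|i x _ IH]; first by rewrite ltxx.
  by rewrite /Order.max; case: ifP => // _ _; exists i.
exists i; rewrite bc_chart /chr.
have -> : chw y i - b = - (b * chG y).
  by rewrite gi mulrBr mulr1 mulrA [b * _]mulrC bE mul1r opprB.
by rewrite mulNr mulfK ?gt_eqF ?chG_gt0 // subrr.
Qed.

(** Before the projection coordinate j is 0; after it, this coordinate therefore determines the
    gauge [chG], and the gauge gives back the other coordinates. *)
Lemma chart_inj : injective chart.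
Proof.
move=> y y' E; have Ei i : chr y i = chr y' i by rewrite -!bc_chart E.
have G : chG y = chG y'.
  have := Ei j; rewrite /chr !chw_j => /addrI /(mulfI _) h.
  by apply: invr_inj; apply: h; rewrite sub0r oppr_eq0 gt_eqF.
have W i : chL y i = chL y' i.
  have := Ei i; rewrite /chr G => /addrI /mulIf h.
  by have /addIr /addrI : chw y i - b = chw y' i - b by apply: h; rewrite invr_eq0 gt_eqF ?chG_gt0.
apply/rowP => m; have := W (lift j (lift ord_max m)).
by rewrite /chL !liftK.
Qed.

Lemma chart0 : chart 0 = v.
Proof.
have L0 i : chw 0 i = bc v i.
  rewrite /chw /chL; case: unlift => [i'|]; last by rewrite addr0.
  case: unlift => [i''|]; first by rewrite mxE addr0.
  by rewrite big1 ?oppr0 ?addr0 // => m _; rewrite mxE.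
have G1 : chG 0 = 1.
  apply/le_anti; rewrite chG_ge1 andbT; apply: bigmax_le => // i _.
  by rewrite L0 gerBl mulr_ge0 ?ler0n ?bc_ge0.
by apply: bc_inj => i; rewrite bc_chart /chr G1 L0 divr1 addrC subrK.
Qed.

Lemma chart_continuous : continuous chart.
Proof.
have cL i : continuous (fun y => chL y i).
  rewrite /chL; case: unlift => [i'|]; last exact: cst_continuous.
  case: unlift => [i''|]; first exact: coord_continuous.
  move=> y; apply: (@cvgN K K^o _ (nbhs y) _ (fun y : 'rV[K]_d => \sum_m y 0 m)).
  apply: (@continuous_big K 'I_d +%R 0 xpredT) => [|m _]; first exact: add_continuous.
  exact: coord_continuous.
have cw i : continuous (fun y => chw y i).
  move=> y; apply: (@cvgD K K^o _ (nbhs y) _ (fun=> bc v i)); first exact: cvg_cst.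
  exact: cL.
have cG : continuous chG.
  apply: continuous_big => [|i _ y]; first exact: max_continuous.
  apply: (@cvgB K K^o _ (nbhs y) _ (fun=> 1)); first exact: cvg_cst.
  by apply: (@cvgM K _ (nbhs y) _ (fun=> d.+2%:R)); [exact: cvg_cst|exact: cw].
apply: continuous_bc => i.
rewrite (_ : (fun y => _) = (fun y => chr y i)); last first.
  by apply/funext => y; rewrite bc_chart.
move=> y; apply: (@cvgD K K^o _ (nbhs y) _ (fun=> b)); first exact: cvg_cst.
apply: (@cvgM K _ (nbhs y) _ (fun y => chw y i - b)).
  by apply: (@cvgB K K^o _ (nbhs y) _ (fun y => chw y i)); [exact: cw|exact: cvg_cst].
by apply: (@cvgV K _ (nbhs y) _ chG); [rewrite gt_eqF // chG_gt0|exact: cG].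
Qed.

End BoundaryChart.

(** * Invariance of domain for two overlapping cells *)

Section LocalDomain.
Variable K : realType.
Local Notation Dl := (stdsimplex K).

(** Radial retraction to the unit ball: it turns a map defined on the ball into one defined
    everywhere, as [invariance_of_domain] requires. *)
Definition clamp n (x : 'rV[K]_n) : 'rV[K]_n := (Order.max 1 `|x|)^-1 *: x.

Lemma clamp_id n (x : 'rV[K]_n) : `|x| <= 1 -> clamp x = x.
Proof. by move=> x1; rewrite /clamp max_l // invr1 scale1r. Qed.

Lemma clamp_norm n (x : 'rV[K]_n) : `|clamp x| <= 1.
Proof.
have m0 : 0 < Order.max 1 `|x| by rewrite lt_max ltr01.
rewrite normrZ ger0_norm ?invr_ge0 ?(ltW m0) // ler_pdivrMl // mulr1.
by rewrite le_max lexx orbT.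
Qed.

Lemma clamp_continuous n : continuous (@clamp n).
Proof.
apply: rv_contZ => [x|x]; last exact: cvg_id.
apply: (@cvgV K _ (nbhs x) _ (fun x : 'rV[K]_n => Order.max 1 `|x|)).
  by rewrite gt_eqF // lt_max ltr01.
by apply: max_fun_continuous; [exact: cst_continuous|exact: norm_continuous].
Qed.

(** Barycentric coordinates without the redundant first one, padded with zeros: a chart of the
    k-simplex in R^d when k <= d. *)
Definition padv k d (u : Dl k) : 'rV[K]_d :=
  \row_i (if insub (i : nat) is Some i' then bc u (lift ord0 (i' : 'I_k)) else 0).

Lemma padv_inj k d : (k <= d)%N -> injective (@padv k d).
Proof.
move=> kd u w E; have h (i : 'I_k) : bc u (lift ord0 i) = bc w (lift ord0 i).
  by have /rowP/(_ (widen_ord kd i)) := E; rewrite !mxE /= valK.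
apply: bc_inj => i; case: (unliftP ord0 i) => [i' ->|->]; first exact: h.
have := bc_sum w; rewrite -(bc_sum u) !(big_ord_recl k) /=.
rewrite (eq_bigr (fun i => bc u (lift ord0 i))) => [|m _]; last by rewrite h.
by move/addIr.
Qed.

Lemma rv_continuous (X : topologicalType) n (f : X -> 'rV[K]_n) :
  (forall i, continuous (fun x => f x 0 i)) -> continuous f.
Proof.
move=> cf; rewrite (_ : f = fun x => \sum_(i < n) f x 0 i *: delta_mx 0 i).
  apply: continuous_big => [|i _]; first exact: add_continuous.
  by apply: rv_contZ => //; exact: cst_continuous.
by apply/funext => x; exact: row_sum_delta.
Qed.

Lemma padv_continuous k d : continuous (@padv k d).
Proof.
apply: rv_continuous => i.
rewrite (_ : (fun u => _) = (fun u : Dl k =>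
  if insub (i : nat) is Some i' then bc u (lift ord0 (i' : 'I_k)) else 0)).
  case: insub => [i'|]; [exact: bc_continuous|exact: cst_continuous].
by apply/funext => u; rewrite mxE.
Qed.

Section Local.
Variables (T : topologicalType) (d k : nat) (phi : Dl d.+1 -> T) (psi : Dl k -> T).
Hypothesis cphi : continuous phi.
Hypothesis iphi : injective phi.
Hypothesis epsi : embedding psi.
Variables (v : Dl d.+1) (O : set (Dl d.+1)).
Hypothesis vbd : bd v.
Hypothesis oO : open O.
Hypothesis Ov : O v.
Hypothesis Opsi : forall w, O w -> bd w -> range psi (phi w).

(** The boundary near v, parametrized by [chart] and read in psi, gives an injective map from a
    d-ball to R^d, whose image contains a ball. For k < d this is absurd, since coordinate k of the
    image is 0; for k = d it gives the open set. *)
Lemma local_domain : (k <= d)%N -> k = d /\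
  exists O' : set (Dl k), [/\ open O', O' (phinv psi (phi v)) &
    forall w, O' w -> exists2 w', bd w' & psi w = phi w'].
Proof.
move=> kd; have [j vj] := vbd.
have [e e0 eO] : exists2 e : K, 0 < e & forall y, `|y| <= e -> O (chart v j y).
  have : nbhs (0 : 'rV[K]_d) (chart v j @^-1` O).
    apply: chart_continuous => //; rewrite chart0 //.
    by apply: open_nbhs_nbhs; split.
  move=> /nbhs_ballP[e /= e0 eO]; exists (e / 2); first by rewrite divr_gt0.
  move=> y ye; apply: eO; rewrite -ball_normE /= sub0r normrN.
  by apply: le_lt_trans ye _; rewrite ltr_pdivrMr // ltr_pMr // ltr1n.
pose sc (x : 'rV[K]_d) := chart v j (e *: clamp x).
have scO x : O (sc x).
  apply: eO; rewrite normrZ gtr0_norm // -[leRHS]mulr1 ler_pM2l //; exact: clamp_norm.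
have scb x : bd (sc x) by exact: chart_bd.
have csc : continuous sc.
  move=> x; apply: (@continuous_comp _ _ _ (fun x => e *: clamp x) (chart v j)).
    by apply: rv_contZ; [exact: cst_continuous|exact: clamp_continuous].
  exact: chart_continuous.
have sc0 : sc 0 = v by rewrite /sc clamp_id ?normr0 // scaler0 chart0.
pose th x := phinv psi (phi (sc x)).
have thK x : psi (th x) = phi (sc x) by apply: phinvK; exact: Opsi.
have cth : continuous th.
  apply: (phinv_continuous epsi (p := phi \o sc)) => [x|x]; last exact: Opsi.
  by apply: continuous_comp; [exact: csc|exact: cphi].
have ith x y : `|x| <= 1 -> `|y| <= 1 -> th x = th y -> x = y.
  move=> x1 y1 /(congr1 psi); rewrite !thK => /iphi /(chart_inj vj).
  rewrite !clamp_id // => /(congr1 (fun z => e^-1 *: z)).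
  by rewrite !scalerA mulVf ?gt_eqF // !scale1r.
pose g x := padv d (th x).
have cg : continuous g.
  by move=> x; apply: (@continuous_comp _ _ _ th (padv d)); [exact: cth|exact: padv_continuous].
have [r r0 gr] := invariance_of_domain cg (fun x y x1 y1 E => ith x y x1 y1 (padv_inj kd E)).
have kd' : k = d.
  apply/eqP; rewrite eqn_leq kd leqNgt; apply/negP => kd'.
  (* A point within r of g 0 but off the hyperplane that contains the image. *)
  pose c := g 0 + (r / 2) *: delta_mx 0 (Ordinal kd').
  have [|x _ xc] := gr c.
    rewrite /c addrAC subrr add0r normrZ gtr0_norm ?divr_gt0 //.
    apply: (@le_lt_trans _ _ (r / 2 * 1)).
      rewrite ler_pM2l ?divr_gt0 //; apply: norm_le => // i.
      by rewrite mxE; case: (_ && _); rewrite ?normr1 ?normr0.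
    by rewrite mulr1 ltr_pdivrMr // ltr_pMr // ltr1n.
  have := congr1 (fun z : 'rV[K]_d => z 0 (Ordinal kd')) xc.
  rewrite /c /g !mxE /= insubF ?ltnn // !eqxx mulr1 add0r => /esym/eqP.
  by rewrite mulf_eq0 invr_eq0 gt_eqF ?pnatr_eq0.
split=> //; exists (padv d @^-1` ball (g 0) r); split.
- apply: open_comp; last exact: ball_open.
  by move=> w _; exact: padv_continuous.
- by rewrite /= -sc0; apply: ballxx.
- move=> w; rewrite /= -ball_normE /= distrC => /gr[x x1 /(padv_inj kd) <-].
  by exists (sc x) => //; rewrite thK.
Qed.

End Local.
End LocalDomain.

(** * Closed cells of a regular complex *)

Section CWTopology.
Variables (K : realType) (T : topologicalType) (X : regular_CW K T).
Local Notation Dl := (stdsimplex K).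
Local Notation cell := (cells X).
Implicit Types x y z : cell.

Definition ch (x : cell) : Dl (tag x) -> T := chi (tagged x).
Arguments ch : clear implicits.
Definition cl (x : cell) : set T := range (ch x).

Lemma ch_embedding x : embedding (ch x).
Proof. exact: CW_embedding. Qed.

Lemma ch_continuous x : continuous (ch x).
Proof. by have [] := ch_embedding x. Qed.

Lemma ch_inj x : injective (ch x).
Proof. by have [] := ch_embedding x. Qed.

Lemma hausT : hausdorff_space T.
Proof. exact: CW_hausdorff X. Qed.

Lemma cl_compact x : compact (cl x).
Proof.
apply: continuous_compact; last exact: simplex_compact.
by apply: continuous_subspaceT; exact: ch_continuous.
Qed.

Lemma cl_closed x : closed (cl x).
Proof. by apply: compact_closed; [exact: hausT|exact: cl_compact]. Qed.

Lemma open_cell_cl x : open_cell x `<=` cl x.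
Proof. by move=> _ [u _ <-]; exists u. Qed.

Lemma open_cell_ch x u : open_cell x (ch x u) <-> ~ bd u.
Proof.
rewrite bdE; split=> [[w wi /ch_inj <-//]|ui]; by exists u.
Qed.

Lemma simplex_interior_dense k (u : Dl k) (U : set (Dl k)) : nbhs u U ->
  exists2 w, U w & ~ bd w.
Proof.
move=> /nbhs_ballP[e /= e0 eU].
pose t : K := Order.min (e / 2) (1 / 2).
have t0 : 0 < t by rewrite lt_min !divr_gt0.
have t1 : t <= 1 / 2 by rewrite ge_min lexx orbT.
have te : t < e.
  by rewrite gt_min ltr_pdivrMr // ltr_pMr // ltr1n.
have x0 i : 0 <= (1 - t) * bc u i + t * bc (bary K k) i.
  by rewrite addr_ge0 // mulr_ge0 ?bc_ge0 ?(ltW t0) //; lra.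
have x1 : \sum_i ((1 - t) * bc u i + t * bc (bary K k) i) = 1.
  by rewrite big_split /= -!mulr_sumr !bc_sum; lra.
exists (mksimplex x0 x1).
  apply: eU; rewrite -[ball _ _ _]/(ball (set_val u) e (set_val _)) -ball_normE /=.
  apply: le_lt_trans te; apply: norm_le => [|i]; first exact: ltW.
  rewrite !mxE -/(bc u i); have -> : bc u i - ((1 - t) * bc u i + t * bc (bary K k) i) =
    t * (bc u i - bc (bary K k) i) by ring.
  rewrite normrM gtr0_norm // ler_piMr ?(ltW t0) //.
  have := bc_ge0 u i; have := bc_le1 u i.
  have := bc_ge0 (bary K k) i; have := bc_le1 (bary K k) i.
  by rewrite ler_norml => ? ? ? ?; lra.
move=> [i]; rewrite bc_mk; have : 0 < t * bc (bary K k) i.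
  by rewrite mulr_gt0 // bc_bary invr_gt0 ltr0n.
have : 0 <= (1 - t) * bc u i by rewrite mulr_ge0 ?bc_ge0 //; lra.
by move=> ? ? ?; lra.
Qed.

Lemma closure_open_cell x : closure (open_cell x) = cl x.
Proof.
rewrite eqEsubset; split.
  by rewrite [X in _ `<=` X](closure_id _).1; [exact/closureS/open_cell_cl|exact: cl_closed].
move=> _ [u _ <-] U nU; have [w Uw nw] := simplex_interior_dense (ch_continuous nU).
by exists (ch x w); split=> //; apply/open_cell_ch.
Qed.

Lemma cell_of p : exists c : cell, open_cell c p.
Proof. by have [c [cp _]] := CW_partition X p; exists c. Qed.

Lemma open_cell_uniq p x y : open_cell x p -> open_cell y p -> x = y.
Proof. by have [c [_ cu]] := CW_partition X p => /cu <- /cu <-. Qed.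

Lemma open_cell_neq0 x : open_cell x (ch x (bary K (tag x))).
Proof. by apply/open_cell_ch; exact: bary_nbd. Qed.

Lemma faceE x y : face x y <-> open_cell y `<=` cl x.
Proof. by rewrite /face closure_open_cell. Qed.

Lemma cl_boundary x u : bd u -> exists2 y : cell, (tag y < tag x)%N & open_cell y (ch x u).
Proof.
move=> ub; have [B [_ Bd Bx]] := CW_boundary (tagged x).
have [|c Bc cu] := Bx (ch x u).
  by exists u => //= ui; move: ub; apply/bdE.
by exists c => //; exact: Bd.
Qed.

Lemma cl_finite x : exists2 B : set cell, finite_set B &
  forall p, cl x p -> exists2 c, B c & open_cell c p.
Proof.
have [B [fB Bd Bx]] := CW_boundary (tagged x).
exists (B `|` [set x]); first by rewrite finite_setU; split=> //; exact: finite_set1.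
move=> _ [u _ <-]; have [ub|nb] := pselect (bd u).
  have [|c Bc cu] := Bx (ch x u); last by exists c => //; left.
  by exists u => //= ui; move: ub; apply/bdE.
by exists x; [right|apply/open_cell_ch].
Qed.

Lemma cl_tag x y p : open_cell y p -> cl x p -> (tag y <= tag x)%N /\ (y <> x -> (tag y < tag x)%N).
Proof.
move=> yp [u _ up]; have [ub|nb] := pselect (bd u).
  have [z zx zu] := cl_boundary ub; rewrite up in zu.
  by rewrite (open_cell_uniq yp zu); split=> //; exact: ltnW.
have : open_cell x p by rewrite -up; apply/open_cell_ch.
by move=> /(open_cell_uniq yp) ->; split.
Qed.

Definition cellset (S : set cell) : set T := \bigcup_(c in S) open_cell c.

(** By the weak topology it is enough to look inside one closed cell. It meets finitely many open
    cells, so the trace is a finite union of closed sets. *)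
Lemma cellset_closed (S : set cell) : (forall c, S c -> cl c `<=` cellset S) ->
  closed (cellset S).
Proof.
move=> Scl; apply: (@CW_weak _ _ X) => d c; pose w : cell := existT _ d c.
have [B fB Bw] := cl_finite w.
have -> : chi c @^-1` cellset S = \bigcup_(x in B `&` S) (ch w @^-1` cl x).
  rewrite eqEsubset; split=> u /=.
    move=> [x Sx xu]; exists x; last exact: open_cell_cl.
    split=> //; have [|y By yu] := Bw (ch w u); first by exists u.
    by rewrite (open_cell_uniq xu yu).
  by move=> [x [_ Sx] xu]; exact: (Scl x).
apply: closed_bigcup => [|x _]; first exact: finite_setIl.
by apply: preimage_closed; [move=> v _; exact: (@ch_continuous w)|exact: cl_closed].
Qed.

(** Choose a point of C in each open cell that meets C. Every subset of these points is closed, as a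
    closed cell contains finitely many of them; were they infinite in number, their cofinite filter
    would cluster at a point of C, which this discreteness forbids. *)
Lemma compact_cells (C : set T) : compact C ->
  finite_set [set x : cell | open_cell x `&` C !=set0].
Proof.
move=> cC; set I := [set x | _].
have /choice [pt ptP] : forall x : cell, exists p, I x -> open_cell x p /\ C p.
  by move=> x; have [[p [xp Cp]]|nI] := pselect (I x); [exists p|exists (ch x (bary K _))].
pose D : set T := pt @` I.
have Dsub (E : set T) : E `<=` D -> closed E.
  move=> ED; apply: (@CW_weak _ _ X) => d c; pose w : cell := existT _ d c.
  have [B fB Bw] := cl_finite w.
  have hD : accessible_space (Dl d).
    exact/hausdorff_accessible/simplex_hausdorff.
  apply: (proj1 accessible_finite_set_closed hD).
  apply: (@sub_finite_set _ _ ((fun x => phinv (ch w) (pt x)) @` B)).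
    move=> u /= Eu; have [x Ix xu] := ED _ Eu.
    exists x; last by rewrite xu (phiK (ch_embedding w)).
    have [xp _] := ptP x Ix; have [|y By yu] := Bw (ch w u); first by exists u.
    by rewrite xu in xp; rewrite (open_cell_uniq xp yu).
  exact: finite_image.
have fD : finite_set D.
  apply: contrapT => infD; pose F : set (set T) := [set A | finite_set (D `\` A)].
  have FF : ProperFilter F.
    split; first by rewrite /F /= setD0.
    split=> [|A B fA fB|A B AB fA].
    - by rewrite /F /mkset setDT.
    - by rewrite /F /mkset setDIr finite_setU.
    - by apply: sub_finite_set fA => p [Dp nBp]; split=> // /AB.
  have FC : F C.
    rewrite /F /= (_ : D `\` C = set0) // -subset0 => _ [[x Ix <-]].
    by have [_ ?] := ptP x Ix.
  have [p [Cp clp]] := cC F FF FC.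
  have h1 : F (D `\ p).
    rewrite /F /mkset setDD; apply: (@sub_finite_set _ _ [set p]) => [q []//|].
    exact: finite_set1.
  have h2 : nbhs p (~` (D `\ p)).
    apply: open_nbhs_nbhs; split; first by rewrite openC; apply: Dsub => y [].
    by move=> [_]; exact.
  by have [q [Dq nq]] := clp _ _ h1 h2.
have /choice [f fP] := cell_of.
apply: (@sub_finite_set _ _ (f @` D)); last exact: finite_image.
move=> x Ix; have [xp _] := ptP x Ix; exists (pt x); first by exists x.
exact: open_cell_uniq (fP _) xp.
Qed.

Definition skel_but (d : nat) (x : cell) : set T :=
  cellset [set c | (tag c <= d)%N /\ c <> x].

Lemma skel_but_closed x : closed (skel_but (tag x) x).
Proof.
apply: cellset_closed => c /= [cd cx] p cp; have [y yp] := cell_of p.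
have [yc yc'] := cl_tag yp cp; exists y => //=; split; first exact: leq_trans cd.
move=> yx; have [yc_|/yc'] := pselect (y = c); first by apply: cx; rewrite -yc_.
by rewrite yx ltnNge cd.
Qed.

(** Connectedness of the open simplex, along the segment from a to u; the pair C, F presents a
    clopen subset of it. *)
Lemma interior_clopen k (C F : set (Dl k)) : open C -> closed F ->
  (forall u, ~ bd u -> C u <-> F u) -> (exists2 u, ~ bd u & C u) ->
  forall u, ~ bd u -> C u.
Proof.
move=> oC cF CF [a na Ca] u nu.
have x0 (t : K) : 0 <= t <= 1 -> forall i, 0 <= (1 - t) * bc a i + t * bc u i.
  by move=> /andP[t0 t1] i; rewrite addr_ge0 // mulr_ge0 ?bc_ge0 ?subr_ge0.
have x1 (t : K) : \sum_i ((1 - t) * bc a i + t * bc u i) = 1.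
  by rewrite big_split /= -!mulr_sumr !bc_sum; lra.
pose ga (t : K) : Dl k := vx (\row_i ((1 - t) * bc a i + t * bc u i)).
have bga t i : 0 <= t <= 1 -> bc (ga t) i = (1 - t) * bc a i + t * bc u i.
  move=> t01; rewrite /ga; set r := \row_i _.
  by rewrite (_ : r = set_val (mksimplex (x0 t t01) (x1 t))) // vxK bc_mk.
have nga t : 0 <= t <= 1 -> ~ bd (ga t).
  move=> t01 [i]; rewrite bga // => E; have /andP[t0 t1] := t01.
  have a0 : 0 < bc a i by move/bdE: na; exact.
  have u0 : 0 < bc u i by move/bdE: nu; exact.
  have [t10|t1'] := eqVneq t 1; first by move: E; rewrite t10 subrr mul0r add0r mul1r; lra.
  have : 0 < (1 - t) * bc a i by rewrite mulr_gt0 // subr_gt0 lt_neqAle t1' t1.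
  have : 0 <= t * bc u i by rewrite mulr_ge0 // ltW.
  by move: E; lra.
pose J : set K := `[0, 1]%classic.
have JE t : J t <-> 0 <= t <= 1 by rewrite /J /= in_itv.
have cga : {within J, continuous ga}.
  apply/subspace_sigL_continuousP; apply: continuous_bc => i.
  rewrite (_ : (fun x : J => bc (sigL J ga x) i) =
      (fun t : K => (1 - t) * bc a i + t * bc u i) \o (set_val : J -> K)).
    move=> y; apply: continuous_comp; first exact: initial_continuous.
    apply: (@cvgD K K^o _ (nbhs (set_val y)) _ (fun t => (1 - t) * bc a i)).
      apply: (@cvgM K _ (nbhs (set_val y)) _ (fun t => 1 - t)); last exact: cvg_cst.
      apply: (@cvgB K K^o _ (nbhs (set_val y)) _ (fun=> 1)); first exact: cvg_cst.
      exact: cvg_id.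
    by apply: (@cvgM K _ (nbhs (set_val y)) _ (fun t => t)); [exact: cvg_id|exact: cvg_cst].
  apply/funext => -[t tJ]; rewrite /sigL /= bga //; apply/JE; exact: set_mem tJ.
have ga1 : ga 1 = u.
  by apply: bc_inj => i; rewrite bga ?ler01 ?lexx // subrr mul0r add0r mul1r.
have ga0 : ga 0 = a.
  by apply: bc_inj => i; rewrite bga ?ler01 ?lexx // subr0 mul1r mul0r addr0.
have J1 : J 1 by apply/JE; rewrite ler01 lexx.
have J0 : J 0 by apply/JE; rewrite ler01 lexx.
suff E : J `&` ga @^-1` C = J by have : (J `&` ga @^-1` C) 1 by [rewrite E]; rewrite /= ga1 => -[].
apply: (@segment_connected K 0 1).
- by exists 0; split=> //=; rewrite ga0.
- have /continuousP/(_ C oC)/open_subspaceP[V oV VE] := cga.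
  by exists V => //; rewrite setIC [RHS]setIC VE.
- have /continuousP/(_ (~` F)) := cga; rewrite openC => /(_ cF)/open_subspaceP[V oV VE].
  exists (~` V); first by rewrite closedC.
  rewrite eqEsubset; split=> t [Jt].
    move=> /= /CF h; split=> // Vt; have : (V `&` J) t by [].
    by rewrite VE => -[] /= nF _; apply: nF; apply: h; apply: nga; exact/JE.
  move=> nVt; split=> //=; apply/CF; first by apply: nga; exact/JE.
  apply: contrapT => nF; apply: nVt; have : (ga @^-1` (~` F) `&` J) t by [].
  by rewrite -VE => -[].
Qed.

End CWTopology.

Arguments ch {K T X} x _.

(** * A cell that meets a closed cell lies in it *)

Section Normality.
Variables (K : realType) (T : topologicalType) (X : regular_CW K T).
Local Notation Dl := (stdsimplex K).
Local Notation cell := (cells X).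
Implicit Types x y z : cell.

Definition sph x : set T := ch x @` (@bd K (tag x)).

Lemma cl_sph x p : cl x p -> ~ open_cell x p -> sph x p.
Proof.
move=> [u _ <-] nu; exists u => //; apply: contrapT => nb.
by apply: nu; apply/open_cell_ch.
Qed.

Lemma sph_cl x : sph x `<=` cl x.
Proof. by move=> _ [u _ <-]; exists u. Qed.

Lemma sph_closed x : closed (sph x).
Proof.
apply: compact_closed; first exact: (hausT X).
apply: continuous_compact; first by apply: continuous_subspaceT; exact: ch_continuous.
by apply: (subclosed_compact _ (@simplex_compact K _)) => //; exact: bd_closed.
Qed.

Lemma sph_tag x y p : open_cell y p -> sph x p -> (tag y < tag x)%N.
Proof.
move=> yp xp; have [_] := cl_tag yp (sph_cl xp); apply => yx.
by move: yp; rewrite yx => xp'; case: xp xp' => u ub <- /open_cell_ch.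
Qed.

(* Near a point of the open cell y the k-skeleton (k = dim y) is contained in y;
   so a piece of the boundary sphere of x inside the k-skeleton can be read in the
   chart of y. *)
Lemma sph_local d x y p (N : set T) : tag x = d.+1 -> (tag y <= d)%N ->
  open N -> N p -> open_cell y p -> sph x p ->
  (forall q z, N q -> sph x q -> open_cell z q -> (tag z <= tag y)%N) ->
  tag y = d /\ exists V : set (Dl (tag y)), [/\ open V, V (phinv (ch y) p) &
    forall w, V w -> sph x (ch y w)].
Proof.
case: x => e c /= ed; move: c; rewrite {e}ed => c.
pose x : cell := existT _ d.+1 c; rewrite -/x.
move=> yd oN Np yp xp Nmax; have [v vb vp] := xp.
pose O := ch x @^-1` (N `&` ~` skel_but (tag y) y).
have oO : open O.
  apply: open_comp; first by move=> w _; exact: ch_continuous.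
  by apply: openI => //; rewrite openC; exact: skel_but_closed.
have Ov : O v.
  rewrite /O /= vp; split=> // -[z [_ zy] zp]; apply: zy; exact: open_cell_uniq zp yp.
have Opsi w : O w -> bd w -> range (ch y) (ch x w).
  move=> [Nw nw] wb; have [z zw] := cell_of X (ch x w).
  have zt : (tag z <= tag y)%N by apply: Nmax zw => //; exists w.
  have [<-|zy] := pselect (z = y); first exact: open_cell_cl zw.
  by exfalso; apply: nw; exists z.
have [td [V [oV Vp hV]]] := local_domain (@ch_continuous _ _ _ x)
  (@ch_inj _ _ _ x) (ch_embedding y) vb oO Ov Opsi yd.
split=> //; exists V; split=> //; first by rewrite -vp.
by move=> w /hV[w' w'b ->]; exists w'.
Qed.

(** The trace of the sphere on z is closed. It is open by [sph_local], since no cell that meets the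
    sphere has dimension above d. An open cell is connected. *)
Lemma sph_facet d x z p : tag x = d.+1 -> tag z = d -> open_cell z p -> sph x p ->
  open_cell z `<=` sph x.
Proof.
move=> xd zd zp xp; pose F := ch z @^-1` sph x.
have cF : closed F.
  by apply: preimage_closed; [move=> w _; exact: ch_continuous|exact: sph_closed].
pose C := \bigcup_(O in [set O : set (Dl (tag z)) | open O /\ O `<=` F]) O.
have oC : open C by apply: bigcup_open => Q [].
have CF u : ~ bd u -> C u <-> F u.
  move=> nu; split=> [[Q [_ QF] /QF//]|Fu].
  have zu : open_cell z (ch z u) by apply/open_cell_ch.
  have zd' : (tag z <= d)%N by rewrite zd.
  have mx q z' : setT q -> sph x q -> open_cell z' q -> (tag z' <= tag z)%N.
    by move=> _ xq z'q; have := sph_tag z'q xq; rewrite xd zd.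
  have [_ [V [oV Vu hV]]] := sph_local xd zd' openT I zu Fu mx.
  exists V; first by split=> // w /hV.
  by rewrite -(phiK (ch_embedding z) u).
have := interior_clopen oC cF CF; case: zp => u0 iu0 u0p; move/bdE in iu0.
move=> h _ [u iu <-]; move/bdE in iu; have : C u.
  by apply: h => //; exists u0 => //; apply/CF => //; exact: (eq_ind_r (sph x) xp u0p).
by move/(CF _ iu).
Qed.

(** Induction on the dimension d + 1 of x. If p lies in a closed d-cell whose interior is in the
    sphere, the induction hypothesis applies to that cell. If not, remove these closed d-cells: a
    cell of maximal dimension that meets the rest of the sphere has dimension d by [sph_local], so
    by [sph_facet] it is one of the cells removed. *)
Lemma cl_normal x y p : open_cell y p -> cl x p -> open_cell y `<=` cl x.
Proof.
have [m] := ubnP (tag x); elim: m x y p => // m IH x y p xm yp xp.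
have [xp'|/(cl_sph xp) sp] := pselect (open_cell x p).
  by rewrite (open_cell_uniq yp xp'); exact: open_cell_cl.
have [d xd] : exists d, tag x = d.+1.
  by have := sph_tag yp sp; case: (tag x) => // d _; exists d.
have [B fB Bx] := cl_finite x.
pose Z : set cell := [set z | [/\ B z, tag z = d & open_cell z `<=` sph x]].
have [[z [Bz zd zx] zp]|nZ] := pselect (exists2 z, Z z & cl z p).
  apply: subset_trans (IH z y p _ yp zp) _; first by rewrite zd -ltnS -xd.
  rewrite -closure_open_cell (closure_id (cl x)).1; last exact: cl_closed.
  by apply: closureS => q /zx /sph_cl.
exfalso; pose N : set T := ~` (\bigcup_(z in Z) cl z).
have oN : open N.
  rewrite openC; apply: closed_bigcup => [|z _]; last exact: cl_closed.
  by apply: sub_finite_set fB => z [].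
have Np : N p by move=> [z Zz zp]; apply: nZ; exists z.
have ex : exists k, `[< exists y q, [/\ tag y = k, open_cell y q, sph x q & N q] >].
  by exists (tag y); apply/asboolP; exists y, p.
have bnd k : `[< exists y q, [/\ tag y = k, open_cell y q, sph x q & N q] >] -> (k <= d)%N.
  by move=> /asboolP[y' [q [<- yq xq _]]]; have := sph_tag yq xq; rewrite xd.
case: (ex_maxnP ex bnd) => k /asboolP[y' [q [y'k y'q xq Nq]]] kmax.
have y'd : (tag y' <= d)%N by apply: bnd; apply/asboolP; exists y', q.
have mx q' z : N q' -> sph x q' -> open_cell z q' -> (tag z <= tag y')%N.
  by move=> Nq' xq' zq'; rewrite y'k; apply: kmax; apply/asboolP; exists z, q'.
have [td _] := sph_local xd y'd oN Nq y'q xq mx.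
apply: Nq; exists y'; last exact: open_cell_cl.
split=> //; last exact: sph_facet xd td y'q xq.
by have [c Bc cq] := Bx q (sph_cl xq); rewrite (open_cell_uniq y'q cq).
Qed.

Lemma face_cl x y p : open_cell y p -> cl x p -> face x y.
Proof. by move=> yp xp; apply/faceE; exact: cl_normal yp xp. Qed.

Lemma face_tag x y : face x y -> (tag y <= tag x)%N.
Proof.
move/faceE => h; have yo := open_cell_neq0 y.
by have [] := cl_tag yo (h _ yo).
Qed.

Lemma star_finite p : locally_compact [set: T] -> finite_set [set c : cell | cl c p].
Proof.
move=> /(_ p I) [C]; rewrite withinET => nC [cC _].
apply: sub_finite_set (compact_cells X cC) => c cp /=.
have : closure (open_cell c) p by rewrite closure_open_cell.
by move=> /(_ _ nC).
Qed.

(** The complement of the open star of y. *)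
Definition costar y : set T := cellset [set c | ~ face c y].

Lemma costar_closed y : closed (costar y).
Proof.
apply: cellset_closed => c /= ncy p cp; have [z zp] := cell_of X p.
exists z => //= zy; apply: ncy; apply: face_trans zy; exact: face_cl zp cp.
Qed.

Lemma costarE y z p : open_cell z p -> costar y p <-> ~ face z y.
Proof.
move=> zp; split=> [[c nc cp]|nz]; last by exists z.
by rewrite (open_cell_uniq zp cp).
Qed.

Lemma face_finite y : locally_compact [set: T] -> finite_set [set c : cell | face c y].
Proof.
move=> lc; apply: sub_finite_set (star_finite (ch y (bary K _)) lc) => c /= /faceE; apply.
exact: open_cell_neq0.
Qed.

End Normality.

(** * Cellular computation of the local cohomology *)

Section CellularFiltration.
Variables (K : realType) (T : topologicalType) (X : regular_CW K T).
Local Notation Dl := (stdsimplex K).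
Local Notation cell := (cells X).
Implicit Types (A B : set T) (x y z : cell) (l : seq cell).

Definition addc A l : set T := A `|` cellset [set` l].

Definition attachable A l : Prop := [/\ closed A, uniq l,
  forall z, z \in l -> sph z `<=` A & forall z p, z \in l -> open_cell z p -> ~ A p].

Lemma addc_cons A z l : sph z `<=` A -> addc A (z :: l) = addc (A `|` cl z) l.
Proof.
move=> zA; rewrite /addc eqEsubset; split=> p.
  move=> [Ap|[c /=]]; first by left; left.
  rewrite inE => /predU1P[->|cl'] cp; last by right; exists c.
  by left; right; exact: open_cell_cl.
move=> [[Ap|zp]|[c /= cl' cp]]; first by left.
  have [op|/(cl_sph zp)/zA Ap] := pselect (open_cell z p); last by left.
  by right; exists z => //=; rewrite mem_head.
by right; exists c => //=; rewrite inE cl' orbT.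
Qed.

Lemma addc_nil A : addc A [::] = A.
Proof.
by rewrite /addc /cellset (_ : [set` [::]] = set0) ?bigcup_set0 ?setU0 // -subset0.
Qed.

Lemma attachable_cons A z l : attachable A (z :: l) ->
  [/\ closed A, forall u, bd u -> A (ch z u), forall u, A (ch z u) -> bd u &
    attachable (A `|` cl z) l].
Proof.
move=> [cA /= /andP[zl ul] sA oA]; split=> //.
- by move=> u ub; apply: sA (mem_head _ _) _ _; exists u.
- move=> u Au; apply: contrapT => nu; apply: oA (mem_head z l) _ Au.
  exact/open_cell_ch.
split=> //; first by apply: closedU => //; exact: cl_closed.
  by move=> w wl p wp; left; apply: sA wp; rewrite inE wl orbT.
move=> w p wl wp [Ap|zp]; first by apply: oA wp Ap; rewrite inE wl orbT.
have [op|/(cl_sph zp)] := pselect (open_cell z p).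
  by move: zl; rewrite (open_cell_uniq op wp) wl.
by move=> /(sA _ (mem_head _ _)); apply: oA wp; rewrite inE wl orbT.
Qed.

Section Coef.
Variable M : zmodType.

Lemma closed1T (p : T) : closed [set p].
Proof. by apply: hausdorff_closed1; exact: hausT X. Qed.

Lemma vanish_ch A z (e : cochain K M T) : sph z `<=` A -> vanish A e ->
  dl e (ch z) = 0.
Proof.
case: z => -[//|k] c zA e0; rewrite dlS big1 // => i _; rewrite e0 ?mul0rz //.
split=> [u|_ [u _ <-] /=].
  by apply: continuous_comp; [exact: coface_continuous|exact: (@ch_continuous _ _ _ (existT _ k.+1 c))].
by apply: zA; exists (coface i u) => //; exists i; rewrite bc_coface unlift_none.
Qed.

Lemma null_vanish A B (c : cochain K M T) : vanish B c -> null B A c.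
Proof.
move=> c0; exists (fun _ _ => 0) => // k s sB; rewrite c0 //.
by case: k s {sB} => // k s; rewrite dlS big1 // => i _; rewrite mul0rz.
Qed.

(** One cell at a time by [attach_null]. The spheres of the remaining cells lie in A, so subtracting
    the coboundary of a cochain that vanishes on A keeps the values on them. *)
Lemma attachable_null A l (c : cochain K M T) : attachable A l -> rcocycle (addc A l) A c ->
  (forall z, z \in l -> c (tag z) (ch z) = 0) -> null (addc A l) A c.
Proof.
elim: l A c => [|z l IH] A c.
  rewrite addc_nil => _ [c0 _] _; exact: null_vanish.
move=> Al; have [cA zA Az Azl] := attachable_cons Al.
have zA' : sph z `<=` A by move=> _ [u ub <-]; exact: zA.
rewrite addc_cons // => cc cz.
have sub : A `|` cl z `<=` addc (A `|` cl z) l by exact: subsetUl.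
have [e e0 ce] : null (A `|` cl z) A c.
  apply: (attach_null cA closed1T (@cl_closed _ _ _ z) (ch_embedding z) zA Az).
  - exact: simplex_nullP.
  - exact: rcocycle_sub sub (@subset_refl _ A) cc.
  - exact: cz (mem_head _ _).
have [||g g0 cg] := IH (A `|` cl z) (fun k s => c k s - dl e s) Azl.
- split=> k s ss; first by rewrite ce // subrr.
  by rewrite dlB dl_dl cc.2 // subrr.
- move=> w wl; rewrite cz ?inE ?wl ?orbT // (@vanish_ch A) ?subrr //.
  by case: Al => _ _ sA _; apply: sA; rewrite inE wl orbT.
exists (fun k s => e k s + g k s) => k s ss.
  by rewrite e0 // g0 ?addr0 //; apply: sin_sub ss; exact: subsetUl.
by rewrite dlD -cg // addrC subrK.
Qed.

Lemma attachable_puncture A l p : attachable A l -> (forall z, z \in l -> cl z p) ->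
  acyclic K M (addc A l `\ p) (A `\ p).
Proof.
elim: l A => [|z l IH] A.
  rewrite addc_nil => _ _ c [c0 _]; exact: null_vanish.
move=> Al lp; have [cA zA Az Azl] := attachable_cons Al.
have zA' : sph z `<=` A by move=> _ [u ub <-]; exact: zA.
rewrite addc_cons //.
apply: (@acyclic_trans _ _ _ _ ((A `|` cl z) `\ p)).
- by move=> q [Aq qp]; split=> //; left.
- by move=> q [Aq qp]; split=> //; left.
- have [u _ up] := lp z (mem_head _ _); rewrite -up.
  exact: (acyclic_puncture cA (@cl_closed _ _ _ z) (ch_embedding z) zA Az).
- by apply: IH => // w wl; apply: lp; rewrite inE wl orbT.
Qed.

Definition homog (q : nat) (c : cochain K M T) : Prop :=
  forall k (s : Dl k -> T), k != q -> c k s = 0.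

Lemma homog_hpart q c : homog q (hpart q c).
Proof. by move=> k s /negPf kq; rewrite /hpart kq. Qed.

Lemma homog_dl q c : homog q c -> homog q.+1 (dl c).
Proof.
move=> hc [//|k] s kq; rewrite dlS big1 // => i _.
by rewrite hc ?mul0rz.
Qed.

Lemma homogB q c e : homog q c -> homog q e -> homog q (fun k s => c k s - e k s).
Proof. by move=> hc he k s kq; rewrite hc // he // subrr. Qed.

(** The part of degree q - 1 of a primitive suffices. For q = 0 the predecessor is again 0, and the
    primitive is 0. *)
Lemma null_homog A B q c : homog q c -> null B A c ->
  exists e, [/\ homog q.-1 e, homog q (dl e), vanish A e &
    forall k (s : Dl k -> T), sin B s -> c k s = dl e s].
Proof.
case: q => [|q] hc [e e0 ce].
  exists (fun _ _ => 0); split=> //.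
    by move=> [|k] s //= _; rewrite big1 // => i _; rewrite mul0rz.
  move=> [|k] s sB; first by rewrite ce.
  by rewrite hc //= big1 // => i _; rewrite mul0rz.
exists (hpart q e); split=> [||k s sA|k s sB]; first exact: homog_hpart.
- exact/homog_dl/homog_hpart.
- by rewrite /hpart e0 // if_same.
- by rewrite dl_hpart /hpart; case: (k =P q.+1) => [kq|/eqP kq]; [exact: ce|rewrite hc].
Qed.

End Coef.

Section Star.
Variable y : cell.
Hypothesis lc : locally_compact [set: T].
Hypothesis fin_dim : finite_dimensional X.

Definition costar_skel (k : nat) : set T := cellset [set c | ~ face c y \/ (tag c < k)%N].

Lemma costar_skelE k z p : open_cell z p -> costar_skel k p <-> (~ face z y \/ (tag z < k)%N).
Proof.
move=> zp; split=> [[c cB cp]|zk]; last by exists z.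
by rewrite (open_cell_uniq zp cp).
Qed.

Lemma costar_skel_closed k : closed (costar_skel k).
Proof.
apply: cellset_closed => c /= ck p cp; have [z zp] := cell_of X p.
have cz := face_cl zp cp; exists z => //=.
case: ck => [nc|ck]; [left=> zy; apply: nc; exact: face_trans cz zy|right].
exact: leq_ltn_trans (face_tag cz) ck.
Qed.

Lemma costar_skel0 : costar_skel 0 = costar y.
Proof.
by rewrite eqEsubset; split=> p [c]; [case=> // nc cp; exists c|move=> nc cp; exists c => //; left].
Qed.

Lemma costar_skel_sub k m : (k <= m)%N -> costar_skel k `<=` costar_skel m.
Proof.
move=> km p [c ck cp]; exists c => //; case: ck => [|ck]; [by left|right].
exact: leq_trans ck km.
Qed.

Lemma costar_skel_full : exists n, forall k, (n <= k)%N -> costar_skel k = setT.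
Proof.
have [n nX] := fin_dim; exists n.+1 => k nk; rewrite eqEsubset; split=> // p _.
have [c cp] := cell_of X p; exists c => //; right; apply: leq_trans nk.
by rewrite ltnS leqNgt; apply/negP => /nX; apply; exact: tagged c.
Qed.

Lemma star_seq k : exists l : seq cell, uniq l /\
  forall z, z \in l <-> (face z y /\ tag z = k).
Proof.
have /finite_seqP[s sE] : finite_set [set c : cell | face c y /\ tag c = k].
  by apply: sub_finite_set (face_finite y lc) => c [].
exists (undup s); split; first exact: undup_uniq.
move=> z; rewrite mem_undup; split=> [zs|zk].
  by have : [set c : cell | face c y /\ tag c = k] z by rewrite sE.
by have : [set` s] z by rewrite -sE.
Qed.

Lemma costar_skel_attachable k l : (uniq l /\ forall z, z \in l <-> (face z y /\ tag z = k)) ->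
  attachable (costar_skel k) l /\ addc (costar_skel k) l = costar_skel k.+1.
Proof.
move=> [ul lE]; split.
  split=> //; first exact: costar_skel_closed.
    move=> z /lE[zy zk] p zp; have [w wp] := cell_of X p; exists w => //; right.
    by rewrite -zk; exact: sph_tag wp zp.
  by move=> z p /lE[zy zk] zp /(costar_skelE _ zp)[//|]; rewrite zk ltnn.
rewrite /addc eqEsubset; split=> p.
  move=> [|[z /lE[zy zk] zp]]; first exact: costar_skel_sub.
  by exists z => //; right; rewrite /= zk.
move=> [c ck cp]; have [cy|ncy] := pselect (face c y); last by left; exists c => //; left.
have [ck'|kc] := ltnP (tag c) k; first by left; exists c => //; right.
right; exists c => //; apply/lE; split=> //.
by case: ck => // ck; apply/eqP; rewrite eqn_leq kc andbT -ltnS.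
Qed.

Section Coef2.
Variable M : zmodType.

(** Each step attaches cells of one dimension and has relative cohomology in that degree alone; the
    condition on q excludes the dimensions j to m - 1 of the steps. *)
Lemma costar_skel_null j m q (c : cochain K M T) : homog q c -> (j <= m)%N ->
  (q < j)%N || (m <= q)%N -> rcocycle (costar_skel m) (costar_skel j) c ->
  null (costar_skel m) (costar_skel j) c.
Proof.
move=> hc; elim: m => [|m IH] jm qjm cc.
  have j0 : j = 0%N by apply/eqP; rewrite -leqn0.
  by apply: null_vanish; have := cc.1; rewrite j0.
have [jm'|mj] := leqP j m; last first.
  have j0 : j = m.+1 by apply/eqP; rewrite eqn_leq jm.
  by apply: null_vanish; have := cc.1; rewrite j0.
have qjm' : (q < j)%N || (m <= q)%N.
  by case/orP: qjm => [->//|/ltnW ->]; rewrite orbT.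
have [e [_ he e0 ce]] := null_homog hc
  (IH jm' qjm' (rcocycle_sub (costar_skel_sub (leqnSn m)) (@subset_refl _ _) cc)).
have [l lE] := star_seq m; have [ll lm] := costar_skel_attachable lE.
have cc' : rcocycle (addc (costar_skel m) l) (costar_skel m) (fun k s => c k s - dl e s).
  rewrite lm; split=> k s ss; first by rewrite ce // subrr.
  by rewrite dlB dl_dl cc.2 // subrr.
have cz z : z \in l -> c (tag z) (ch z) - dl e (ch z) = 0.
  move=> /lE.2[_ zm]; have mq : (m != q).
    by apply/eqP => mq; move: qjm; rewrite -mq; case/orP; [rewrite ltnNge jm'|rewrite ltnn].
  by rewrite hc ?he ?subrr ?zm.
have [g g0 cg] := attachable_null ll cc' cz.
exists (fun k s => e k s + g k s) => k s ss.
  by rewrite e0 // g0 ?addr0 //; apply: sin_sub ss; exact: costar_skel_sub.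
by rewrite dlD -cg ?lm // addrC subrK.
Qed.

(** Every closed coface of y contains p, so each of them, once punctured at p, is attached without
    changing the cohomology. *)
Lemma acyclic_star p : open_cell y p -> acyclic K M (~` [set p]) (costar y).
Proof.
move=> yp; have [n nT] := costar_skel_full.
have -> : ~` [set p] = costar_skel n `\ p by rewrite nT // setTD.
have B0 : costar y = costar_skel 0 `\ p.
  rewrite costar_skel0 eqEsubset; split=> q; [split=> // qp|by case].
  by move: H; rewrite qp => /(costarE _ yp); apply; exact: face_refl.
rewrite B0; elim: n {nT} => [|n IH].
  move=> c [c0 _]; exact: null_vanish.
apply: acyclic_trans IH _.
- by move=> q [qB qp]; split=> //; exact: costar_skel_sub qB.
- by move=> q [qB qp]; split=> //; exact: costar_skel_sub qB.
have [l lE] := star_seq n; have [ll <-] := costar_skel_attachable lE.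
apply: attachable_puncture => // z /lE.2[/faceE zy _]; exact: zy.
Qed.

End Coef2.
End Star.
End CellularFiltration.

(** * Degrees of attaching maps and the cellular coboundary *)

Section QuotientModule.

Lemma quotient_module (V : zmodType) (N : set V) : N 0 ->
  (forall u v, N u -> N v -> N (u - v)) ->
  exists (M : zmodType) (pi : V -> M),
    (forall u v, pi (u - v) = pi u - pi v) /\ forall v, pi v = 0 <-> N v.
Proof.
move=> N0 NB; pose S : {pred V} := fun v => `[< N v >].
have Sclosed : zmod_closed S.
  split; first by apply/asboolP.
  by move=> u v /asboolP Nu /asboolP Nv; apply/asboolP; exact: NB.
pose Sz := GRing.isZmodClosed.Build V S Sclosed.
pose SS : zmodClosed V := HB.pack S Sz.
exists (Quotient.quot SS), (\pi_(Quotient.quot SS))%qT; split=> [u v|v].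
  exact: (raddfB (\pi_(Quotient.quot SS))%qT).
rewrite -(raddf0 (\pi_(Quotient.quot SS))%qT); split.
  by move/eqP; rewrite -Quotient.idealrBE subr0 => /asboolP.
by move=> Nv; apply/eqP; rewrite -Quotient.idealrBE subr0; apply/asboolP.
Qed.

End QuotientModule.

Lemma existT_inj (I : eqType) (C : I -> Type) (i : I) (x y : C i) :
  existT C i x = existT C i y -> x = y.
Proof. by move=> E; have := projT2_eq E; rewrite (eq_axiomK (projT1_eq E)). Qed.

Section Degree.
Variables (K : realType) (T : topologicalType) (X : regular_CW K T).
Local Notation Dl := (stdsimplex K).
Local Notation cell := (cells X).
Implicit Types (A B : set T) (x y : cell).

Definition pack_simplex k (s : Dl k -> T) (cs : continuous s) : singular K T k :=
  HB.pack s (@isContinuous.Build _ _ s cs).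

Lemma pack_simplexK k (s : singular K T k) (cs : continuous s) : pack_simplex cs = s.
Proof.
by case: s cs => f [[cf]] cs; rewrite /pack_simplex /= (Prop_irrelevance cs cf).
Qed.

Section Total.
Variable M : zmodType.

(** The passage from functions on singular simplices to cochains, which take values on all maps: 0
    in other degrees and on discontinuous maps. *)
Definition total k (a : singular K T k -> M) : cochain K M T := fun j s =>
  if pselect (j = k) is left e then
    if pselect (continuous (eq_rect j (fun n => Dl n -> T) s k e)) is left cs
    then a (pack_simplex cs) else 0
  else 0.

Lemma totalE k (a : singular K T k -> M) (s : singular K T k) : total a s = a s.
Proof.
rewrite /total; case: pselect => // e; rewrite (eq_axiomK e) /=.
by case: pselect => [cs|[]]; [rewrite pack_simplexK|exact: cts_fun].
Qed.

Lemma homog_total k (a : singular K T k -> M) : homog k (total a).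
Proof. by move=> j s jk; rewrite /total; case: pselect => // e; rewrite e eqxx in jk. Qed.

Lemma homog_vanish A k (c : cochain K M T) : homog k c ->
  (forall s : singular K T k, range s `<=` A -> c k s = 0) -> vanish A c.
Proof.
move=> hc c0 j s [cs sA]; have [jk|jk] := eqVneq j k; last exact: hc.
by move: s cs sA; rewrite jk => s cs sA; exact: (c0 (pack_simplex cs)).
Qed.

End Total.

Lemma sin_singular A k (s : singular K T k) : range s `<=` A -> sin A s.
Proof. by move=> sA; split=> //; exact: cts_fun. Qed.

Lemma skel_butE (z : cell) : skeleton X (tag z) = skel_but (tag z) z `|` cl z.
Proof.
rewrite eqEsubset; split=> p.
  move=> [c cd cp]; have [cz|cz] := pselect (c = z).
    by right; rewrite -cz; exact: open_cell_cl.
  by left; exists c.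
move=> [[c [cd _] cp]|zp]; first by exists c.
by have [c cp] := cell_of X p; exists c => //; have [] := cl_tag cp zp.
Qed.

Lemma skel_butP (z : cell) : skel_but (tag z) z = skeleton X (tag z) `\` open_cell z.
Proof.
rewrite eqEsubset; split=> p.
  move=> [c [cd cz] cp]; split; first by exists c.
  by move=> zp; apply: cz; exact: open_cell_uniq cp zp.
move=> [[c cd cp] nz]; exists c => //; split=> // cz; by rewrite cz in cp.
Qed.

Lemma attach_cell (z : cell) : [/\ closed (skel_but (tag z) z),
  forall u, bd u -> skel_but (tag z) z (ch z u) &
  forall u, skel_but (tag z) z (ch z u) -> bd u].
Proof.
split; first exact: skel_but_closed.
  move=> u ub; have [c ct cu] := cl_boundary ub; exists c => //; split; first exact: ltnW.
  by move=> cz; rewrite cz ltnn in ct.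
move=> u [c [cd cz] cu]; apply: contrapT => /open_cell_ch zu.
by apply: cz; exact: open_cell_uniq cu zu.
Qed.

Lemma skel_attachable d (l : seq cell) : uniq l -> (forall z, z \in l -> tag z = d) ->
  attachable (cellset [set c | (tag c <= d)%N /\ c \notin l]) l /\
  addc (cellset [set c | (tag c <= d)%N /\ c \notin l]) l = skeleton X d.
Proof.
move=> ul ld; split.
  split=> //.
  - apply: cellset_closed => c /= [cd cl_] p cp; have [y yp] := cell_of X p.
    have [yc yc'] := cl_tag yp cp; exists y => //=; split; first exact: leq_trans cd.
    have [->//|/yc' ycd] := pselect (y = c); apply/negP => /ld yd.
    by move: (leq_trans ycd cd); rewrite yd ltnn.
  - move=> z /ld zd p zp; have [y yp] := cell_of X p; have yz := sph_tag yp zp.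
    exists y => //; split; first by rewrite -zd ltnW.
    by apply/negP => /ld yd; move: yz; rewrite yd zd ltnn.
  - move=> z p zl zp [c [_ cl_] cp]; move: cl_; rewrite -(open_cell_uniq zp cp).
    by rewrite zl.
rewrite eqEsubset; split=> p.
  by move=> [[c [cd _] cp]|[c /= /ld cd cp]]; exists c => //=; rewrite ?cd.
move=> [c cd cp]; case: (boolP (c \in l)) => cl_; first by right; exists c.
by left; exists c.
Qed.

Lemma sin_chi_face d (w : Defs.cell X d.+1) i :
  sin (sph (existT _ d.+1 w)) (chi w \o coface i).
Proof.
split=> [u|_ [u _ <-]].
  apply: continuous_comp; first exact: coface_continuous.
  exact: (@ch_continuous _ _ _ (existT _ d.+1 w)).
by exists (coface i u) => //; exists i; rewrite bc_coface unlift_none.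
Qed.

Lemma sph_skel x d : tag x = d.+1 -> sph x `<=` skeleton X d.
Proof.
move=> xd p xp; have [c cp] := cell_of X p; exists c => //=.
by rewrite -ltnS -xd; exact: sph_tag cp xp.
Qed.

(** The faces of [chi w] lie in the d-skeleton, where c agrees with [dl e]. *)
Lemma null_chi (M : zmodType) d A (c : cochain K M T) (w : Defs.cell X d.+1) :
  null (skeleton X d) A c -> dl c (chi w) = 0.
Proof.
move=> [e _ ce]; rewrite -[RHS](dl_dl e (chi w)) !dlS.
apply: eq_bigr => i _; rewrite ce //; apply: sin_sub (sin_chi_face w i).
exact: sph_skel.
Qed.

Section Coefficients.
Variable R : comNzRingType.

Lemma sdifE k (s : singular K T k.+1) (c : cochain K R T) :
  sdif (fun s : singular K T k => c k s) s = dl c s.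
Proof.
rewrite dlS; apply: eq_bigr => i _.
by rewrite -mulrzr rmorphXn rmorphN1 mulrC.
Qed.

Lemma dl_suml (I : Type) (r : seq I) (m : I -> R) (g : I -> cochain K R T) k (s : Dl k -> T) :
  dl (fun k s => \sum_(i <- r) m i * g i k s) s = \sum_(i <- r) m i * dl (g i) s.
Proof.
case: k s => [|k] s; first by rewrite /= big1 // => i _; rewrite mulr0.
rewrite dlS; under eq_bigr do rewrite mulrz_suml.
rewrite exchange_big; apply: eq_bigr => i _; rewrite dlS mulr_sumr.
by apply: eq_bigr => j _; rewrite mulrzAr.
Qed.

Lemma dual_cochain d (z : Defs.cell X d) : exists2 phi : cochain K R T,
  rcocycle (skeleton X d) (skel_but d (existT _ d z)) phi & phi d (chi z) = 1.
Proof.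
pose Z : cell := existT _ d z; have [cA zb zi] := attach_cell Z.
have [phi pc p1] := attach_cocycle cA (@closed1T _ _ X) (ch_embedding Z) zi (1 : R) (@simplex_cocycleP K R d).
by exists phi => //; rewrite (skel_butE Z).
Qed.

(** Evaluating the chain identity on a cocycle dual to z kills both sums. *)
Lemma degree_uniq d (w : Defs.cell X d.+1) (z : Defs.cell X d) (r : R) phi :
  is_degree w z r -> rcocycle (skeleton X d) (skel_but d (existT _ d z)) phi ->
  phi d (chi z) = 1 -> r = dl phi (chi w).
Proof.
move=> [b [e [bS eS wE]]] [phi0 phi_dl] phi1.
have := wE (fun s => phi d s); rewrite sdifE phi1 mulr1 => ->.
rewrite [X in _ = _ + X + _]big1_seq => [|p /andP[_ /bS pS]]; last first.
  by rewrite sdifE phi_dl ?mulr0 //; exact: sin_singular.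
rewrite big1_seq ?addr0 // => p /andP[_ /eS pS].
rewrite phi0 ?mulr0 //; apply: sin_singular.
by rewrite -(skel_butP (existT _ d z)) in pS.
Qed.

Section Existence.
Variables (d : nat) (w : Defs.cell X d.+1) (z : Defs.cell X d).
Let Z : cell := existT _ d z.
Let V : zmodType := (singular K T d -> R) -> R.

Definition degree_expression (r : R) (b : seq (R * singular K T d.+1))
    (e : seq (R * singular K T d)) (g : V) : Prop :=
  [/\ forall p, p \in b -> range p.2 `<=` skeleton X d,
      forall p, p \in e -> range p.2 `<=` skel_but d Z
    & forall c, g c = r * c (chi z) + \sum_(p <- b) p.1 * sdif c p.2
                      + \sum_(p <- e) p.1 * c p.2].

Definition degree_expressible : set V :=
  [set g | exists r b e, degree_expression r b e g].

Lemma degree_expressible0 : degree_expressible 0.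
Proof. by exists 0, [::], [::]; split=> // c; rewrite !big_nil mul0r !addr0. Qed.

Lemma degree_expressibleB u v : degree_expressible u -> degree_expressible v ->
  degree_expressible (u - v).
Proof.
move=> [r [b [e [bS eS uE]]]] [r' [b' [e' [b'S e'S vE]]]].
exists (r - r'), (b ++ [seq (- p.1, p.2) | p <- b']), (e ++ [seq (- p.1, p.2) | p <- e']).
split=> [p|p|c].
- by rewrite mem_cat => /orP[/bS//|/mapP[q /b'S qS ->]].
- by rewrite mem_cat => /orP[/eS//|/mapP[q /e'S qS ->]].
have NE (J : Type) (s : seq (R * J)) (f : J -> R) :
    \sum_(p <- s) - p.1 * f p.2 = - \sum_(p <- s) p.1 * f p.2.
  by rewrite -sumrN; apply: eq_bigr => p _; rewrite mulNr.
rewrite (_ : (u - v) c = u c - v c) // uE vE !big_cat !big_map /= mulrBl.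
by rewrite (NE _ b' (sdif c)) (NE _ e' c); ring.
Qed.

(** That tau is a relative cocycle with value 0 on [chi z] amounts to three instances of
    expressibility. By [attach_null] it is then null, and [dl tau (chi w) = 0] says that the
    boundary of [chi w] is expressible. *)
Lemma degree_exists : exists r : R, is_degree w z r.
Proof.
have [M [pi [piB pi0]]] := quotient_module degree_expressible0 degree_expressibleB.
have pi00 : pi 0 = 0 by apply/pi0; exact: degree_expressible0.
have piN u : pi (- u) = - pi u by rewrite -sub0r piB pi00 sub0r.
have piD u v : pi (u + v) = pi u + pi v by rewrite -[v in LHS]opprK piB piN opprK.
have piS n (s : V) : pi (s *~ (-1) ^+ n) = pi s *~ (-1) ^+ n.
  by rewrite -signr_odd; case: (odd n); rewrite ?expr1 ?expr0 ?mulrNz ?mulr1z ?piN.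
pose tau : cochain K M T := total (fun s : singular K T d => pi (fun c => c s)).
have piX (I : Type) (r : seq I) (h : I -> V) : pi (\sum_(i <- r) h i) = \sum_(i <- r) pi (h i).
  by elim/big_rec2: _ => // i a b _ <-; rewrite piD.
have tauE (s : singular K T d) : tau d s = pi (fun c => c s) := totalE _ s.
have tau_dl (s : singular K T d.+1) : dl tau s = pi (fun c => sdif c s).
  rewrite dlS; transitivity (\sum_(i < d.+2) pi ((fun c => c (sface i s)) *~ (-1) ^+ i)).
    by apply: eq_bigr => i _; rewrite piS -(tauE (sface i s)).
  rewrite -piX; congr pi; apply/funext => c; rewrite fct_sumE.
  apply: eq_bigr => i _; rewrite -signr_odd -[in RHS]signr_odd.
  by case: (odd i); rewrite ?expr1 ?expr0 ?mulrN1z ?mulr1z ?mulN1r ?mul1r.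
have htau : homog d tau by exact: homog_total.
have tc : rcocycle (skeleton X d) (skel_but d Z) tau.
  split.
    apply: homog_vanish htau _ => s sA; rewrite tauE; apply/pi0.
    exists 0, [::], [:: (1, s)]; split=> // [p|c]; first by rewrite inE => /eqP ->.
    by rewrite big_nil big_seq1 mul0r !add0r mul1r.
  apply: homog_vanish (homog_dl htau) _ => s sA; rewrite tau_dl; apply/pi0.
  exists 0, [:: (1, s)], [::]; split=> // [p|c]; first by rewrite inE => /eqP ->.
  by rewrite big_nil big_seq1 mul0r add0r mul1r addr0.
have tz : tau d (chi z) = 0.
  rewrite tauE; apply/pi0; exists 1, [::], [::]; split=> // c.
  by rewrite !big_nil !addr0 mul1r.
have [cA zb zi] := attach_cell Z.
have tn : null (skeleton X d) (skel_but d Z) tau.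
  rewrite (skel_butE Z).
  apply: (attach_null cA (@closed1T _ _ X) (@cl_closed _ _ _ Z) (ch_embedding Z) zb zi) => //.
    exact: simplex_nullP.
  by rewrite -(skel_butE Z).
have := null_chi w tn; rewrite tau_dl => /pi0[r [b [e [bS eS wE]]]].
exists r, b, e; split=> // p /eS; by rewrite (skel_butP Z).
Qed.
End Existence.

Lemma incidenceE d (w : Defs.cell X d.+1) (z : Defs.cell X d) phi :
  rcocycle (skeleton X d) (skel_but d (existT _ d z)) phi ->
  phi d (chi z) = 1 -> incidence R w z = dl phi (chi w).
Proof.
move=> phic phi1; rewrite /incidence; case: xgetP => [r _ /degree_uniq/(_ phic phi1)//|nr].
by have [r /nr] := degree_exists w z.
Qed.

Lemma incidence_eq0 d (w : Defs.cell X d.+1) (z : Defs.cell X d) :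
  ~ face (existT _ d.+1 w) (existT _ d z) -> incidence R w z = 0.
Proof.
move=> nwz; have [phi phic phi1] := dual_cochain z.
rewrite (incidenceE w phic phi1) dlS big1 // => i _.
rewrite phic.1 ?mul0rz //; apply: sin_sub (sin_chi_face w i) => p wp.
rewrite (skel_butP (existT _ d z)); split; first exact: sph_skel wp.
by move=> zp; apply: nwz; exact: face_cl zp (sph_cl wp).
Qed.

(* On the pair (X^d, X^d - the d-cells of l) the cochain e is cohomologous to the
   combination of the cochains dual to these cells. *)
Lemma dl_cellular d A (l : seq (Defs.cell X d)) (e : cochain K R T)
    (w : Defs.cell X d.+1) : uniq l ->
  (forall c, (tag c <= d)%N -> (forall z : Defs.cell X d, z \in l -> c <> existT _ d z) ->
     open_cell c `<=` A) ->
  vanish A e -> vanish (skeleton X d) (dl e) ->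
  dl e (chi w) = \sum_(z <- l) incidence R w z * e d (chi z).
Proof.
move=> ul lA e0 e1.
pose l' : seq cell := [seq existT (Defs.cell X) d z | z : Defs.cell X d <- l].
have ul' : uniq l' by rewrite map_inj_uniq //; exact: existT_inj.
have ld (z : cell) : z \in l' -> tag z = d by move=> /mapP[c _ ->].
have [al le] := skel_attachable ul' ld; set A' := cellset _ in al le.
have A'A : A' `<=` A.
  move=> p [c [cd cl'] cp]; apply: lA cp => // z zl cz.
  by move: cl'; rewrite cz map_f.
have /choice[phi phiP] : forall z : Defs.cell X d, exists phi : cochain K R T,
    rcocycle (skeleton X d) (skel_but d (existT _ d z)) phi /\ phi d (chi z) = 1.
  by move=> z; have [phi] := dual_cochain z; exists phi.
pose g : cochain K R T := fun k s => e k s - \sum_(z <- l) e d (chi z) * phi z k s.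
have dlg k (s : Dl k -> T) : dl g s = dl e s - \sum_(z <- l) e d (chi z) * dl (phi z) s.
  by rewrite dlB dl_suml.
have gn : null (skeleton X d) A' g.
  rewrite -le; apply: attachable_null al _ _; first split=> k s ss.
  - rewrite /g e0 ?big1_seq ?subr0 //; last exact: sin_sub ss.
    move=> z /andP[_ zl]; rewrite (phiP z).1.1 ?mulr0 //; apply: sin_sub ss => p [c [cd cl'] cp].
    by exists c => //; split=> // cz; move: cl'; rewrite cz map_f.
  - rewrite le in ss; rewrite dlg e1 // big1 ?subr0 // => z _.
    by rewrite (phiP z).1.2 ?mulr0.
  move=> z /mapP[c cl' ->] /=; rewrite /g (big_rem c) //= (phiP c).2 mulr1.
  rewrite big1_seq ?addr0 ?subrr // => x /andP[_ xl]; rewrite (phiP x).1.1 ?mulr0 //.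
  split=> [|_ [u _ <-]]; first exact: (@ch_continuous _ _ _ (existT _ d c)).
  have [y yp] := cell_of X (chi c u); exists y => //=.
  have [yd yd'] : (tag y <= d)%N /\ (y <> existT _ d c -> (tag y < d)%N).
    by apply: (@cl_tag _ _ _ (existT _ d c) y _ yp); exists u.
  split=> // yx; have [yc|/yd'] := pselect (y = existT _ d c); last by rewrite yx /= ltnn.
  move: xl; rewrite mem_rem_uniq // inE => /andP[/eqP xc _]; apply: xc.
  by apply: (@existT_inj nat (Defs.cell X) d); rewrite -yx yc.
have := null_chi w gn; rewrite dlg => /eqP; rewrite subr_eq0 => /eqP ->.
by apply: eq_bigr => z _; rewrite mulrC (incidenceE w (phiP z).1 (phiP z).2).
Qed.

End Coefficients.
End Degree.

Section AttachableCocycles.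
Variables (K : realType) (T : topologicalType) (X : regular_CW K T).
Local Notation Dl := (stdsimplex K).
Local Notation cell := (cells X).
Implicit Types (A B : set T) (x y z : cell) (l : seq cell).

Lemma addc_closed A l : attachable A l -> closed (addc A l).
Proof.
elim: l A => [|z l IH] A Al; first by rewrite addc_nil; case: Al.
have [_ zA _ Azl] := attachable_cons Al; rewrite addc_cons; first exact: IH.
by move=> _ [u ub <-]; exact: zA.
Qed.

Lemma attachable_rem A l z : attachable A l -> attachable A (rem z l).
Proof.
move=> [cA ul sA oA]; split=> //; first exact: rem_uniq.
  by move=> w /mem_rem; exact: sA.
by move=> w p /mem_rem; exact: oA.
Qed.

(** A combination of cocycles dual to the cells: any cell z may be regarded as attached last, and
    its cocycle then vanishes on all the others. *)
Lemma attachable_cocycle (R : comNzRingType) A l (m : cell -> R) : attachable A l ->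
  exists2 g : cochain K R T, rcocycle (addc A l) A g &
    forall z, z \in l -> g (tag z) (ch z) = m z.
Proof.
move=> Al; have [cA ul sA oA] := Al.
have /choice[g gP] : forall z, exists g : cochain K R T, z \in l ->
    rcocycle (addc A l) (addc A (rem z l)) g /\ g (tag z) (ch z) = 1.
  move=> z; case: (boolP (z \in l)) => [zl|_]; last by exists (fun _ _ => 0).
  have zs u : bd u -> addc A (rem z l) (ch z u).
    by move=> ub; left; apply: (sA z zl); exists u.
  have zo u : addc A (rem z l) (ch z u) -> bd u.
    move=> zu; apply: contrapT => /open_cell_ch uz; case: zu.
      exact: oA zl uz.
    move=> [c /=]; rewrite mem_rem_uniq // inE => /andP[/eqP cz _] cu.
    by apply: cz; exact: open_cell_uniq cu uz.
  have AA : addc A l = addc A (rem z l) `|` cl z.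
    rewrite eqEsubset; split=> p.
      move=> [Ap|[c cl_ cp]]; first by left; left.
      have [cz|/eqP cz] := pselect (c = z).
        by right; rewrite -cz; exact: open_cell_cl.
      by left; right; exists c; rewrite //= mem_rem_uniq // inE cz.
    move=> [[Ap|[c /mem_rem cl_ cp]]|zp]; [by left|by right; exists c|].
    have [op|/(cl_sph zp)/(sA z zl)] := pselect (open_cell z p); last by left.
    by right; exists z.
  have [g gc g1] := attach_cocycle (addc_closed (attachable_rem z Al)) (@closed1T _ _ X)
    (ch_embedding z) zo (1 : R) (@simplex_cocycleP K R _).
  by exists g => _; rewrite AA.
exists (fun k s => \sum_(z <- l) m z * g z k s).
  split=> k s ss.
    rewrite big1_seq // => z /andP[_ zl]; have [[g0 _] _] := gP z zl.
    by rewrite g0 ?mulr0 //; apply: sin_sub ss; exact: subsetUl.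
  rewrite dl_suml big1_seq // => z /andP[_ zl]; have [[_ g0] _] := gP z zl.
  by rewrite g0 ?mulr0.
move=> z zl; rewrite (big_rem z) //= (gP z zl).2 mulr1 big1_seq ?addr0 //.
move=> x /andP[_ xl]; have := mem_rem xl => xl'; have [[g0 _] _] := gP x xl'.
rewrite g0 ?mulr0 //; split=> [|_ [u _ <-]]; first exact: ch_continuous.
have [ub|/open_cell_ch uz] := pselect (bd u).
  by left; apply: (sA z zl); exists u.
right; exists z => //=; rewrite mem_rem_uniq // inE zl andbT.
by apply/eqP => zx; move: xl; rewrite -zx mem_rem_uniq // inE eqxx.
Qed.

End AttachableCocycles.

(** * Local cochains as values of singular cochains on cells *)

Section CellularCohomology.
Variables (K : realType) (R : comNzRingType) (T : topologicalType).
Variable X : regular_CW K T.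
Local Notation Dl := (stdsimplex K).
Local Notation cell := (cells X).
Local Notation at_ := (existT (Defs.cell X)).
Implicit Types x y : cell.
Hypothesis lc : locally_compact [set: T].
Hypothesis fin_dim : finite_dimensional X.

Section OneCell.
Variable y : cell.

Lemma coface_seq k : exists l : seq (Defs.cell X k),
  [/\ uniq l, forall z, z \in l <-> face (at_ k z) y,
      attachable (costar_skel y k) [seq at_ k z | z <- l] &
      addc (costar_skel y k) [seq at_ k z | z <- l] = costar_skel y k.+1].
Proof.
have fs : finite_set [set z : Defs.cell X k | face (at_ k z) y].
  rewrite (_ : [set z | _] = at_ k @^-1` [set c : cell | face c y]) //.
  apply: finite_preimage; last exact: face_finite.
  by move=> z z' _ _; exact: existT_inj.
have /finite_seqP[s sE] := fs; exists (undup s).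
have sP z : z \in undup s <-> face (at_ k z) y.
  by rewrite mem_undup -[face _ _]/([set z : Defs.cell X k | face (at_ k z) y] z) sE.
have [al le] : attachable (costar_skel y k) [seq at_ k z | z <- undup s] /\
    addc (costar_skel y k) [seq at_ k z | z <- undup s] = costar_skel y k.+1.
  apply: costar_skel_attachable; split.
    by rewrite map_inj_uniq ?undup_uniq //; exact: existT_inj.
  move=> z; split=> [/mapP[c /sP cy ->]//|]; case: z => k' z [zy /= kk].
  by move: z zy; rewrite kk => z zy; apply: map_f; apply/sP.
by split=> //; exact: undup_uniq.
Qed.

Lemma skeleton_costar_skel k : skeleton X k `<=` costar_skel y k.+1.
Proof. by move=> p [c ck cp]; exists c => //; right. Qed.

Lemma vanish_coface A k (c : cochain K R T) z :
  costar y `<=` A -> vanish A c -> ~ face (at_ k z) y -> c k (chi z) = 0.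
Proof.
move=> yA c0 nz; apply: (c0 k (ch (at_ k z))).
split=> [|p zp]; first exact: (@ch_continuous _ _ _ (at_ k z)).
apply: yA; have [x xp] := cell_of X p; exists x => //= xy; apply: nz.
by apply: face_trans xy; exact: (face_cl (x := at_ k z) xp zp).
Qed.

Lemma costar_skel_costar k : costar y `<=` costar_skel y k.
Proof. by rewrite -costar_skel0; exact: costar_skel_sub. Qed.

Lemma sum_cofaces k (l : seq (Defs.cell X k)) (f : Defs.cell X k -> R) :
  uniq l -> (forall z, z \in l <-> face (at_ k z) y) ->
  \sum_(z \in [set z | face (at_ k z) y]) f z = \sum_(z <- l) f z.
Proof.
move=> ul lE; rewrite [RHS]fsbig_seq //; apply: eq_fsbigl.
by rewrite eqEsubset; split=> z /=; [move=> /lE|move=> ?; apply/lE].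
Qed.

(** This is [dl_cellular] for the k-dimensional cofaces of y: the other cells of dimension at most k
    lie in [costar_skel y k]. *)
Lemma dif_evaluate k (e : cochain K R T) (w : Defs.cell X k.+1) :
  vanish (costar_skel y k) e -> vanish (costar_skel y k.+1) (dl e) ->
  face (at_ k.+1 w) y ->
  dl e (chi w) = dif (c := local_cochains R y) (fun z => e k (chi z)) w.
Proof.
move=> e0 e1 wy; have [l [ul lE _ _]] := coface_seq k.
rewrite /= asboolT // (sum_cofaces _ ul lE).
apply: (dl_cellular w ul _ e0); last exact: vanish_sub (@skeleton_costar_skel k) e1.
move=> c cd cl p cp; exists c => //=; have [ck|kc] := ltnP (tag c) k; first by right.
left=> cy; have ck : tag c = k by apply/eqP; rewrite eqn_leq cd.
move: cy cl {cp kc cd}; case: c ck => k' c /= kk; move: c; rewrite kk => c cy.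
by move=> /(_ c); apply => //; apply/lE.
Qed.

Lemma evaluate_cochain k (c : cochain K R T) : vanish (costar y) c ->
  @cochains _ (local_cochains R y) k (fun z => c k (chi z)).
Proof.
move=> c0; have h z : c k (chi z) != 0 -> face (at_ k z) y.
  move=> /eqP cz; apply: contrapT => nz; apply: cz.
  exact: vanish_coface c0 nz.
split=> //; have [l [_ lE _ _]] := coface_seq k.
by apply: sub_finite_set (finite_seq l) => z /= /h /lE.
Qed.

Lemma evaluate_cocycle k (c : cochain K R T) : rcocycle setT (costar_skel y k) c ->
  @cocycle _ (local_cochains R y) k (fun z => c k (chi z)).
Proof.
move=> [c0 c1]; split; first exact: evaluate_cochain (vanish_sub (@costar_skel_costar k) c0).
apply/funext => w; have [wy|nwy] := pselect (face (at_ k.+1 w) y).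
  rewrite -dif_evaluate //; last exact: vanish_sub c1.
  by apply: c1; apply: sin_singular.
by rewrite /= asboolF.
Qed.

Lemma realize_cochain k (a : Defs.cell X k -> R) :
  @cochains _ (local_cochains R y) k a ->
  exists c : cochain K R T, [/\ homog k c, rcocycle (costar_skel y k.+1) (costar_skel y k) c &
    forall z, c k (chi z) = a z].
Proof.
move=> [_ ya]; have [l [ul lE al le]] := coface_seq k.
pose m (x : cell) : R := if pselect (tag x = k) is left e
  then a (eq_rect _ (fun k => Defs.cell X k : Type) (tagged x) k e) else 0.
have mE z : m (at_ k z) = a z.
  by rewrite /m; case: pselect => // e; rewrite (eq_axiomK e).
have [g gc gm] := attachable_cocycle m al; rewrite le in gc.
exists (hpart k g); split=> [||z]; first exact: homog_hpart.
  split=> j s ss; first by rewrite /hpart gc.1 // if_same.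
  by rewrite dl_hpart /hpart gc.2 // if_same.
rewrite /hpart eqxx; have [zy|nzy] := pselect (face (at_ k z) y).
  by rewrite -mE; apply: (gm (at_ k z)); rewrite map_f //; apply/lE.
rewrite (vanish_coface (@costar_skel_costar k) gc.1 nzy); apply/esym/eqP.
by apply: contrapT => /negP/ya.
Qed.

(** The k-cells give no obstruction because c is 0 on them, and the cells of higher dimension have
    no relative cohomology in degree k. *)
Lemma null_evaluate0 k (c : cochain K R T) : homog k c -> rcocycle setT (costar_skel y k) c ->
  (forall z, face (at_ k z) y -> c k (chi z) = 0) -> null setT (costar_skel y k) c.
Proof.
move=> hc cc cz; have [l [ul lE al le]] := coface_seq k.
have n1 : null (costar_skel y k.+1) (costar_skel y k) c.
  rewrite -le; apply: attachable_null al _ _; first exact: rcocycle_sub cc.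
  by move=> z /mapP[z' /lE z'y ->]; exact: cz.
have [e [_ he e0 ce]] := null_homog hc n1.
have [n nT] := costar_skel_full y fin_dim.
have c2 : rcocycle setT (costar_skel y k.+1) (fun k s => c k s - dl e s).
  split=> j s ss; first by rewrite ce // subrr.
  by rewrite dlB dl_dl cc.2 // subrr.
have n2 : null (costar_skel y (maxn n k.+1)) (costar_skel y k.+1) (fun k s => c k s - dl e s).
  apply: (costar_skel_null lc (q := k)) => //.
  - by move=> j s jk; rewrite hc // he // subrr.
  - exact: leq_maxr.
  - by rewrite ltnS leqnn.
  - exact: rcocycle_sub c2.
rewrite nT ?leq_maxl // in n2; have [g g0 cg] := n2.
exists (fun k s => e k s + g k s) => j s ss.
  by rewrite e0 // g0 ?addr0 //; apply: sin_sub ss; exact: costar_skel_sub.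
by rewrite dlD -cg // addrC subrK.
Qed.

(** Forward, a primitive is first corrected to vanish on the previous stage of the filtration, so
    that its values on cells have the right differential. Backward, a cellular primitive is realized
    by a cochain, and [null_evaluate0] treats the difference. *)
Lemma null_evaluate k (c : cochain K R T) : homog k c -> rcocycle setT (costar_skel y k) c ->
  null setT (costar y) c <->
  @coboundary _ (local_cochains R y) k (fun z => c k (chi z)).
Proof.
case: k => [|k] hc cc.
  split=> [[e e0 ce]|cz].
    by apply/funext => z; rewrite /= ce //; apply: sin_singular.
  rewrite -costar_skel0; apply: null_evaluate0 hc cc _ => z _; exact: (congr1 (fun f => f z) cz).
split=> [/(null_homog hc)[e [/= he _ e0 ce]]|[b yb bE]].
  have [f f0 ef] : null (costar_skel y k) (costar_skel y 0) e.
    apply: (costar_skel_null lc (q := k)) => //; first by rewrite leqnn orbT.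
    split; first by rewrite costar_skel0.
    move=> j s ss; rewrite -ce; last by case: ss.
    by rewrite cc.1 //; apply: sin_sub ss; exact: costar_skel_sub.
  pose g : cochain K R T := fun j s => e j s - dl f s.
  have g0 : vanish (costar_skel y k) g by move=> j s ss; rewrite /g ef // subrr.
  have g1 j (s : Dl j -> T) : sin setT s -> c j s = dl g s.
    by move=> ss; rewrite dlB dl_dl subr0 ce.
  have g2 : vanish (costar_skel y k.+1) (dl g).
    by move=> j s ss; rewrite -g1 ?cc.1 //; case: ss.
  exists (fun z => g k (chi z)); first exact: evaluate_cochain (vanish_sub (@costar_skel_costar k) g0).
  apply/funext => w; have [wy|nwy] := pselect (face (at_ k.+1 w) y).
    by rewrite -[LHS](dif_evaluate g0 g2 wy) g1 //; apply: sin_singular.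
  by rewrite /= asboolF // (vanish_coface (@costar_skel_costar k.+1) cc.1).
have [g [hg gc gb]] := realize_cochain yb.
have [|||e e0 ce] := @null_evaluate0 k.+1 (fun j s => c j s - dl g s).
- exact: homogB hc (homog_dl hg).
- split=> j s ss; first by rewrite cc.1 // gc.2 // subrr.
  by rewrite dlB dl_dl cc.2 // subrr.
- move=> w wy; rewrite dif_evaluate //; [|exact: gc.1|exact: gc.2].
  rewrite (_ : (fun z => _) = b); last by apply/funext => z; rewrite gb.
  by rewrite bE subrr.
exists (fun j s => g j s + e j s) => j s ss.
  rewrite e0 ?gc.1 ?addr0 //; apply: sin_sub ss; exact: costar_skel_costar.
by rewrite dlD -ce // addrC subrK.
Qed.

(** The obstruction [dl g] is 0 on the (k+1)-dimensional cofaces, hence is the coboundary of a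
    cochain that vanishes on [costar_skel y k.+1]; subtracting the latter keeps the values on
    k-cells. *)
Lemma realize_cocycle k (a : Defs.cell X k -> R) :
  @cocycle _ (local_cochains R y) k a ->
  exists c : cochain K R T, [/\ homog k c, rcocycle setT (costar_skel y k) c &
    forall z, c k (chi z) = a z].
Proof.
move=> [ya da]; have [g [hg [g0 g1] gE]] := realize_cochain ya.
have gw w : face (at_ k.+1 w) y -> dl g (chi w) = 0.
  move=> wy; rewrite dif_evaluate //.
  rewrite (_ : (fun z => _) = a); last by apply/funext => z; rewrite gE.
  exact: (congr1 (fun f => f w) da).
have [h h0 gh] := null_evaluate0 (homog_dl hg) (conj g1 (fun j s _ => dl_dl g s)) gw.
exists (hpart k (fun j s => g j s - h j s)); split=> [||z]; first exact: homog_hpart.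
  split=> j s ss; rewrite ?dl_hpart /hpart; case: eqP => // _.
    by rewrite g0 // h0 ?subrr //; apply: sin_sub ss; exact: costar_skel_sub.
  by rewrite dlB gh // subrr.
rewrite /hpart eqxx gE (h0 k (ch (at_ k z))) ?subr0 //.
split=> [|p zp]; first exact: (@ch_continuous _ _ _ (at_ k z)).
have [x xp] := cell_of X p; exists x => //; right; rewrite ltnS.
by have [] := cl_tag xp (zp : cl (at_ k z) p).
Qed.

Lemma cocycle_costar_skel k (c : cochain K R T) : homog k c -> rcocycle setT (costar y) c ->
  exists2 c', homog k c' & rcocycle setT (costar_skel y k) c' /\
    null setT (costar y) (fun k s => c k s - c' k s).
Proof.
move=> hc cc; have n0 : null (costar_skel y k) (costar_skel y 0) c.
  apply: (costar_skel_null lc (q := k)) => //; first by rewrite leqnn orbT.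
  by apply: rcocycle_sub cc; rewrite ?costar_skel0.
have [e [_ he e0 ce]] := null_homog hc n0; rewrite costar_skel0 in e0.
exists (fun j s => c j s - dl e s); first exact: homogB.
split; first split=> j s ss; first by rewrite ce // subrr.
  by rewrite dlB dl_dl cc.2 // subrr.
by exists e => // j s _; rewrite opprB addrC subrK.
Qed.

End OneCell.

Lemma cochains_face x y k (a : Defs.cell X k -> R) : face x y ->
  @cochains _ (local_cochains R x) k a -> @cochains _ (local_cochains R y) k a.
Proof.
move=> xy [fa ax]; split=> // z /ax zx; exact: face_trans zx xy.
Qed.

(** If w is a coface of y but not of x, no coface of x is a face of w, so w has incidence 0 with the
    support of a. *)
Lemma local_incl_map x y : face x y ->
  @is_cochain_map R (local_cochains R x) (local_cochains R y) (local_incl x y).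
Proof.
move=> xy; split=> // [k a|k a ax]; first exact: cochains_face.
apply/funext => w; rewrite /local_incl /=.
have [lx [ulx lxE _ _]] := coface_seq x k; have [ly [uly lyE _ _]] := coface_seq y k.
rewrite (sum_cofaces _ ulx lxE) (sum_cofaces _ uly lyE).
have [wx|nwx] := pselect (face (at_ k.+1 w) x).
  rewrite !asboolT //; last exact: face_trans wx xy.
  rewrite [RHS](bigID (mem lx)) /= [X in _ = _ + X]big1_seq ?addr0; last first.
    move=> z /andP[zx _]; rewrite [a z](_ : _ = 0) ?mulr0 //; apply/eqP; apply: contrapT => /negP.
    by move/ax.2/lxE; exact/negP.
  rewrite -[RHS]big_filter; apply: perm_big; apply: uniq_perm => //; first exact: filter_uniq.
  move=> z; rewrite mem_filter; apply/idP/andP => [zx|[]//]; split=> //.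
  by apply/lyE; apply: face_trans xy; apply/lxE.
rewrite asboolF //; case: asboolP => // wy; rewrite big1 // => z _.
have [az|az] := eqVneq (a z) 0; first by rewrite az mulr0.
rewrite incidence_eq0 ?mul0r // => wz; apply: nwx; apply: face_trans wz _.
exact: ax.2 z az.
Qed.

Lemma costar_face x y : face x y -> costar y `<=` costar x.
Proof. by move=> xy p [c nc cp]; exists c => // cx; apply: nc; exact: face_trans cx xy. Qed.

Lemma costar_skel_face x y k : face x y -> costar_skel y k `<=` costar_skel x k.
Proof.
move=> xy p [c nc cp]; exists c => //; case: nc => [nc|]; [left=> cx|by right].
by apply: nc; exact: face_trans cx xy.
Qed.

Lemma null_face x y (c : cochain K R T) : face x y ->
  null setT (costar x) c -> null setT (costar y) c.
Proof. by move=> xy [e e0 ce]; exists e => //; exact: vanish_sub (costar_face xy) e0. Qed.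

(** As [costar y] is contained in [costar x], cocycles relative to [costar x] are also cocycles
    relative to [costar y]; evaluation on cells turns this identity of cochains into the inclusion
    of local complexes. *)
Lemma local_incl_quasi_iso x y : face x y ->
  (forall q (c : cochain K R T), homog q c -> rcocycle setT (costar x) c ->
     null setT (costar y) c -> null setT (costar x) c) ->
  (forall q (b : cochain K R T), homog q b -> rcocycle setT (costar y) b ->
     exists2 c, homog q c & rcocycle setT (costar x) c /\
       null setT (costar y) (fun k s => c k s - b k s)) ->
  @quasi_iso R (local_cochains R x) (local_cochains R y) (local_incl x y).
Proof.
move=> xy inj surj; split=> [|k]; first exact: local_incl_map.
split=> [a ca ya|b cb].
  have [c [hc cc cE]] := realize_cocycle ca.
  have aE : a = (fun z => c k (chi z)) by apply/funext => z; rewrite cE.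
  rewrite aE; apply/null_evaluate => //; apply: (inj k) => //.
    exact: rcocycle_sub (@costar_skel_costar x k) cc.
  apply/(@null_evaluate y k) => //; last by rewrite -aE.
  exact: rcocycle_sub (costar_skel_face xy) cc.
have [c [hc cc cE]] := realize_cocycle cb.
have bE : b = (fun z => c k (chi z)) by apply/funext => z; rewrite cE.
have [c' hc' [cc' nc']] := surj k c hc (rcocycle_sub (@subset_refl _ _) (@costar_skel_costar y k) cc).
have [c'' hc'' [cc'' nc'']] := cocycle_costar_skel hc' cc'.
exists (fun z => c'' k (chi z)); first exact: evaluate_cocycle.
rewrite (_ : local_incl _ _ _ - b = (fun z => c'' k (chi z) - c k (chi z))); last first.
  by apply/funext => z; rewrite bE.
apply/(@null_evaluate y k (fun k s => c'' k s - c k s)).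
- exact: homogB.
- apply: rcocycleB => //; exact: rcocycle_sub (costar_skel_face xy) cc''.
have [e e0 ce] := nc'; have [g g0 cg] := null_face xy nc''.
exists (fun k s => e k s - g k s) => j s ss; first by rewrite e0 // g0 // subrr.
by rewrite dlB -ce // -cg // opprB [RHS]addrC addrA subrK.
Qed.

End CellularCohomology.

(** * Compact supports and basic neighborhoods *)

Section CompactSupports.
Variables (K : realType) (R : comNzRingType) (T : topologicalType).
Hypothesis hT : hausdorff_space T.
Local Notation Dl := (stdsimplex K).
Implicit Types (A B U V : set T) (c e : cochain K R T).

(** Compactly supported classes of U, represented by cocycles on all of T that vanish off a compact
    subset of U: extension by zero to a larger open set becomes the identity. *)
Definition compact_cocycle U q c : Prop := homog q c /\
  exists B, [/\ compact B, B `<=` U & rcocycle setT (~` B) c].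

Definition compact_null U c : Prop :=
  exists B, [/\ compact B, B `<=` U & null setT (~` B) c].

Lemma dl0 k (s : Dl k -> T) : dl ((fun _ _ => 0) : cochain K R T) s = 0.
Proof. by case: k s => // k s; rewrite dlS big1 // => i _; rewrite mul0rz. Qed.

Lemma null_sub A A' c : A' `<=` A -> null setT A c -> null setT A' c.
Proof. by move=> AA [e e0 ce]; exists e => //; exact: vanish_sub e0. Qed.

Lemma nullB A c c' : null setT A c -> null setT A c' ->
  null setT A (fun k s => c k s - c' k s).
Proof.
move=> [e e0 ce] [g g0 cg]; exists (fun k s => e k s - g k s) => k s ss.
  by rewrite e0 // g0 // subrr.
by rewrite dlB ce // cg.
Qed.

Lemma nullN A c : null setT A c -> null setT A (fun k s => - c k s).
Proof.
have n0 : null setT A ((fun _ _ => 0) : cochain K R T) by exact: null_vanish.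
by move=> n; have [e e0 ce] := nullB n0 n; exists e => // k s ss; rewrite -ce // sub0r.
Qed.

Lemma nullD A c c' : null setT A c -> null setT A c' ->
  null setT A (fun k s => c k s + c' k s).
Proof.
move=> n /nullN n'; have [e e0 ce] := nullB n n'.
by exists e => // k s ss; rewrite -ce // opprK.
Qed.

Lemma null_ext A c c' : (forall k (s : Dl k -> T), c k s = c' k s) ->
  null setT A c -> null setT A c'.
Proof. by move=> E [e e0 ce]; exists e => // k s ss; rewrite -E ce. Qed.

Lemma compact_null_sub U V c : V `<=` U -> compact_null V c -> compact_null U c.
Proof. by move=> VU [B [cB BV nB]]; exists B; split=> //; exact: subset_trans VU. Qed.

Lemma compact_nullB U c c' : compact_null U c -> compact_null U c' -> compact_null U (fun k s => c k s - c' k s).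
Proof.
move=> [B [cB BU nB]] [B' [cB' BU' nB']]; exists (B `|` B'); split.
- exact: compactU.
- by move=> x [/BU|/BU'].
- by apply: nullB; [apply: null_sub nB|apply: null_sub nB'] => x nx Bx; apply: nx; [left|right].
Qed.

Lemma compact_null_ext U c c' : (forall k (s : Dl k -> T), c k s = c' k s) ->
  compact_null U c -> compact_null U c'.
Proof. by move=> E [B [cB BU nB]]; exists B; split=> //; exact: null_ext nB. Qed.

Lemma compact_null_eq U c c' : compact_null U (fun k s => c k s - c' k s) -> compact_null U c' -> compact_null U c.
Proof.
move=> h n'; have n0 : compact_null U (fun _ _ => 0).
  by exists set0; split=> //; [exact: compact0|exact: null_vanish].
apply: compact_null_ext (compact_nullB h (compact_nullB n0 n')) => k s.
by rewrite sub0r opprK subrK.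
Qed.

Section Frozen.
Variable U : set T.
Hypothesis oU : open U.
Local Notation C := (Cc K R U).

Lemma restrictE k (a : singular K T k -> R) (s : singular K T k) : range s `<=` U -> Defs.restrict U a s = a s.
Proof. by move=> sU; rewrite /Defs.restrict asboolT. Qed.

Lemma CcB k a b : @cochains R C k a -> @cochains R C k b -> @cochains R C k (a - b).
Proof.
move=> [aU [B [cB BU aB]]] [bU [B' [cB' BU' bB']]].
have h s : (a - b) s != 0 -> a s != 0 \/ b s != 0.
  rewrite (_ : (a - b) s = a s - b s) //; have [->|] := eqVneq (a s) 0; last by left.
  by rewrite sub0r oppr_eq0; right.
split=> [s /h[/aU|/bU]//|]; exists (B `|` B'); split.
- exact: compactU.
- by move=> x [/BU|/BU'].
- by move=> s /h[/aB|/bB'] [x [xs xB]]; exists x; split=> //; [left|right].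
Qed.

Lemma sdifB k (a b : singular K T k -> R) (s : singular K T k.+1) : sdif (a - b) s = sdif a s - sdif b s.
Proof. by rewrite -sumrB; apply: eq_bigr => i _; rewrite mulrBr. Qed.

Lemma Cc_difB k (a b : gen C k -> R) : dif (a - b) = dif a - dif b :> (gen C k.+1 -> R).
Proof.
apply/funext => s; rewrite /= [RHS](_ : _ = (if `[< range s `<=` U >] then sdif a s else 0) -
  (if `[< range s `<=` U >] then sdif b s else 0)) //.
by case: asboolP => _; rewrite ?sdifB ?subr0.
Qed.

Lemma Cc0 k : @cochains R C k 0.
Proof.
split=> [s|]; first by rewrite eqxx.
by exists set0; split=> //; [exact: compact0|move=> s; rewrite eqxx].
Qed.

Lemma coboundaryB k a b : @coboundary R C k a -> @coboundary R C k b ->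
  @coboundary R C k (a - b).
Proof.
case: k a b => [|k] a b; first by move=> -> ->; rewrite /= subr0.
move=> [a' ca' <-] [b' cb' <-]; exists (a' - b'); [exact: CcB|exact: Cc_difB].
Qed.

Lemma coboundary0 k : @coboundary R C k 0.
Proof.
case: k => [//|k]; exists 0; [exact: Cc0|apply/funext => s].
rewrite /= /sdif big1 ?if_same // => i _; exact: mulr0.
Qed.

Lemma coboundary_sym k a b : @coboundary R C k (a - b) -> @coboundary R C k (b - a).
Proof. by move=> h; rewrite -(opprB a b) -sub0r; apply: coboundaryB => //; exact: coboundary0. Qed.

Lemma coboundary_trans k a b g : @coboundary R C k (a - b) ->
  @coboundary R C k (b - g) -> @coboundary R C k (a - g).
Proof.
move=> h /coboundary_sym h'; have -> : a - g = (a - b) - (g - b).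
  by rewrite opprB addrA subrK.
exact: coboundaryB.
Qed.

Lemma coboundary_eq k a b : @coboundary R C k (a - b) ->
  @coboundary R C k b -> @coboundary R C k a.
Proof.
move=> h hb; have := coboundary_trans (g := 0) h; rewrite !subr0; exact.
Qed.

(** [total w] fails to be a cocycle only on simplices that meet B and leave U; [small2] for U and
    the complement of B corrects it without changing w inside U. *)
Lemma extend_cocycle k w B : compact B -> B `<=` U -> @cocycle R C k w ->
  (forall s, w s != 0 -> range s `&` B !=set0) ->
  exists c, [/\ homog k c, rcocycle setT (~` B) c &
    forall s : singular K T k, range s `<=` U -> c k s = w s].
Proof.
move=> cB BU [[wU _] dw] wB; have cloB : closed B by exact: compact_closed.
have oB : open (~` B) by rewrite openC.
have hw : homog k (total w) := homog_total w.
have w0 : vanish (~` B) (total w).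
  apply: homog_vanish hw _ => s sB; rewrite totalE; apply/eqP; apply: contrapT => /negP/wB.
  by move=> [x [xs xB]]; apply: sB xs xB.
have dwU : vanish (setT `&` U) (dl (total w)).
  apply: homog_vanish (homog_dl hw) _ => s; rewrite setTI => sU.
  have E : sdif w s = 0 by have := congr1 (fun g => g s) dw; rewrite /= asboolT.
  by rewrite -sdifE -[RHS]E; congr (sdif _ s); apply/funext => s'; exact: totalE.
have dwB : vanish (setT `&` ~` B) (dl (total w)).
  by rewrite setTI; exact: dl_vanish.
have cov : setT `<=` U `|` ~` B.
  by move=> x _; have [/BU|] := pselect (B x); [left|right].
have [h [hU hB wh]] := small2 oU oB cov (fun k s _ => dl_dl _ s) dwU dwB.
rewrite !setTI in hU hB.
exists (hpart k (fun j s => total w s - h j s)); split.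
- exact: homog_hpart.
- split=> j s ss; rewrite ?dl_hpart /hpart; case: eqP => // _.
    by rewrite w0 // hB // subrr.
  by rewrite dlB wh // subrr.
- move=> s sU; rewrite /hpart eqxx totalE hU ?subr0 //; exact: sin_singular.
Qed.

(** The primitive b on U, extended by [total], accounts for c inside U. Off the two compact supports
    both c and [dl b] vanish, so [small2] gives a primitive of the difference. *)
Lemma compact_null_coboundary k c B : compact B -> B `<=` U -> homog k c ->
  rcocycle setT (~` B) c ->
  @coboundary R C k (Defs.restrict U (fun s => c k s)) -> compact_null U c.
Proof.
move=> cB BU hc [c0 c1] cb.
have [b [B' [hb cB' BU' b0 cE]]] : exists b B', [/\ homog k.-1 b, compact B', B' `<=` U,
    vanish (~` B') b & vanish U (fun j s => c j s - dl b s)].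
  case: k hc cb => [|k] hc /= cb.
    exists (fun _ _ => 0), set0; split=> //; first exact: compact0.
    apply: (@homog_vanish _ _ _ _ 0) => [j s j0|s sU]; first by rewrite hc // dl0 subr0.
    by rewrite dl0 subr0 -(restrictE (fun s => c _ s) sU) cb.
  have [b [bU [B' [cB' BU' bB']]] bE] := cb; exists (total b), B'.
  have hb := homog_total b; split=> //.
    apply: homog_vanish hb _ => s sB; rewrite totalE; apply/eqP.
    by apply: contrapT => /negP/bB' [x [xs xB]]; apply: sB xs xB.
  apply: (@homog_vanish _ _ _ _ k.+1); first exact: homogB hc (homog_dl hb).
  move=> s sU; have E : sdif b s = c k.+1 s.
    by have := congr1 (fun g => g s) bE; rewrite /= restrictE // asboolT.
  have E' : dl (total b) s = sdif b s.
    by rewrite -sdifE; congr (sdif _ s); apply/funext => s'; exact: totalE.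
  by rewrite E' E subrr.
have oBB : open (~` (B `|` B')).
  by rewrite openC; apply: closedU; exact: compact_closed.
have [||||h [hU hB ch]] := @small2 _ _ _ setT U (~` (B `|` B')) (fun j s => c j s - dl b s) oU oBB.
- by move=> x _; have [[/BU|/BU']|] := pselect ((B `|` B') x); [left|left|right].
- by move=> j s ss; rewrite dlB dl_dl c1 // subrr.
- by rewrite setTI.
- rewrite setTI => j s ss; rewrite c0; last by apply: sin_sub ss => x nx Bx; apply: nx; left.
  by rewrite (dl_vanish b0) ?subrr //; apply: sin_sub ss => x nx Bx; apply: nx; right.
exists (B `|` B'); split=> [||]; [exact: compactU|by move=> x [/BU|/BU']|].
exists (fun j s => b j s + h j s) => j s ss.
  rewrite b0 ?add0r; last by apply: sin_sub ss => x nx Bx; apply: nx; right.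
  by apply: hB; rewrite setTI.
by rewrite dlD -ch // addrC subrK.
Qed.

Lemma cocycle_restrict k c : compact_cocycle U k c -> @cocycle R C k (Defs.restrict U (fun s => c k s)).
Proof.
move=> [_ [B [cB BU [c0 c1]]]]; split.
  split=> [s|]; first by rewrite /Defs.restrict; case: asboolP; rewrite ?eqxx.
  exists B; split=> // s; rewrite /Defs.restrict; case: asboolP => [sU /eqP cs|]; last by rewrite eqxx.
  apply: contrapT => sB; apply: cs; apply: c0; apply: sin_singular => x xs xB.
  by apply: sB; exists x.
apply/funext => s /=; case: asboolP => // sU.
rewrite -[RHS](c1 k.+1 s) -?sdifE; last exact: sin_singular.
apply: eq_bigr => i _; congr (_ * _); rewrite restrictE //.
by move=> x [u _ <-]; apply: sU; exists (coface i u).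
Qed.

Lemma coboundary_compact_null k c : homog k c -> compact_null U c ->
  @coboundary R C k (Defs.restrict U (fun s => c k s)).
Proof.
move=> hc [B [cB BU /(null_homog hc)[e [he _ e0 ce]]]].
have cE (s : singular K T k) : c k s = dl e s by apply: ce; apply: sin_singular.
case: k hc he cE => [|k] hc he cE /=.
  by apply/funext => s; rewrite /Defs.restrict cE; case: asboolP.
exists (Defs.restrict U (fun s => e k s)).
  split=> [s|]; first by rewrite /Defs.restrict; case: asboolP; rewrite ?eqxx.
  exists B; split=> // s; rewrite /Defs.restrict; case: asboolP => [sU /eqP es|]; last by rewrite eqxx.
  apply: contrapT => sB; apply: es; apply: e0; apply: sin_singular => x xs xB.
  by apply: sB; exists x.
apply/funext => s; rewrite /= /Defs.restrict; case: asboolP => // sU.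
rewrite cE -sdifE; apply: eq_bigr => i _; congr (_ * _).
by rewrite asboolT // => x [u _ <-]; apply: sU; exists (coface i u).
Qed.

End Frozen.

Section Refinement.
Variables (A : complex R) (U V : set T).
Variables fU fV : forall k, (gen A k -> R) -> singular K T k -> R.
Hypotheses (oU : open U) (oV : open V) (VU : V `<=` U).
Hypothesis qU : @quasi_iso R A (Cc K R U) fU.
Hypothesis qV : @quasi_iso R A (Cc K R V) fV.
Hypothesis extV : forall k z, @cocycle R A k z -> extends_by_zero V U (fV z) (fU z).

(** The witness of [extends_by_zero] is a cocycle of U supported in V; extended to T it represents
    the images of z in both sets. *)
Lemma refinement_cocycle k z : @cocycle R A k z -> exists2 c, compact_cocycle V k c &
  @coboundary R (Cc K R V) k (Defs.restrict V (fun s => c k s) - fV z) /\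
  @coboundary R (Cc K R U) k (Defs.restrict U (fun s => c k s) - fU z).
Proof.
move=> /extV[w [cw [B [cB BV wB]] wV wU]].
have BU := subset_trans BV VU.
have [c [hc cc cE]] := extend_cocycle oU cB BU cw wB.
exists c; first by split=> //; exists B.
have cEV : Defs.restrict V (fun s => c k s) = Defs.restrict V w.
  apply/funext => s; rewrite /Defs.restrict; case: asboolP => // sV.
  by rewrite cE //; exact: subset_trans sV VU.
have cEU : Defs.restrict U (fun s => c k s) = w.
  apply/funext => s; rewrite /Defs.restrict; case: asboolP => [/cE//|sU].
  by apply/esym/eqP; apply: contrapT => /negP h; apply: sU; exact: cw.1.1 s h.
by rewrite cEV cEU.
Qed.

Lemma refinement_surj q c : compact_cocycle U q c ->
  exists2 c', compact_cocycle V q c' & compact_null U (fun k s => c k s - c' k s).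
Proof.
move=> cc; have [z zc zE] := (qU.2 q).2 _ (cocycle_restrict cc).
have [c' cc' [_ c'U]] := refinement_cocycle zc; exists c' => //.
have [hc [B [cB BU c1]]] := cc; have [hc' [B' [cB' BV c1']]] := cc'.
have sub : B `|` B' `<=` U by move=> x [/BU//|/BV/VU//].
have cBB : rcocycle setT (~` (B `|` B')) (fun k s => c k s - c' k s).
  by apply: rcocycleB; [apply: rcocycle_sub c1|apply: rcocycle_sub c1'] => // x nx Bx; apply: nx; [left|right].
apply: (compact_null_coboundary oU (compactU cB cB') sub (homogB hc hc') cBB).
rewrite (_ : Defs.restrict U _ = Defs.restrict U (fun s => c q s) - Defs.restrict U (fun s => c' q s)).
  by apply: coboundary_sym; exact: coboundary_trans c'U zE.
apply/funext => s; rewrite [RHS](_ : _ = Defs.restrict U (fun s => c q s) s -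
  Defs.restrict U (fun s => c' q s) s) // /Defs.restrict.
by case: asboolP => // _; rewrite subr0.
Qed.

(** The class of c comes from a cocycle z of the model. Its image in U is a coboundary, so z is one
    because [fU] is a quasi-isomorphism, and hence so is its image in V. *)
Lemma refinement_inj q c : compact_cocycle V q c -> compact_null U c -> compact_null V c.
Proof.
move=> cc nc; have [z zc zE] := (qV.2 q).2 _ (cocycle_restrict cc).
have [c' cc' [c'V c'U]] := refinement_cocycle zc.
have [hc [B [cB BV c1]]] := cc; have [hc' [B' [cB' BV' c1']]] := cc'.
have nV : compact_null V (fun k s => c' k s - c k s).
  have sub : B `|` B' `<=` V by move=> x [/BV//|/BV'//].
  have cBB : rcocycle setT (~` (B `|` B')) (fun k s => c' k s - c k s).
    by apply: rcocycleB; [apply: rcocycle_sub c1'|apply: rcocycle_sub c1] => // x nx Bx; apply: nx; [right|left].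
  apply: (compact_null_coboundary oV (compactU cB cB') sub (homogB hc' hc) cBB).
  rewrite (_ : Defs.restrict V _ = Defs.restrict V (fun s => c' q s) - Defs.restrict V (fun s => c q s)).
    exact: coboundary_trans c'V zE.
  apply/funext => s; rewrite [RHS](_ : _ = Defs.restrict V (fun s => c' q s) s -
    Defs.restrict V (fun s => c q s) s) // /Defs.restrict.
  by case: asboolP => // _; rewrite subr0.
have nc' : compact_null U c' := compact_null_eq (compact_null_sub VU nV) nc.
have fz : @coboundary R (Cc K R U) q (fU z).
  by apply: coboundary_eq (coboundary_compact_null hc' nc'); exact: coboundary_sym.
have bz := (qU.2 q).1 z zc fz.
have fVz : @coboundary R (Cc K R V) q (fV z).
  have [f1 fL fd] := qV.1; case: q z zc bz {zE c'V c'U fz cc nc hc c1 cc' hc' c1'} => [|q] z zc.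
    (* In degree 0 coboundaries are 0, and [fV] maps 0 to 0 by linearity with coefficient -1. *)
    move=> z0; have := fL 0%N (-1) z z zc.1 zc.1.
    rewrite (_ : (fun g => _) = z); last by apply/funext => g; rewrite mulN1r addNr z0.
    by move=> ->; apply/funext => g; rewrite mulN1r addNr.
  by move=> [b cb bE]; exists (fV b); [exact: f1|rewrite -fd // bE].
apply: (compact_null_coboundary oV cB BV hc c1); apply: coboundary_eq fVz; exact: coboundary_sym.
Qed.

End Refinement.
End CompactSupports.

(** * Countable bases of neighborhoods and telescopes *)

Section LocalBase.
Variables (K : realType) (T : topologicalType) (X : regular_CW K T).
Local Notation Dl := (stdsimplex K).
Local Notation cell := (cells X).
Hypothesis lc : locally_compact [set: T].

Lemma compact_nbhs p (U : set T) : open U -> U p ->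
  exists C, [/\ compact C, C `<=` U & nbhs p C].
Proof.
move=> oU Up; have [C] := lc (x := p) I; rewrite withinET => nC [cC clC].
have [A nA AU] := compact_regular (hausT X) cC nC (open_nbhs_nbhs (conj oU Up)).
exists (C `&` closure A); split.
- by apply: compact_closedI => //; exact: closed_closure.
- by move=> x [_ /AU].
- by apply: filterI => //; apply: filterS nA; exact: subset_closure.
Qed.

(** Finitely many closed cells contain p, and each has the metric of its simplex. O n removes the
    costar and the points of these cells at distance at least 1 / (n + 1) from p. *)
Lemma nbhd_base p : exists O : nat -> set T, (forall n, open (O n) /\ O n p) /\
  forall Q, closed Q -> ~ Q p ->
    exists n, forall m x, (n <= m)%N -> O m x -> ~ Q x.
Proof.
have [y yp] := cell_of X p.
have /finite_seqP[l lE] := face_finite y lc.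
have lP (c : cell) : c \in l -> cl c p.
  move=> cl_; have : [set c : cell | face c y] c by rewrite lE.
  by move=> /faceE; apply.
pose t (c : cell) := phinv (ch c) p.
have tP (c : cell) : c \in l -> ch c (t c) = p by move=> /lP; exact: phinvK.
pose dist (c : cell) (u : Dl (tag c)) : K := `|set_val u - set_val (t c)|.
pose D (n : nat) (c : cell) : set T := ch c @` [set u | n.+1%:R^-1 <= dist c u].
have cdist (c : cell) : continuous (dist c).
  move=> u; apply: (@continuous_comp _ _ _ (fun u : Dl (tag c) => set_val u - set_val (t c)) (fun v => `|v|)).
    apply: rv_contB; last exact: cst_continuous.
    by move=> v; exact: initial_continuous.
  exact: norm_continuous.
have Dcl (n : nat) (c : cell) : closed (D n c).
  apply: compact_closed; first exact: (hausT X).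
  apply: continuous_compact; first by apply: continuous_subspaceT; exact: ch_continuous.
  apply: (subclosed_compact _ (@simplex_compact K _)) => //.
  rewrite (_ : [set u | _] = dist c @^-1` [set r | n.+1%:R^-1 <= r]) //.
  by apply: preimage_closed; [move=> u _; exact: cdist|exact: closed_ge].
pose O n := ~` (costar y `|` \bigcup_(c in [set` l]) D n c).
exists O; split=> [n|Q cQ Qp].
  split.
    rewrite openC; apply: closedU; first exact: costar_closed.
    by apply: closed_bigcup => [|c _]; [exact: finite_seq|exact: Dcl].
  move=> [/(costarE _ yp)|[c cl_ [u /= Du up]]]; first by apply; exact: face_refl.
  move: Du; rewrite /dist /t -up (phiK (ch_embedding c)) subrr normr0.
  by rewrite leNgt invr_gt0 ltr0n.
have far (c : cell) : c \in l -> exists n, forall u, Q (ch c u) -> n.+1%:R^-1 <= dist c u.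
  move=> cl_; have : nbhs (t c) (ch c @^-1` (~` Q)).
    apply: (@ch_continuous _ _ _ c); rewrite tP //; apply: open_nbhs_nbhs; split=> //.
    by rewrite openC.
  move=> /nbhs_ballP[e /= e0 eQ].
  exists (Num.truncn e^-1) => u Qu; rewrite leNgt; apply/negP => ud.
  apply: (eQ u) Qu; rewrite -[ball _ _ _]/(ball (set_val (t c)) e (set_val u)) -ball_normE /=.
  rewrite distrC; apply: lt_le_trans ud _; rewrite -[leRHS]invrK lef_pV2 ?posrE ?invr_gt0 ?ltr0n //.
  by apply/ltW; rewrite truncnS_gt.
have [n nP] : exists n, forall c, c \in l -> forall u, Q (ch c u) -> n.+1%:R^-1 <= dist c u.
  elim: (l) far => [|c s IH] far; first by exists 0%N.
  have [n1 h1] := far c (mem_head _ _).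
  have [|n2 h2] := IH; first by move=> z zs; apply: far; rewrite inE zs orbT.
  exists (maxn n1 n2) => z; rewrite inE => /predU1P[->|zs] u Qu.
    apply: le_trans (h1 u Qu); rewrite lef_pV2 ?posrE ?ltr0n // ler_nat ltnS; exact: leq_maxl.
  by apply: le_trans (h2 z zs u Qu); rewrite lef_pV2 ?posrE ?ltr0n // ler_nat ltnS; exact: leq_maxr.
exists n => m x nm Ox Qx; have [c cx] := cell_of X x; apply: Ox.
have [cy|ncy] := pselect (face c y); last by left; exists c.
have cl_ : c \in l by have : [set` l] c by rewrite -lE.
right; exists c => //; have [u _ ux] := open_cell_cl cx; exists u => //=.
apply: le_trans (nP c cl_ u _); last by rewrite ux.
by rewrite lef_pV2 ?posrE ?ltr0n // ler_nat ltnS.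
Qed.

End LocalBase.

Section Telescope.
Variables (K : realType) (R : comNzRingType) (T : topologicalType).
Local Notation Dl := (stdsimplex K).
Hypothesis hT : hausdorff_space T.
Variables (p : T) (U : nat -> set T).
Hypothesis U_far : forall Q, closed Q -> ~ Q p ->
  exists n, forall m x, (n <= m)%N -> U m x -> ~ Q x.

(* The sum of the g n is finite on each simplex that misses p. *)
Lemma telescope (c g : nat -> cochain K R T) :
  (forall n, vanish (~` U n) (c n)) -> (forall n, vanish (~` U n) (g n)) ->
  (forall n k (s : Dl k -> T), sin setT s -> c n k s - c n.+1 k s = dl (g n) s) ->
  exists2 G, forall A, (forall n, vanish A (g n)) -> vanish A G &
    vanish (~` [set p]) (fun k s => c 0 k s - dl G s).
Proof.
move=> c0 g0 cg; pose far n k (s : Dl k -> T) := forall m, (n <= m)%N -> range s `<=` ~` U m.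
pose G : cochain K R T := fun k s => if pselect (exists n, far n k s) is left ex
  then \sum_(n < projT1 (cid ex)) g n k s else 0.
have GE n k (s : Dl k -> T) : continuous s -> far n k s -> G k s = \sum_(i < n) g i k s.
  move=> cs fn; rewrite /G; case: pselect => [ex|[]]; last by exists n.
  case: (cid ex) => m /= fm.
  have mono a b : (a <= b)%N -> far a k s -> \sum_(i < a) g i k s = \sum_(i < b) g i k s.
    move=> ab fa; rewrite -(subnKC ab) big_split_ord /= [X in _ + X]big1 ?addr0 // => i _.
    by apply: g0; split=> //; apply: fa; exact: leq_addr.
  by case: (leqP m n) => [|/ltnW] mn; [exact: mono|apply/esym; exact: mono].
exists G => [A gA k s sA|].
  by rewrite /G; case: pselect => // ex; rewrite big1 // => i _; exact: gA.
move=> k s [cs sp].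
have [n fn] : exists n, far n k s.
  have cQ : closed (range s).
    apply: compact_closed => //; apply: continuous_compact; last exact: simplex_compact.
    exact: continuous_subspaceT.
  have [n nP] := U_far cQ (fun sp' => sp _ sp' erefl).
  by exists n => m nm x xs Ux; exact: nP nm Ux xs.
have -> : dl G s = \sum_(i < n) dl (g i) s.
  case: k s cs sp fn => [|k] s cs sp fn; first by rewrite /= big1.
  rewrite dlS; under [RHS]eq_bigr do rewrite dlS.
  rewrite exchange_big; apply: eq_bigr => j _; rewrite -mulrz_suml; congr (_ *~ _).
  apply: GE; first by move=> u; apply: continuous_comp; [exact: coface_continuous|exact: cs].
  by move=> m nm _ [u _ <-]; apply: (fn m nm); exists (coface j u).
have -> : \sum_(i < n) dl (g i) s = c 0 k s - c n k s.
  have := telescope_sumr (fun i => c i k s) (leq0n n); rewrite big_mkord => E.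
  rewrite -[RHS]opprB -E -sumrN; apply: eq_bigr => i _.
  by rewrite opprB -cg.
by rewrite opprB addrC subrK; apply: c0; split=> //; exact: fn.
Qed.

End Telescope.

(** * Cohomology at a point and in its basic neighborhoods *)

Section PointCohomology.
Variables (K : realType) (R : comNzRingType) (T : topologicalType).
Variable X : regular_CW K T.
Local Notation Dl := (stdsimplex K).
Local Notation cell := (cells X).
Implicit Types (U V W : set T) (c e : cochain K R T).
Hypothesis lc : locally_compact [set: T].

Lemma null_hpart A B q c : null B A c -> null B A (hpart q c).
Proof.
move=> [e e0 ce]; case: q => [|q].
  exists (fun _ _ => 0) => // -[|k] s sB; rewrite dl0 /hpart //= ce //.
exists (hpart q e) => k s ss; first by rewrite /hpart e0 // if_same.
by rewrite dl_hpart /hpart ce.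
Qed.

Section Point.
Variables (p : T) (basic : set (set T)).
Hypothesis basic_small : forall W, open W -> W p -> exists V, [/\ basic V, V p & V `<=` W].
Hypothesis basic_open : forall U, basic U -> U p -> open U.
Hypothesis basic_surj : forall U V q c, basic U -> basic V -> V p -> V `<=` U ->
  compact_cocycle U q c -> exists2 c', compact_cocycle V q c' & compact_null U (fun k s => c k s - c' k s).
Hypothesis basic_inj : forall U V q c, basic U -> basic V -> V p -> V `<=` U ->
  compact_cocycle V q c -> compact_null U c -> compact_null V c.

(** C contains all the sets but the first, so that the sum of a telescope still has compact support
    in U. *)
Lemma basic_sequence U : basic U -> U p -> exists Un : nat -> set T,
  [/\ Un 0%N = U, forall n, basic (Un n) /\ Un n p, forall n, Un n.+1 `<=` Un n,
      exists C, [/\ compact C, C `<=` U & forall n, Un n.+1 `<=` C] &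
      forall Q, closed Q -> ~ Q p -> exists n, forall m x, (n <= m)%N -> Un m x -> ~ Q x].
Proof.
move=> bU Up; have [C [cC CU nC]] := compact_nbhs X lc (basic_open bU Up) Up.
have [Q0 [oQ far]] := nbhd_base X lc p.
have /choice[nb nbP] : forall W, exists V, open W -> W p -> [/\ basic V, V p & V `<=` W].
  move=> W; have [[oW Wp]|nW] := pselect (open W /\ W p).
    by have [V VP] := basic_small oW Wp; exists V.
  by exists W => oW Wp; case: nW.
pose Un := fix Un n := if n is n'.+1 then nb (Un n' `&` (Q0 n `&` interior C)) else U.
have UnP n : basic (Un n) /\ Un n p.
  elim: n => [//|n [bn pn]] /=.
  have [||? ? _ //] := nbP (Un n `&` (Q0 n.+1 `&` interior C)); last first.
    by split=> //; split; [exact: (oQ _).2|exact: nbhs_singleton (nbhs_interior nC)].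
  by apply: openI; [exact: basic_open|apply: openI; [exact: (oQ _).1|exact: open_interior]].
have UnS n : Un n.+1 `<=` Un n `&` (Q0 n.+1 `&` interior C).
  have [||_ _ //] := nbP (Un n `&` (Q0 n.+1 `&` interior C)); last first.
    by have [_ ?] := UnP n; split=> //; split; [exact: (oQ _).2|exact: nbhs_singleton (nbhs_interior nC)].
  have [bn pn] := UnP n.
  by apply: openI; [exact: basic_open|apply: openI; [exact: (oQ _).1|exact: open_interior]].
exists Un; split=> //.
- by move=> n x /UnS[].
- by exists C; split=> // n x /UnS[_ [_ /interior_subset]].
- move=> Q cQ Qp; have [n nP] := far Q cQ Qp; exists n.+1 => -[//|m] x nm.
  by move=> /UnS[_ [Ox _]]; apply: nP Ox; exact: ltnW.
Qed.

Section Sequence.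
Variables (U : set T) (Un : nat -> set T) (C : set T) (P : nat -> cochain K R T -> Prop).
Hypothesis Un0 : Un 0%N = U.
Hypotheses (cC : compact C) (CU : C `<=` U) (UnC : forall n, Un n.+1 `<=` C).
Hypothesis Unfar : forall Q, closed Q -> ~ Q p ->
  exists n, forall m x, (n <= m)%N -> Un m x -> ~ Q x.
Hypothesis P_vanish : forall n e, P n e -> vanish (~` Un n) e.
Hypothesis P_step : forall n e, P n e ->
  exists2 e', P n.+1 e' & compact_null (Un n) (fun k s => e k s - e' k s).

(** Dependent choice of cochains supported in smaller and smaller sets, with the primitives of their
    differences. The predicate P is a parameter because [local_surj] moves cocycles and [local_inj]
    moves primitives. *)
Lemma telescope_choice e : P 0 e -> exists G B, [/\ compact B, B `<=` U,
  vanish (~` B) G & vanish (~` [set p]) (fun k s => e k s - dl G s)].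
Proof.
move=> P0; have /choice[step stepP] : forall x : nat * cochain K R T,
    exists r : cochain K R T * cochain K R T * set T, P x.1 x.2 ->
    [/\ P x.1.+1 r.1.1, compact r.2, r.2 `<=` Un x.1, vanish (~` r.2) r.1.2 &
      forall k (s : Dl k -> T), sin setT s -> x.2 k s - r.1.1 k s = dl r.1.2 s].
  move=> [n e'] /=; have [Pe|nP] := pselect (P n e'); last by exists (e', e', set0).
  have [e1 P1 [B [cB BU [g g0 ge]]]] := P_step Pe.
  by exists (e1, g, B).
pose E := fix E n := if n is n'.+1 then (step (n', E n')).1.1 else e.
have PE n : P n (E n) by elim: n => [//|n /(stepP (n, E n))[]].
pose g n := (step (n, E n)).1.2; pose B n := (step (n, E n)).2.
have gP n : [/\ compact (B n), B n `<=` Un n, vanish (~` B n) (g n) &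
    forall k (s : Dl k -> T), sin setT s -> E n k s - E n.+1 k s = dl (g n) s].
  by have [] := stepP (n, E n) (PE n).
have [||G GA Gp] := @telescope K R T (hausT X) p Un Unfar E g _ _ (fun n => let: And4 _ _ _ h := gP n in h).
- by move=> n; exact: P_vanish.
- move=> n; have [_ BU g0 _] := gP n; apply: vanish_sub g0 => x nx Bx; exact: nx (BU _ Bx).
exists G, (B 0%N `|` C); have [cB BU _ _] := gP 0%N; split=> //.
- exact: compactU.
- by move=> x [/BU|/CU]; rewrite ?Un0.
apply: GA => n; have [_ BUn g0 _] := gP n; apply: vanish_sub g0 => x nx Bx; apply: nx.
by case: n BUn Bx => [_ Bx|n BUn Bx]; [left|right; apply: (@UnC n); exact: BUn Bx].
Qed.

End Sequence.

Lemma compact_cocycle_vanish U q c : compact_cocycle U q c -> vanish (~` U) c.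
Proof.
move=> [_ [B [_ BU [c0 _]]]]; apply: vanish_sub c0 => x nx Bx; exact: nx (BU _ Bx).
Qed.

Lemma local_surj U q c : basic U -> U p -> compact_cocycle U q c -> exists c',
  [/\ homog q c', rcocycle setT (~` [set p]) c' & compact_null U (fun k s => c k s - c' k s)].
Proof.
move=> bU Up cc; have [Un [Un0 UnP UnS [C [cC CU UnC]] far]] := basic_sequence bU Up.
have [|n e Pe||G [B [cB BU GB Gp]]] := @telescope_choice U Un C (fun n => compact_cocycle (Un n) q)
  Un0 cC CU UnC far _ _ c.
- by move=> n e; exact: compact_cocycle_vanish.
- have [bn pn] := UnP n; have [bn' pn'] := UnP n.+1.
  exact: basic_surj Pe.
- by rewrite Un0.
have [hc [B' [_ _ [_ c1]]]] := cc.
exists (hpart q (fun k s => c k s - dl G s)); split; first exact: homog_hpart.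
  split=> k s ss; rewrite ?dl_hpart /hpart; case: eqP => // _; first exact: Gp.
  by rewrite dlB dl_dl c1 // subrr.
exists B; split=> //.
have : null setT (~` B) (hpart q (dl G)) by apply: null_hpart; exists G.
apply: null_ext => k s; rewrite /hpart; case: eqP => [_|/eqP kq].
  by rewrite opprB addrC subrK.
by rewrite hc // subr0.
Qed.

(** Here it is a primitive g of c that moves towards p. By injectivity c has a primitive g' in the
    next set. The cocycle g - g' is cohomologous, by surjectivity one degree below, to some z
    supported there, and g' + z is the next primitive. *)
Lemma local_inj U q c : basic U -> U p -> homog q c ->
  rcocycle setT (~` [set p]) c -> compact_null U c -> null setT (~` [set p]) c.
Proof.
move=> bU Up hc cc nc; have [Un [Un0 UnP UnS [C [cC CU UnC]] far]] := basic_sequence bU Up.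
pose P n e := [/\ homog q.-1 e, exists B, [/\ compact B, B `<=` Un n & vanish (~` B) e] &
  forall k (s : Dl k -> T), sin setT s -> c k s = dl e s].
have cyc n : compact_cocycle (Un n) q c.
  split=> //; exists [set p]; split=> //; first exact: compact_set1.
  by move=> _ ->; exact: (UnP n).2.
have [B [cB BU /(null_homog hc)[e [he _ e0 ce]]]] := nc.
have [n g [_ [D [_ DU g0]] _]|n g [hg [D [cD DU g0]] cg]||G [D [cD DU GD Gp]]] :=
  @telescope_choice U Un C P Un0 cC CU UnC far _ _ e.
- by apply: vanish_sub g0 => x nx Dx; exact: nx (DU _ Dx).
- have [bn pn] := UnP n; have [bn' pn'] := UnP n.+1.
  have n1 : compact_null (Un n.+1) c.
    apply: (basic_inj bn bn' pn' (@UnS n) (cyc n.+1)).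
    by exists D; split=> //; exists g.
  have [D' [cD' DU' /(null_homog hc)[g' [hg' _ g0' cg']]]] := n1.
  have zc : compact_cocycle (Un n) q.-1 (fun k s => g k s - g' k s).
    split; first exact: homogB.
    exists (D `|` D'); split; first exact: compactU.
      by move=> x [/DU//|/DU'/UnS].
    split=> k s ss; last by rewrite dlB -cg // -cg' // subrr.
    rewrite g0 ?g0' ?subrr //; apply: sin_sub ss => x nx Dx; apply: nx; by [right|left].
  have [z [hz [D'' [cD'' DU'' [z0 z1]]]] nz] := basic_surj bn bn' pn' (@UnS n) zc.
  exists (fun k s => g' k s + z k s).
    split=> [k s kq||k s ss].
    + by rewrite hg' // hz // addr0.
    + exists (D' `|` D''); split; [exact: compactU|by move=> x [/DU'|/DU'']|].
      move=> k s ss; rewrite g0' ?z0 ?addr0 //; apply: sin_sub ss => x nx Dx; apply: nx; by [left|right].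
    + by rewrite dlD z1 // addr0 cg'.
  by apply: compact_null_ext nz => k s; rewrite opprD addrA.
- by split=> //; exists B; rewrite Un0.
exists (fun k s => e k s - dl G s) => // k s ss.
by rewrite dlB dl_dl subr0 ce.
Qed.

End Point.
End PointCohomology.

(** * Comparison of two cells of the same stratum *)

Section StratumLink.
Variables (K : realType) (R : comNzRingType) (T : topologicalType).
Local Notation Dl := (stdsimplex K).

(* Only the top piece of the filtration, for which U n X_n = U, is used. *)
Lemma link_basic (N : nat) (F : nat -> set T) d S : stratification K R N F ->
  stratum N F d S -> exists basic : set (set T),
  [/\ forall p W, S p -> open W -> W p -> exists V, [/\ basic V, V p & V `<=` W],
      forall p U, S p -> basic U -> U p -> open U,
      forall p U V q (c : cochain K R T), S p -> basic U -> basic V -> V p -> V `<=` U ->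
        compact_cocycle U q c -> exists2 c', compact_cocycle V q c' & compact_null U (fun k s => c k s - c' k s) &
      forall p U V q (c : cochain K R T), S p -> basic U -> basic V -> V p -> V `<=` U ->
        compact_cocycle V q c -> compact_null U c -> compact_null V c].
Proof.
move=> [hT _ [_ FT _ _] _ lk] Sd; have [dN _] := Sd.
have [L [G [Phi [_ _ [basic [f [small nb ext]]]]]]] := lk d S Sd.
have top : (d <= N.-1 < N)%N by lia.
have topS : N.-1.+1 = N by lia.
have nbE p U : S p -> basic U -> U p -> open U /\
    @quasi_iso R (Cc K R (@model K d L G N.-1)) (Cc K R U) (f p U N.-1).
  move=> Sp bU Up; have [oU _ /(_ _ top) + _ _] := nb p U Sp bU Up.
  by rewrite topS FT setIT.
have extE p U V k z : S p -> basic U -> basic V -> V p -> V `<=` U ->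
    @cocycle R (Cc K R (@model K d L G N.-1)) k z ->
    extends_by_zero V U (f p V N.-1 k z) (f p U N.-1 k z).
  move=> Sp bU bV Vp VU cz; have := ext p U V Sp bU bV Vp VU _ _ _ top cz.
  by rewrite topS FT !setIT.
exists basic; split=> // [p U Sp bU Up|p U V q c Sp bU bV Vp VU cc|p U V q c Sp bU bV Vp VU cc nc].
- by have [] := nbE p U Sp bU Up.
- have [oU qU] := nbE p U Sp bU (VU _ Vp); have [oV qV] := nbE p V Sp bV Vp.
  exact: (refinement_surj hT oU VU qU (fun k z => @extE p U V k z Sp bU bV Vp VU) cc).
- have [oU qU] := nbE p U Sp bU (VU _ Vp); have [oV qV] := nbE p V Sp bV Vp.
  exact: (refinement_inj hT oU oV VU qU qV (fun k z => @extE p U V k z Sp bU bV Vp VU) cc nc).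
Qed.

Variable X : regular_CW K T.
Local Notation cell := (cells X).
Implicit Types (x y : cell) (c e : cochain K R T).
Hypothesis lc : locally_compact [set: T].
Hypothesis fin_dim : finite_dimensional X.

Lemma star_to_point y p q c : open_cell y p -> homog q c ->
  rcocycle setT (costar y) c -> exists c', [/\ homog q c', rcocycle setT (~` [set p]) c' &
    null setT (costar y) (fun k s => c k s - c' k s)].
Proof.
move=> yp hc cc.
have [e [_ he e0 ce]] := null_homog hc (acyclic_star lc fin_dim yp (rcocycle_sub (@subsetT _ _) (@subset_refl _ _) cc)).
exists (fun k s => c k s - dl e s); split; first exact: homogB.
  by split=> k s ss; [rewrite ce // subrr|rewrite dlB dl_dl cc.2 // subrr].
by exists e => // k s ss; rewrite opprB addrC subrK.
Qed.

Lemma costar_point y p : open_cell y p -> costar y `<=` ~` [set p].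
Proof.
by move=> yp z /= yz zp; move: yz; rewrite zp => /(costarE _ yp); apply; exact: face_refl.
Qed.

Lemma star_null_point y p c : open_cell y p -> rcocycle setT (~` [set p]) c ->
  null setT (costar y) c -> null setT (~` [set p]) c.
Proof.
move=> yp [c0 _] [e e0 ce].
have [|g g0 eg] := acyclic_star lc fin_dim yp (c := e).
  by split=> // k s ss; rewrite -ce ?c0 //; case: ss.
exists (fun k s => e k s - dl g s) => k s ss; first by rewrite eg // subrr.
by rewrite dlB dl_dl subr0 ce.
Qed.

(** Classes travel between [costar x], the point q of x, the set U, the point p of y and [costar y].
    The passages are compatible because U lies in the star of y: a coboundary with compact support
    in U is one relative to [costar y]. *)
Lemma stratum_quasi_iso (N : nat) (F : nat -> set T) x y : stratification K R N F ->
  face x y -> same_stratum N F x y ->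
  @quasi_iso R (local_cochains R x) (local_cochains R y) (local_incl x y).
Proof.
move=> st xy [S [d Sd] [xS yS]].
have [basic [small op surj inj]] := link_basic st Sd.
pose p := ch y (bary K _); have yp : open_cell y p := open_cell_neq0 y.
have Sp := yS _ yp.
have oW : open (~` costar y) by rewrite openC; exact: costar_closed.
have Wp : (~` costar y) p by move=> /(costarE _ yp); apply; exact: face_refl.
have [U [bU Up UW]] := small p _ Sp oW Wp.
have oU := op p U Sp bU Up.
have [q [xq Uq]] : exists q, open_cell x q /\ U q.
  have := xy p yp; move=> /(_ U (open_nbhs_nbhs (conj oU Up))) [q [xq Uq]].
  by exists q.
have Sq := xS _ xq.
have loc r : S r -> U r -> (forall q c, compact_cocycle U q c -> exists c',
      [/\ homog q c', rcocycle setT (~` [set r]) c' & compact_null U (fun k s => c k s - c' k s)]) /\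
    (forall q c, homog q c -> rcocycle setT (~` [set r]) c -> compact_null U c ->
      null setT (~` [set r]) c).
  move=> Sr Ur; have sm W := small r W Sr; have opr W := op r W Sr.
  have su V W m c := surj r V W m c Sr; have ij V W m c := inj r V W m c Sr.
  by split=> m c; [exact: (local_surj X lc sm opr su bU Ur)|exact: (local_inj X lc sm opr su ij bU Ur)].
have [psurj pinj] := loc p Sp Up; have [qsurj qinj] := loc q Sq Uq.
have pointU r m c : U r -> homog m c -> rcocycle setT (~` [set r]) c -> compact_cocycle U m c.
  move=> Ur hc cc; split=> //; exists [set r]; split=> //; first exact: compact_set1.
  by move=> _ ->.
have nullU_star c : compact_null U c -> null setT (costar y) c.
  move=> [B [_ BU nB]]; apply: null_sub nB => z yz Bz; exact: UW (BU _ Bz) yz.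
have point_nullU r c : U r -> null setT (~` [set r]) c -> compact_null U c.
  move=> Ur nc; exists [set r]; split=> //; first exact: compact_set1.
  by move=> _ ->.
apply: local_incl_quasi_iso => // m c hc cc.
  move=> nc; have [c' [hc' cc' nc']] := star_to_point xq hc cc.
  have ny : null setT (costar y) c'.
    have := nullB nc (null_face xy nc'); apply: null_ext => k s.
    by rewrite opprB addrC subrK.
  have [c'' [hc'' cc'' nU]] := psurj m c' (pointU q m c' Uq hc' cc').
  have ny'' : null setT (costar y) c''.
    have := nullB ny (nullU_star _ nU); apply: null_ext => k s.
    by rewrite opprB addrC subrK.
  have nUc' : compact_null U c'.
    apply: compact_null_eq nU _; apply: point_nullU Up _; exact: star_null_point ny''.
  have nq := qinj m c' hc' cc' nUc'.
  have := nullD nc' (null_sub (costar_point xq) nq); apply: null_ext => k s.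
  by rewrite subrK.
have [b' [hb' cb' nb']] := star_to_point yp hc cc.
have [c' [hc' cc' nU]] := qsurj m b' (pointU p m b' Up hb' cb').
exists c' => //; split.
  by apply: rcocycle_sub cc' => //; exact: costar_point.
have := nullN (nullD nb' (nullU_star _ nU)); apply: null_ext => k s.
by rewrite addrA subrK opprB.
Qed.

End StratumLink.

(** * Localization and strata *)

Section Localization.
Variables (O : Type) (C : category O) (Sigma : forall x y, Defs.hom C x y -> Prop).

Inductive zigzag : O -> O -> Type :=
| zigzag_nil x : zigzag x x
| zigzag_fwd x y z : Defs.hom C x y -> zigzag y z -> zigzag x z
| zigzag_bwd x y z (h : Defs.hom C y x) : Sigma h -> zigzag y z -> zigzag x z.

Fixpoint zigzag_cat x y z (p : zigzag x y) : zigzag y z -> zigzag x z :=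
  match p in zigzag x y return zigzag y z -> zigzag x z with
  | zigzag_nil _ => id
  | zigzag_fwd _ _ _ h p => fun q => zigzag_fwd h (zigzag_cat p q)
  | zigzag_bwd _ _ _ h hS p => fun q => zigzag_bwd hS (zigzag_cat p q)
  end.

Section Evaluation.
Variables (O' : Type) (D : category O') (F0 : O -> O') (F : functor C D F0).
Hypothesis FS : forall x y (h : Defs.hom C x y), Sigma h -> is_iso (F x y h).

Definition inverse_image x y (h : Defs.hom C x y) (hS : Sigma h) : Defs.hom D (F0 y) (F0 x) :=
  projT1 (cid (FS hS)).

Lemma inverse_imageP x y (h : Defs.hom C x y) (hS : Sigma h) :
  Defs.comp (F x y h) (inverse_image hS) = idm D (F0 x) /\
  Defs.comp (inverse_image hS) (F x y h) = idm D (F0 y).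
Proof. exact: projT2 (cid (FS hS)). Qed.

Fixpoint eval x y (p : zigzag x y) : Defs.hom D (F0 x) (F0 y) :=
  match p in zigzag x y return Defs.hom D (F0 x) (F0 y) with
  | zigzag_nil x => idm D (F0 x)
  | zigzag_fwd _ _ _ h p => Defs.comp (F _ _ h) (eval p)
  | zigzag_bwd _ _ _ h hS p => Defs.comp (inverse_image hS) (eval p)
  end.

Lemma eval_cat x y z (p : zigzag x y) (q : zigzag y z) :
  eval (zigzag_cat p q) = Defs.comp (eval p) (eval q).
Proof.
elim: p q => [u|u v w h p IH|u v w h hS p IH] q /=; first by rewrite comp1m.
  by rewrite IH Defs.compA.
by rewrite IH Defs.compA.
Qed.

End Evaluation.

(* The quantification over all functors that invert Sigma saves the description of
   the relations between zigzags. *)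
Definition zigzag_eq x y (p q : zigzag x y) : Prop :=
  forall (O' : Type) (D : category O') (F0 : O -> O') (F : functor C D F0)
    (FS : forall x y (h : Defs.hom C x y), Sigma h -> is_iso (F x y h)),
  eval FS p = eval FS q.

Definition zigzag_class x y : Type :=
  {A : set (zigzag x y) | exists p, A = [set q | zigzag_eq p q]}.

Definition cls x y (p : zigzag x y) : zigzag_class x y :=
  exist _ [set q | zigzag_eq p q] (ex_intro _ p erefl).

Definition repr x y (f : zigzag_class x y) : zigzag x y := projT1 (cid (proj2_sig f)).

Lemma cls_eq x y (p q : zigzag x y) : zigzag_eq p q -> cls p = cls q.
Proof.
move=> pq; apply: eq_exist; rewrite eqEsubset; split=> r /= E O' D F0 F FS.
  by rewrite -E pq.
by rewrite pq E.
Qed.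

Lemma reprK x y (f : zigzag_class x y) : cls (repr f) = f.
Proof. by case: f => A pA; apply: eq_exist; rewrite /repr; case: cid => p /= ->. Qed.

Lemma repr_cls x y (p : zigzag x y) : zigzag_eq (repr (cls p)) p.
Proof.
rewrite /repr; case: cid => q /= E.
have : [set r | zigzag_eq q r] q by [].
by rewrite -E => pq O' D F0 F FS; rewrite pq.
Qed.

Definition class_comp x y z (f : zigzag_class x y) (g : zigzag_class y z) :
  zigzag_class x z := cls (zigzag_cat (repr f) (repr g)).

Lemma class_comp_cls x y z (p : zigzag x y) (q : zigzag y z) :
  class_comp (cls p) (cls q) = cls (zigzag_cat p q).
Proof. by apply: cls_eq => O' D F0 F FS; rewrite !eval_cat !repr_cls. Qed.

Lemma class_comp1m x y (f : zigzag_class x y) : class_comp (cls (zigzag_nil x)) f = f.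
Proof. by rewrite -[f]reprK class_comp_cls. Qed.

Lemma class_compm1 x y (f : zigzag_class x y) : class_comp f (cls (zigzag_nil y)) = f.
Proof.
rewrite -[f]reprK class_comp_cls; apply: cls_eq => O' D F0 F FS.
by rewrite eval_cat /= compm1.
Qed.

Lemma class_compA x y z t (f : zigzag_class x y) (g : zigzag_class y z)
    (h : zigzag_class z t) :
  class_comp f (class_comp g h) = class_comp (class_comp f g) h.
Proof.
rewrite -[f]reprK -[g]reprK -[h]reprK !class_comp_cls; apply: cls_eq => O' D F0 F FS.
by rewrite !eval_cat Defs.compA.
Qed.

Definition localized : category O :=
  Category class_comp1m class_compm1 class_compA.

Lemma localize1 x : cls (zigzag_fwd (idm C x) (zigzag_nil x)) = cls (zigzag_nil x).
Proof. by apply: cls_eq => O' D F0 F FS /=; rewrite fmap1 comp1m. Qed.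

Lemma localizeM x y z (f : Defs.hom C x y) (g : Defs.hom C y z) :
  cls (zigzag_fwd (Defs.comp f g) (zigzag_nil z)) =
  class_comp (cls (zigzag_fwd f (zigzag_nil y))) (cls (zigzag_fwd g (zigzag_nil z))).
Proof.
rewrite class_comp_cls; apply: cls_eq => O' D F0 F FS /=.
by rewrite fmapM !compm1.
Qed.

Definition localize : functor C localized id :=
  @Functor O O C localized id (fun x y h => cls (zigzag_fwd h (zigzag_nil y)))
    localize1 localizeM.

Lemma inverse_uniq (O' : Type) (D : category O') (x y : O') (f : Defs.hom D x y)
    (g g' : Defs.hom D y x) : Defs.comp g f = idm D y -> Defs.comp f g' = idm D x -> g = g'.
Proof. by move=> gf fg; rewrite -[g]compm1 -fg Defs.compA gf comp1m. Qed.

(** For uniqueness: a functor that agrees with F on C sends a formal inverse to an inverse, which is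
    unique, and is then determined by induction on zigzags. *)
Lemma localizedP : is_localization Sigma localize.
Proof.
have bwdP x y (h : Defs.hom C x y) (hS : Sigma h) :
    class_comp (cls (zigzag_fwd h (zigzag_nil y))) (cls (zigzag_bwd hS (zigzag_nil x))) =
      cls (zigzag_nil x) /\
    class_comp (cls (zigzag_bwd hS (zigzag_nil x))) (cls (zigzag_fwd h (zigzag_nil y))) =
      cls (zigzag_nil y).
  rewrite !class_comp_cls; split; apply: cls_eq => O' D F0 F FS /=.
    by rewrite compm1; have [] := inverse_imageP FS hS.
  by rewrite compm1; have [] := inverse_imageP FS hS.
split=> [x y h hS|O' D F0 F FS].
  by exists (cls (zigzag_bwd hS (zigzag_nil x))); exact: bwdP.
have G1 x : eval FS (repr (cls (zigzag_nil x))) = idm D (F0 x) by rewrite repr_cls.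
have GM x y z (f : zigzag_class x y) (g : zigzag_class y z) :
    eval FS (repr (class_comp f g)) = Defs.comp (eval FS (repr f)) (eval FS (repr g)).
  by rewrite repr_cls eval_cat.
exists (@Functor O O' localized D F0 (fun x y s => eval FS (repr s)) G1 GM).
split=> [x y h|G' G'E x y s] /=; first by rewrite repr_cls /= compm1.
rewrite -[s in LHS]reprK; elim: (repr s) => [u|u v w h p IH|u v w h hS p IH] /=.
- exact: (fmap1 G').
- rewrite -IH -G'E -(fmapM G'); congr (G' _ _ _).
  by rewrite /= class_comp_cls.
rewrite -IH (_ : inverse_image FS hS = G' u v (cls (zigzag_bwd hS (zigzag_nil v)))).
  by rewrite -(fmapM G'); congr (G' _ _ _); rewrite /= class_comp_cls.
have [h1 h2] := bwdP _ _ h hS; apply: inverse_uniq (inverse_imageP FS hS).2 _.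
by rewrite -G'E -(fmapM G') /= h1; exact: (fmap1 G').
Qed.

End Localization.

Section Isomorphic.
Variables (O : Type) (C : category O).

Lemma isomorphic_refl x : isomorphic C x x.
Proof. by exists (idm C x), (idm C x); rewrite comp1m. Qed.

Lemma isomorphic_sym x y : isomorphic C x y -> isomorphic C y x.
Proof. by move=> [f [g [fg gf]]]; exists g, f. Qed.

Lemma isomorphic_trans x y z : isomorphic C x y -> isomorphic C y z -> isomorphic C x z.
Proof.
move=> [f [f' [ff' f'f]]] [g [g' [gg' g'g]]]; exists (Defs.comp f g), (Defs.comp g' f'); split.
  by rewrite Defs.compA -(Defs.compA f) gg' compm1.
by rewrite Defs.compA -(Defs.compA g') f'f compm1.
Qed.

End Isomorphic.

(** * Strata as isomorphism classes of cells *)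

Section StrataOrder.
Variables (K : realType) (R : comNzRingType) (T : topologicalType).
Variables (X : regular_CW K T) (N : nat) (F : nat -> set T).
Hypothesis st : stratification K R N F.
Hypothesis cel : cellular X N F.
Local Notation cell := (cells X).
Implicit Types (x y : cell) (S : set T).

Let fr : frontier N F. Proof. by case: st. Qed.

(** The frontier condition compares dimensions both ways, and equal dimensions force equality. *)
Lemma strata_eq S S' : strata N F S -> strata N F S' ->
  S `&` closure S' !=set0 -> S' `&` closure S !=set0 -> S = S'.
Proof.
move=> [d Sd] [d' Sd'] /(fr Sd Sd')[_ dd' E] /(fr Sd' Sd)[_ d'd _].
by apply/E/eqP; rewrite eqn_leq dd' d'd.
Qed.

Lemma strata_meet S S' p : strata N F S -> strata N F S' -> S p -> S' p -> S = S'.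
Proof.
move=> hS hS' Sp S'p; apply: strata_eq => //; exists p; split=> //; exact: subset_closure.
Qed.

Lemma strata_cell S x p : strata N F S -> S p -> open_cell x p -> open_cell x `<=` S.
Proof.
move=> hS; have [A ->] := cel hS; move=> [c Ac cp] xp.
by rewrite -(open_cell_uniq cp xp) => q cq; exists c.
Qed.

Lemma cell_stratum x : exists S, strata N F S /\ open_cell x `<=` S.
Proof.
have xp := open_cell_neq0 x; set p := ch x _ in xp.
have [F0 FN _ _] : filtration N F by case: st.
have [d dN [Fd nFd]] : exists2 d, (d < N)%N & F d.+1 p /\ ~ F d p.
  have : F N p by rewrite FN.
  elim: (N) => [|n IH]; first by rewrite F0.
  move=> Fn; have [/IH[d dn h]|nF] := pselect (F n p); last by exists n.
  by exists d => //; exact: ltnW.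
pose S := connected_component (Defs.layer F d) p.
have hS : strata N F S by exists d; split=> //; exists p.
exists S; split=> //; apply: strata_cell hS _ xp.
exact: connected_component_refl.
Qed.

Lemma same_stratum_trans x y z : same_stratum N F x y -> same_stratum N F y z ->
  same_stratum N F x z.
Proof.
move=> [S hS [xS yS]] [S' hS' [yS' zS']]; exists S => //; split=> //.
by rewrite (strata_meet hS hS' (yS _ (open_cell_neq0 y)) (yS' _ (open_cell_neq0 y))).
Qed.

(* In a stratum, the cells related to x by E form an open set, as each of them has
   a neighbourhood that consists of its cofaces; so do the other cells. *)
Lemma stratum_zigzag (E : cell -> cell -> Prop) :
  (forall x, E x x) -> (forall x y, E x y -> E y x) ->
  (forall x y z, E x y -> E y z -> E x z) ->
  (forall x y, face x y -> same_stratum N F x y -> E x y) ->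
  forall x y, same_stratum N F x y -> E x y.
Proof.
move=> Er Es Et Ef x y [S [d [dN [p lp Sp]]] [xS yS]].
have hS : strata N F S by exists d; split=> //; exists p.
have cS : connected S by rewrite Sp; exact: component_connected.
pose near (P : cell -> Prop) := \bigcup_(c in [set c | open_cell c `<=` S /\ P c]) ~` costar c.
have onear P : open (near P).
  by apply: bigcup_open => c _; rewrite openC; exact: costar_closed.
have nearE P c q : (forall c c', P c -> E c' c -> P c') -> S q -> open_cell c q ->
    near P q <-> P c.
  move=> Pinv Sq cq; split=> [[c' [c'S Pc'] nc]|Pc].
    apply: Pinv Pc' (Ef _ _ _ _).
      by apply: contrapT => ncc; apply: nc; exists c.
    by exists S => //; split=> //; exact: strata_cell hS Sq cq.
  exists c; first by split=> //; exact: strata_cell hS Sq cq.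
  by move=> /(costarE _ cq); apply; exact: face_refl.
have inv1 c c' : E x c -> E c' c -> E x c' by move=> xc /Es; exact: Et.
have inv2 c c' : ~ E x c -> E c' c -> ~ E x c' by move=> nxc c'c xc'; apply: nxc; exact: Et c'c.
have xo := open_cell_neq0 x; have yo := open_cell_neq0 y.
have : S `&` near (E x) = S.
  apply: cS.
  - exists (ch x (bary K _)); split; first exact: xS.
    by apply/(nearE _ _ _ inv1 (xS _ xo) xo).
  - by exists (near (E x)).
  exists (~` near (fun c => ~ E x c)); first by rewrite closedC.
  rewrite eqEsubset; split=> q [Sq]; have [c cq] := cell_of X q.
    move=> /(nearE _ _ _ inv1 Sq cq) xc; split=> //.
    by move=> /(nearE _ _ _ inv2 Sq cq).
  move=> nq; split=> //; apply/(nearE _ _ _ inv1 Sq cq); apply: contrapT => nxc.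
  by apply: nq; apply/(nearE _ _ _ inv2 Sq cq).
move=> SE; have : (S `&` near (E x)) (ch y (bary K _)) by rewrite SE; exact: yS.
by move=> [Sq /(nearE _ _ _ inv1 Sq yo)].
Qed.

Lemma sub_closure_trans (A B D : set T) : B `<=` closure A -> D `<=` closure B ->
  D `<=` closure A.
Proof.
move=> AB BD; apply: subset_trans BD _.
by rewrite [X in _ `<=` X](closure_id _).1; [exact: closureS|exact: closed_closure].
Qed.

(** A preorder on all subsets of T; on strata it is antisymmetric by [strata_eq]. *)
Definition closure_order : category (set T) :=
  @Category (set T) (fun A B => B `<=` closure A) (@subset_closure T) sub_closure_trans
    (fun _ _ _ => Prop_irrelevance _ _) (fun _ _ _ => Prop_irrelevance _ _)
    (fun _ _ _ _ _ _ _ => Prop_irrelevance _ _).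

Lemma closure_order_thin A B (f g : Defs.hom closure_order A B) : f = g.
Proof. exact: (@Prop_irrelevance (B `<=` closure A) f g). Qed.

Definition stratum_of x : set T := projT1 (cid (cell_stratum x)).

Lemma stratum_ofP x : strata N F (stratum_of x) /\ open_cell x `<=` stratum_of x.
Proof. exact: projT2 (cid (cell_stratum x)). Qed.

Lemma stratum_of_face x y : face x y -> stratum_of y `<=` closure (stratum_of x).
Proof.
move=> xy; have [[d xS] xo] := stratum_ofP x; have [[d' yS] yo] := stratum_ofP y.
have [|//] := fr yS xS; exists (ch y (bary K _)); have yy := open_cell_neq0 y.
by split; [exact: yo|exact: closureS xo _ (xy _ yy)].
Qed.

Definition stratum_functor : functor (Fc X) closure_order stratum_of :=
  @Functor cell (set T) (Fc X) closure_order stratum_of stratum_of_face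
    (fun _ => closure_order_thin _ _) (fun _ _ _ _ _ => closure_order_thin _ _).

Lemma stratum_of_eq x y : same_stratum N F x y <-> stratum_of x = stratum_of y.
Proof.
have [xS xo] := stratum_ofP x; have [yS yo] := stratum_ofP y; split=> [[S hS [xS' yS']]|E].
  have xx := open_cell_neq0 x; have yy := open_cell_neq0 y.
  by rewrite (strata_meet xS hS (xo _ xx) (xS' _ xx)) (strata_meet yS hS (yo _ yy) (yS' _ yy)).
by exists (stratum_of x) => //; split=> //; rewrite E.
Qed.

Lemma stratum_isomorphic x y :
  isomorphic (localized (fun (x y : cell) (_ : Defs.hom (Fc X) x y) =>
    face x y /\ same_stratum N F x y)) x y <-> same_stratum N F x y.
Proof.
set Sigma := fun (x y : cell) (_ : Defs.hom (Fc X) x y) => _.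
split=> [[f [g _]]|].
  have [_ /(_ _ closure_order _ stratum_functor)[|G _]] := localizedP Sigma.
    move=> u v h [_ /stratum_of_eq uv].
    have vu : stratum_of u `<=` closure (stratum_of v).
      by rewrite uv; exact: subset_closure.
    by exists vu; split; exact: closure_order_thin.
  apply/stratum_of_eq; have [xS xo] := stratum_ofP x; have [yS yo] := stratum_ofP y.
  (* G turns f and its inverse into inclusions of each stratum in the closure of the other. *)
  have /= yx := G _ _ f; have /= xy := G _ _ g.
  apply: strata_eq => //.
    by exists (ch x (bary K _)); have := xo _ (open_cell_neq0 x); split=> //; exact: xy.
  by exists (ch y (bary K _)); have := yo _ (open_cell_neq0 y); split=> //; exact: yx.
move: x y; apply: stratum_zigzag.
- exact: isomorphic_refl.
- exact: isomorphic_sym.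
- exact: isomorphic_trans.
move=> u v uv su; have [inv _] := localizedP Sigma.
by exists (localize Sigma u v uv); apply: inv.
Qed.

End StrataOrder.

Theorem theorem1p1 (K : realType) (R : comNzRingType) (T : topologicalType)
  (X : regular_CW K T)
  (fin_dim : finite_dimensional X) (loc_cpt : locally_compact [set: T])
  (N : nat) (F : nat -> set T) (canF : canonical_stratification R X N F) :
  exists W : cells X -> cells X -> Prop,
    [/\ forall x y, W x y ->
          face x y /\
          @quasi_iso R (local_cochains R x) (local_cochains R y)
            (local_incl x y),
        forall x y z, W x y -> W y z -> W x z
      & exists (S : category (cells X)) (Q : functor (Fc X) S id),
          is_localization (fun x y _ => W x y) Q /\
          forall x y, same_stratum N F x y <-> isomorphic S x y].
Proof.
have [st cel _] := canF.
exists (fun x y => face x y /\ same_stratum N F x y); split.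
- by move=> x y [xy sxy]; split=> //; exact (stratum_quasi_iso loc_cpt fin_dim st xy sxy).
- move=> x y z [xy sxy] [yz syz]; split; first exact: face_trans xy yz.
  exact (same_stratum_trans st sxy syz).
pose Sigma (x y : cells X) (_ : Defs.hom (Fc X) x y) := face x y /\ same_stratum N F x y.
exists (localized Sigma), (localize Sigma); split; first exact: localizedP.
by move=> x y; split=> /(stratum_isomorphic st cel).
Qed.
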